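(* Let $(q(t),p(t),\psi(t))$ be a projective rolling curve, i.e. a parametrized curve in $\mathcal{PC}$, with $q(t),p(t)$ regular and without inflection points. Then $(q(t),p(t),\psi(t))$ satisfies the no-slip and no-twist condition if and only if $(q(t),p(t))$ is a null curve in $(M^4,[\mathbf g])$ with parallel self-dual tangent null 2-plane. Equivalently, $(q(t),p(t))$ is the projection via $Q^5\to M^4$ of an integral curve of $(Q^5,\mathcal D)$.
   Context: Basic objects. Columns $\mathbf q\in\mathbb R^3$, rows $\mathbf p\in(\mathbb R^3)^*$, $\mathbf p\mathbf q=p_iq^i$, $(\mathbf v\times\mathbf w)_i=\epsilon_{ijk}v^jw^k$ on $\mathbb R^3$. $\mathbb{RP}^2=\mathbb P(\mathbb R^3)$; $\mathbb{RP}^{2*}=\mathbb P((\mathbb R^3)^* )$ is the set of lines of $\mathbb{RP}^2$; the point $[\mathbf q]$ lies on the line $[\mathbf p]$ iff $\mathbf p\mathbf q=0$. $M^4\subset\mathbb{RP}^2\times\mathbb{RP}^{2*}$: non-incident pairs. $Q^5=\{\mathbf p\mathbf q=1\}\subset\mathbb R^3\oplus(\mathbb R^3)^*$, $\Pi:Q^5\to M^4$, $(\mathbf q,\mathbf p)\mapsto([\mathbf q],[\mathbf p])$. $\mathcal D=\ker(d\mathbf p-\mathbf q\times d\mathbf q)\subset TQ^5$; integral curves satisfy $\mathbf p'=\mathbf q\times\mathbf q'$. The dancing metric $\mathbf g$ on $M^4$ is the unique metric of signature $(2,2)$ making $\Pi$ a pseudo-riemannian submersion, $Q^5$ carrying the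 restriction of $-2\,d\mathbf p\,d\mathbf q$; $[\mathbf g]$ is its conformal class. $M^4$ is oriented by bases $(v_1,v_2,Kv_1,Kv_2)$, $K(q',p')=(q',-p')$ on $T_q\mathbb{RP}^2\oplus T_p\mathbb{RP}^{2*}$. A null 2-plane is self-dual if the 2-form $\theta^1\wedge\theta^2$, with $\theta^1,\theta^2$ a basis of its annihilator, is self-dual; each null line lies in a unique self-dual null 2-plane, so a null curve has a well-defined self-dual tangent null 2-plane field, and ''parallel'' is with respect to the Levi-Civita connection of $\mathbf g$. Projective contact. For $(q,p)\in M^4$, $\Psi_{q,p}:\mathbb P(T_q\mathbb{RP}^2)\to\mathbb P(T_p\mathbb{RP}^{2*})$ sends a line $\ell$ through $q$ to the point $\ell\cap p$, where $\mathbb P(T_q\mathbb{RP}^2)$ is identified with the set of lines through $q$ and $\mathbb P(T_p\mathbb{RP}^{2*})$ with the set of points on the line $p$. $\mathcal{PC}$ is the space of triples $(q,p,\psi)$ with $(q,p)\in M^4$ and $\psi:T_q\mathbb{RP}^2\to T_p\mathbb{RP}^{2*}$ a linear isomorphism with projectivization $\Psi_{q,p}$. No-slip condition: $\psi(t)q'(t)=p'(t)$ for all $t$. Parallel transport of lines along a curve. Let $\gamma$ be a regular curve without inflection points (points where the tangent line has contact of order at least 2) in a projective plane. For $q\in\gamma$ the osculating conic $\mathcal C_q$ is the unique conic tangent to $\gamma$ to order 4 at $q$. On $\mathcal C_\gamma=\{(q,x)\mid q\in\gamma,\ x\in\mathcal C_q\}\to\gamma$ there is a projective connection (a line field transverse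 to the fibers whose parallel transport identifies fibers projectively) whose horizontal curves, over a parametrization $q(t)$ of $\gamma$, are the curves $(q(t),x(t))$, $x(t)\in\mathcal C_{q(t)}$, such that $x(t)$ is tangent to the line joining $x(t)$ and $q(t)$. Identify $\mathcal C_q$ with the space of lines through $q$, i.e. with $\mathbb P$ of the tangent space at $q$, by sending $x\ne q$ to the line $xq$ and $q$ itself to the tangent line of $\gamma$ at $q$. This transfers the connection to the projectivized tangent bundle of the plane restricted to $\gamma$; parallel sections along $\gamma$ refer to it. The same construction applies to curves in $\mathbb{RP}^{2*}$, viewed as a projective plane. No-twist condition: if $u(t)$ is a parallel section of $\mathbb P(T\mathbb{RP}^2)$ along $q(t)$, then $\psi(t)u(t)$ is a parallel section of $\mathbb P(T\mathbb{RP}^{2*})$ along $p(t)$.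
   Formalization: In the ''if'' direction ψ is not arbitrary (2ψ would break no-slip): some ψ over (q,p) satisfies no-slip and no-twist, and the given ψ, if no-slip, is no-twist. M^4 is oriented by bases (v1,v2,Kv1,Kv2) with v1,v2 spanning a positive definite plane. *)

(* Defs.v *)
From mathcomp Require Import all_boot all_order all_algebra.
From mathcomp Require Import all_classical all_reals all_analysis.
From mathcomp Require Import ring.

Set Implicit Arguments.
Unset Strict Implicit.
Unset Printing Implicit Defensive.

Import Order.TTheory GRing.Theory Num.Theory.
Import numFieldNormedType.Exports.

Local Open Scope ring_scope.
Local Open Scope classical_set_scope.

(* Points and lines of the projective plane are given by homogeneous
   coordinates: a point [q] by a nonzero column, a line [p] by a nonzero row.
   A curve in the plane, over an open interval, is given by a smooth lift.
   The tangent space of the plane at [q] is R^3 / R q (this identification uses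
   the representative q): a tangent vector is given by a column modulo q, and
   the velocity of [q(t)] is the class of q'(t).  Likewise for the dual plane
   with rows.  When a construction is made for curves of columns, it is applied
   to a curve of rows after transposition. *)

Section ProjectivePlane.
Variable R : realType.
Implicit Types (q v w x : 'cV[R]_3) (p l : 'rV[R]_3).

Definition pairing p q : R := (p *m q) 0 0.

(* (v x w)_i = eps_ijk v^j w^k, with indices in Z/3. *)
Definition cross v w : 'rV[R]_3 :=
  \row_i (v (i + 1) 0 * w (i + 2%:R) 0 - v (i + 2%:R) 0 * w (i + 1) 0).

Definition dcross p l : 'cV[R]_3 := (cross p^T l^T)^T.

Definition projeq (V : lmodType R) (x y : V) : Prop :=
  exists2 a : R, a != 0 & x = a *: y.

Definition same_tangent (V : lmodType R) (z v w : V) : Prop :=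
  exists a : R, v - w = a *: z.

End ProjectivePlane.

Section Curves.
Variable R : realType.
Implicit Types (I : set R) (t : R).

Definition smooth_on (V : normedModType R) I (f : R -> V) : Prop :=
  forall n t, I t -> derivable (derive1n n f) t 1.

Definition regular_on I (c : R -> 'cV[R]_3) : Prop :=
  forall t, I t -> ~ same_tangent (c t) (derive1 c t) 0.

Definition vanishes_to_order (f : R -> R) t (k : nat) : Prop :=
  forall j, (j <= k)%N -> derive1n j f t = 0.

(* A line meeting the curve with contact of order >= 2 has contact of order
   >= 1, so it is the tangent line when the curve is regular. *)
Definition inflection (c : R -> 'cV[R]_3) t : Prop :=
  exists2 l : 'rV[R]_3, l != 0 & vanishes_to_order (fun s => pairing l (c s)) t 2.

Definition no_inflection_on I (c : R -> 'cV[R]_3) : Prop :=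
  forall t, I t -> ~ inflection c t.

End Curves.

Section ParallelTransport.
Variable R : realType.
Implicit Types (I : set R) (t : R) (c x u : R -> 'cV[R]_3).

(* A conic is the zero set of a nondegenerate quadratic form. *)
Definition osculating_conic c t (A : 'M[R]_3) : Prop :=
  [/\ A^T = A, A \in unitmx
    & vanishes_to_order (fun s => pairing ((c s)^T *m A) (c s)) t 4].

Definition on_osculating_conic c t (y : 'cV[R]_3) : Prop :=
  exists2 A, osculating_conic c t A & pairing (y^T *m A) y = 0.

(* The line joining x(t) and c(t) only exists where x(t) != c(t); there, x must
   be tangent to it.  A horizontal curve of the connection, being transverse to
   the curve x = c of the total space, may cross it, but the set of times where
   x = c has empty interior; for smooth x the condition at those times then
   follows by continuity. *)
Definition horizontal I c x : Prop :=
  [/\ smooth_on I x,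
      forall t, I t -> x t != 0 /\ on_osculating_conic c t (x t),
      forall t, I t -> ~ projeq (x t) (c t) ->
        exists a b : R, derive1 x t = a *: x t + b *: c t
    & forall t, I t -> ~ (\forall s \near t, projeq (x s) (c s))].

(* The line through c(t) with direction v corresponds to the point y of the
   osculating conic at c(t). *)
Definition conic_direction c t (y v : 'cV[R]_3) : Prop :=
  [/\ ~ same_tangent (c t) v 0,
      ~ projeq y (c t) -> exists a b : R, y = a *: c t + b *: v
    & projeq y (c t) -> exists a b : R, v = a *: c t + b *: derive1 c t].

(* u(t) is any representative of the section of the projectivized tangent
   bundle along c. *)
Definition parallel_section I c u : Prop :=
  exists2 x, horizontal I c x & forall t, I t -> conic_direction c t (x t) (u t).

End ParallelTransport.

Section Rolling.
Variable R : realType.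
Implicit Types (I : set R) (t : R) (q : R -> 'cV[R]_3) (p : R -> 'rV[R]_3).

(* A 3 x 3 matrix m represents, when it maps R q into R p, the linear map
   R^3 / R q -> (R^3)^* / R p given by the class of lin m v. *)
Definition lin (m : 'M[R]_3) (v : 'cV[R]_3) : 'rV[R]_3 := (m *m v)^T.

(* ([q], [p], m) is in PC.  The line through [q] in the direction v is
   [cross q v]; it meets [p] in [dcross (cross q v) p].  A direction l at [p],
   i.e. the pencil of lines spanned by p and l, is identified with the base
   point [dcross p l] of the pencil, which is on [p]. *)
Definition in_PC (q : 'cV[R]_3) (p : 'rV[R]_3) (m : 'M[R]_3) : Prop :=
  [/\ pairing p q != 0,
      same_tangent p (lin m q) 0,
      forall v, same_tangent p (lin m v) 0 -> same_tangent q v 0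
    & forall v, ~ same_tangent q v 0 ->
        projeq (dcross p (lin m v)) (dcross (cross q v) p)].

Definition rolling_curve I q p (psi : R -> 'M[R]_3) : Prop :=
  [/\ smooth_on I q, smooth_on I p, smooth_on I psi
    & forall t, I t -> in_PC (q t) (p t) (psi t)].

Definition no_slip I q p (psi : R -> 'M[R]_3) : Prop :=
  forall t, I t -> same_tangent (p t) (lin (psi t) (derive1 q t)) (derive1 p t).

Definition no_twist I q p (psi : R -> 'M[R]_3) : Prop :=
  forall u : R -> 'cV[R]_3, parallel_section I q u ->
    parallel_section I (fun t => (p t)^T) (fun t => (lin (psi t) (u t))^T).

End Rolling.

Section DancingMetric.
Variable R : realType.
Implicit Types (z u v : 'cV[R]_3 * 'rV[R]_3).

(* The bilinear form of the quadratic form -2 dp dq. *)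
Definition neutral u v : R := - (pairing u.2 v.1 + pairing v.2 u.1).

Definition Q5 z : Prop := pairing z.2 z.1 = 1.

Definition tangent_Q5 z u : Prop := pairing u.2 z.1 + pairing z.2 u.1 = 0.

(* Spans the kernel of d Pi at z: the fibre through z is {(a q, a^-1 p)}. *)
Definition fibre_dir z : 'cV[R]_3 * 'rV[R]_3 := (z.1, - z.2).

(* z = (q, p) is any pair of homogeneous coordinates of a point of M^4, and u
   represents a tangent vector at this point, its components being taken modulo
   q and p.  The result is the horizontal lift of this vector to the point
   (q, p / (p q)) of Q^5: tangent to Q^5 and orthogonal to the fibre. *)
Definition horizontal_lift z u : 'cV[R]_3 * 'rV[R]_3 :=
  let r := pairing z.2 z.1 in
  (u.1 - (pairing z.2 u.1 / r) *: z.1,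
   r^-1 *: (u.2 - (pairing u.2 z.1 / r) *: z.2)).

Definition dancing z u v : R :=
  neutral (horizontal_lift z u) (horizontal_lift z v).

Lemma pairingE (p : 'rV[R]_3) (q : 'cV[R]_3) :
  pairing p q = \sum_i p 0 i * q i 0.
Proof. by rewrite /pairing mxE. Qed.

Lemma pairingDl (p l : 'rV[R]_3) (q : 'cV[R]_3) :
  pairing (p + l) q = pairing p q + pairing l q.
Proof. by rewrite /pairing mulmxDl mxE. Qed.

Lemma pairingDr (p : 'rV[R]_3) (q v : 'cV[R]_3) :
  pairing p (q + v) = pairing p q + pairing p v.
Proof. by rewrite /pairing mulmxDr mxE. Qed.

Lemma pairingZl (a : R) (p : 'rV[R]_3) (q : 'cV[R]_3) :
  pairing (a *: p) q = a * pairing p q.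
Proof. by rewrite /pairing -scalemxAl mxE. Qed.

Lemma pairingZr (a : R) (p : 'rV[R]_3) (q : 'cV[R]_3) :
  pairing p (a *: q) = a * pairing p q.
Proof. by rewrite /pairing -scalemxAr mxE. Qed.

Lemma pairingNl (p : 'rV[R]_3) (q : 'cV[R]_3) : pairing (- p) q = - pairing p q.
Proof. by rewrite -scaleN1r pairingZl mulN1r. Qed.

Lemma pairingNr (p : 'rV[R]_3) (q : 'cV[R]_3) : pairing p (- q) = - pairing p q.
Proof. by rewrite -scaleN1r pairingZr mulN1r. Qed.

Definition pairing_lin :=
  (pairingDl, pairingDr, pairingZl, pairingZr, pairingNl, pairingNr).

(* dancing does not depend on the representatives chosen, and it makes Pi a
   pseudo-riemannian submersion: these two lemmas characterize it. *)
Lemma dancing_rep z u v (a b c d e f : R) :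
    pairing z.2 z.1 != 0 -> a != 0 -> b != 0 ->
  dancing (a *: z.1, b *: z.2)
    (a *: u.1 + c *: z.1, b *: u.2 + d *: z.2)
    (a *: v.1 + e *: z.1, b *: v.2 + f *: z.2) = dancing z u v.
Proof.
move=> r0 a0 b0; rewrite /dancing /neutral /horizontal_lift /= !pairing_lin.
by field; rewrite r0 a0 b0.
Qed.

Lemma dancing_submersion z u v :
    Q5 z -> tangent_Q5 z u -> tangent_Q5 z v ->
    neutral u (fibre_dir z) = 0 -> neutral v (fibre_dir z) = 0 ->
  dancing z u v = neutral u v.
Proof.
have perp w : tangent_Q5 z w -> neutral w (fibre_dir z) = 0 ->
    pairing z.2 w.1 = 0 /\ pairing w.2 z.1 = 0.
  rewrite /tangent_Q5 /neutral /= pairingNl => /eqP.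
  rewrite addr_eq0 => /eqP -> /eqP; rewrite oppr_eq0 -opprD oppr_eq0 -mulr2n.
  by rewrite mulrn_eq0 /= => /eqP ->; rewrite oppr0.
rewrite /Q5 => z1 zu zv /perp-/(_ zu)[u1 u2] /perp-/(_ zv)[v1 v2].
rewrite /dancing /neutral /horizontal_lift /= z1 u1 u2 v1 v2.
by rewrite !mul0r !scale0r !subr0 invr1 !scale1r.
Qed.

End DancingMetric.

Section LocalGeometry.
Variable R : realType.

(* Levi-Civita connection of the metric G on an open subset of R^n. *)
Definition christoffel n (G : 'rV[R]_n -> 'M[R]_n) (x : 'rV[R]_n) (k i j : 'I_n) : R :=
  2^-1 * \sum_l invmx (G x) k l *
    ('D_(delta_mx 0 i) (fun y => G y j l) x
     + 'D_(delta_mx 0 j) (fun y => G y i l) x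
     - 'D_(delta_mx 0 l) (fun y => G y i j) x).

Definition covariant n (G : 'rV[R]_n -> 'M[R]_n) (x V : R -> 'rV[R]_n) (t : R) :
    'rV[R]_n :=
  derive1 V t +
  \row_k \sum_i \sum_j christoffel G (x t) k i j * derive1 x t 0 i * V t 0 j.

(* 2-forms are given by their antisymmetric matrices of coefficients. *)
Definition wedge n (a b : 'rV[R]_n) : 'M[R]_n := a^T *m b - b^T *m a.

Definition eps4 (i j k l : 'I_(2 + 2)) : R :=
  \det (\matrix_(a < 2 + 2, b < 2 + 2) (tnth [tuple i; j; k; l] a == b)%:R).

(* Hodge star on 2-forms for the metric matrix G and the orientation of the
   basis formed by the rows of e:
   ( *w)_ij = 1/2 vol_klij w^kl,  vol_klij = +-sqrt |det G| eps_klij. *)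
Definition hodge (G e w : 'M[R]_(2 + 2)) : 'M[R]_(2 + 2) :=
  \matrix_(i, j) (2^-1 * Num.sg (\det e) * Num.sqrt `|\det G| *
    \sum_k \sum_l eps4 k l i j * (invmx G *m w *m (invmx G)^T) k l).

End LocalGeometry.

Section M4Charts.
Variable R : realType.
Implicit Types (k : 'I_3 * 'I_3) (x : 'rV[R]_(2 + 2)) (W : 'M[R]_(2, 2 + 2)).

Definition affine_point (i : 'I_3) (y : 'rV[R]_2) : 'cV[R]_3 :=
  \col_j oapp (y 0) 1 (unlift i j).

Definition affine_coord (i : 'I_3) (v : 'cV[R]_3) : 'rV[R]_2 :=
  \row_j (v (lift i j) 0 / v i 0).

(* The nine affine charts of M^4: for k = (i, j), the chart defined by
   q_i != 0 and p_j != 0, normalized to q_i = p_j = 1. *)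
Definition in_chart k (q : 'cV[R]_3) (p : 'rV[R]_3) : Prop :=
  q k.1 0 != 0 /\ p 0 k.2 != 0.

Definition chart k (q : 'cV[R]_3) (p : 'rV[R]_3) : 'rV[R]_(2 + 2) :=
  row_mx (affine_coord k.1 q) (affine_coord k.2 p^T).

Definition unchart k x : 'cV[R]_3 * 'rV[R]_3 :=
  (affine_point k.1 (lsubmx x), (affine_point k.2 (rsubmx x))^T).

(* unchart is affine; this is its linear part. *)
Definition dunchart k x : 'cV[R]_3 * 'rV[R]_3 := unchart k x - unchart k 0.

Definition gram k x : 'M[R]_(2 + 2) :=
  \matrix_(a, b) dancing (unchart k x)
    (dunchart k (delta_mx 0 a)) (dunchart k (delta_mx 0 b)).

Definition Kmx : 'M[R]_(2 + 2) := block_mx 1%:M 0 0 (- 1%:M).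

Definition positive_definite (n : nat) (S : 'M[R]_n) : Prop :=
  forall a : 'rV[R]_n, a != 0 -> 0 < (a *m S *m a^T) 0 0.

(* A basis (v1, v2, K v1, K v2) of the tangent space in which the rows v1, v2 of
   V span a positive definite plane.  All such bases define the same
   orientation, which is not the case without this restriction on v1, v2. *)
Definition oriented_basis (G : 'M[R]_(2 + 2)) (e : 'M[R]_(2 + 2)) : Prop :=
  exists2 V : 'M[R]_(2, 2 + 2),
    positive_definite (V *m G *m V^T) & e = col_mx V (V *m Kmx).

(* The plane spanned by the rows of W. *)
Definition null_plane (G : 'M[R]_(2 + 2)) W : Prop :=
  row_free W /\ W *m G *m W^T = 0.

Definition self_dual_plane (G : 'M[R]_(2 + 2)) W : Prop :=
  exists theta : 'M[R]_(2, 2 + 2),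
    [/\ row_free theta, theta *m W^T = 0
      & exists2 e, oriented_basis G e
        & let w := wedge (row 0 theta) (row 1 theta) in hodge G e w = w].

End M4Charts.

Section CurvesInM4.
Variable R : realType.
Implicit Types (I : set R) (q : R -> 'cV[R]_3) (p : R -> 'rV[R]_3).

Definition null_curve I q p : Prop :=
  forall t, I t ->
    dancing (q t, p t) (derive1 q t, derive1 p t) (derive1 q t, derive1 p t) = 0.

(* The plane field is given in each chart by a smooth frame W; it is parallel
   iff it contains the covariant derivatives of its sections. *)
Definition parallel_self_dual_tangent_plane I q p : Prop :=
  forall k : 'I_3 * 'I_3,
    let J := I `&` [set t | in_chart k (q t) (p t)] in
    let x := fun t => chart k (q t) (p t) in
    exists2 W : R -> 'M[R]_(2, 2 + 2), smooth_on J W &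
      forall t, J t ->
        [/\ null_plane (gram k (x t)) (W t),
            self_dual_plane (gram k (x t)) (W t),
            (derive1 x t <= W t)%MS
          & forall a : 'I_2,
              (covariant (gram k) x (fun s => row a (W s)) t <= W t)%MS].

Definition null_with_parallel_plane I q p : Prop :=
  null_curve I q p /\ parallel_self_dual_tangent_plane I q p.

Definition integral_curve_D I (Q : R -> 'cV[R]_3) (P : R -> 'rV[R]_3) : Prop :=
  [/\ smooth_on I Q, smooth_on I P
    & forall t, I t -> Q5 (Q t, P t) /\ derive1 P t = cross (Q t) (derive1 Q t)].

Definition projects_from_integral_curve I q p : Prop :=
  exists Q P, integral_curve_D I Q P /\
    forall t, I t -> projeq (Q t) (q t) /\ projeq (P t) (p t).

End CurvesInM4.

(* Main.v *)
(* An element psi of PC over (q, p) is, up to a nonzero factor, the class of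
   v |-> q x v.  So there is a no-slip psi over a curve iff p' = mu q x q' + a p,
   which is the condition that the curve is null.  After rescaling q and p to Q
   and P with P Q = 1, this becomes P' = Q x Q' + al P, and each of the other
   conditions is equivalent to al = 0.
   - Integral curves of D: (Q, P) is one if al = 0, and any other lift
     (phi Q, P / phi) satisfies the equation only if phi^3 = 1.
   - No-twist: in the frame (c, c', c'') with c''' = E c'' + A c' + B c, a section
     y c' + z c'' modulo c is parallel iff y : z solves a Riccati equation whose
     coefficients are given by E and A.  For the curve P^T, E is unchanged, A is
     replaced by A - E al + 3 al', and Q x (y Q' + z Q'') has coordinates
     (y - al z, z).  If solutions are sent to solutions, then al y z + k z^2 = 0
     for two independent ones and the same function k, so al = 0.
   - Parallel plane: the self-dual null plane containing (q', p') is the graph of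
     v |-> mu q x v modulo p.  In homogeneous coordinates the Levi-Civita
     connection is v' - (p q' / p q) v - (p v / p q) q' on the first factor, with
     the dual expression on the second.  The derivative of a section of the graph
     is in the graph up to a term K q x v, where K is a multiple of al. *)

Require Import Defs.
From mathcomp Require Import all_boot all_order all_algebra.
From mathcomp Require Import all_classical all_reals all_analysis.
From mathcomp Require Import ring lra.
Import Order.TTheory GRing.Theory Num.Theory.
Import numFieldNormedType.Exports.
Local Open Scope ring_scope.
Local Open Scope classical_set_scope.

Set Implicit Arguments.
Unset Strict Implicit.
Unset Printing Implicit Defensive.

(** * Smooth functions of one variable *)

Section Calculus.
Variable R : realType.
Implicit Types (I : set R) (t : R).

(** The obstacle is the quantifier in [no_twist]: it only speaks of sections parallel along the
    whole of [I]. To extract [al t0 = 0] one needs such sections with prescribed values at [t0],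
    while the ratio of a Riccati solution may become infinite. The Riccati equation is therefore
    lifted to a linear system for the pair (y, z), which is solved on all of [I], and a Wronskian
    keeps the pair away from (0, 0). A parallel section is given by a point x moving on the
    osculating conics, and the tangency condition is void at the times when x meets the curve. These
    times have empty interior, so the Riccati equation extends to them by continuity. The rescaling
    has to satisfy f g r = 1 and g mu = f^2 with r = p q, hence g^3 = 1 / (mu r^2): this is why a
    smooth real cube root is needed. Proportionality factors are often given for each time
    separately; before differentiating, they are recovered as quotients of pairings. For the
    connection no Christoffel symbol is computed: the Koszul formula and nondegeneracy identify it
    in homogeneous coordinates. *)

Definition dif (V : normedModType R) I (f g : R -> V) : Prop :=
  forall t, I t -> is_derive t (1 : R) f (g t).

Section Generic.
Variable V : normedModType R.
Implicit Types f g h : R -> V.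

Lemma dif_eq I f g h : dif I f g -> (forall t, I t -> g t = h t) -> dif I f h.
Proof. by move=> fg gh t It; rewrite -gh//; exact: fg. Qed.

Lemma dif_ext I f g h :
  open I -> (forall t, I t -> f t = g t) -> dif I f h -> dif I g h.
Proof.
move=> oI fg fh t It; apply: near_eq_is_derive (fh t It).
near=> s; apply: fg; near: s; exact: open_nbhs_nbhs.
Unshelve. all: by end_near. Qed.

Lemma difE I f g t : dif I f g -> I t -> derive1 f t = g t.
Proof. by move=> fg /fg fgt; rewrite derive1E derive_val. Qed.

Lemma dif_derive1 I f : (forall t, I t -> derivable f t 1) -> dif I f (derive1 f).
Proof. by move=> df t It; rewrite derive1E; apply: derivableP; exact: df. Qed.

Lemma dif_unique I f g h t : dif I f g -> dif I f h -> I t -> g t = h t.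
Proof. by move=> fg fh It; rewrite -(difE fg It) (difE fh It). Qed.

Lemma derive1n_eq I f g n t :
  open I -> (forall s, I s -> f s = g s) -> I t -> derive1n n f t = derive1n n g t.
Proof.
move=> oI; elim: n f g t => [|n IH] f g t fg It; first exact: fg.
rewrite !derive1Sn; apply: IH => // s Is; rewrite !derive1E.
apply: near_eq_derive; near=> u; apply: fg; near: u; exact: open_nbhs_nbhs.
Unshelve. all: by end_near. Qed.

Lemma smooth_dif I f : smooth_on I f -> dif I f (derive1 f).
Proof. by move=> sf; apply: dif_derive1 => t; exact: (sf 0). Qed.

Lemma smooth_derive1 I f : smooth_on I f -> smooth_on I (derive1 f).
Proof. by move=> sf n t It; rewrite -derive1Sn; exact: sf. Qed.

(** The derivative of order n + 1 of [f] agrees on the open set [I] with that of order n of a member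
    of [C], so a class stable under differentiation is smooth. The algebraic closure properties come
    from exhibiting such a class, which avoids Leibniz formulas of higher order. *)
Lemma smooth_coind I (C : set (R -> V)) : open I ->
    (forall f, C f -> exists2 g, C g & dif I f g) ->
  forall f, C f -> smooth_on I f.
Proof.
move=> oI step f Cf n; elim: n f Cf => [|n IH] f /step[g Cg fg] t It.
  by have := fg t It => -[].
rewrite derive1Sn.
apply: near_eq_derivable (IH _ Cg t It); near=> s.
have Is : I s by near: s; exact: open_nbhs_nbhs.
apply/esym/(derive1n_eq n oI) => // u Iu; exact: difE fg Iu.
Unshelve. all: by end_near. Qed.

Lemma smooth_ext I f g :
  open I -> (forall t, I t -> f t = g t) -> smooth_on I f -> smooth_on I g.
Proof.
move=> oI fg sf n t It; apply: near_eq_derivable (sf n t It); near=> s.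
by apply: (derive1n_eq n oI) => //; near: s; exact: open_nbhs_nbhs.
Unshelve. all: by end_near. Qed.

Lemma smooth_sub I J f : J `<=` I -> smooth_on I f -> smooth_on J f.
Proof. by move=> JI sf n t /JI; exact: sf. Qed.

Lemma dif_continuous I f g t : dif I f g -> I t -> {for t, continuous f}.
Proof.
by move=> fg /fg [df _]; apply/differentiable_continuous/derivable1_diffP.
Qed.

Lemma dif_cst I (c : V) : dif I (fun=> c) (fun=> 0).
Proof. by move=> t _; exact: is_derive_cst. Qed.

Lemma difD I f f' g g' : dif I f f' -> dif I g g' ->
  dif I (fun t => f t + g t) (fun t => f' t + g' t).
Proof. by move=> ff gg t It; apply: is_deriveD; [exact: ff|exact: gg]. Qed.

Lemma difN I f f' : dif I f f' -> dif I (fun t => - f t) (fun t => - f' t).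
Proof. by move=> ff t It; apply: is_deriveN; exact: ff. Qed.

End Generic.

Section Scalar.
Implicit Types f g : R -> R.

Lemma difM I f f' g g' : dif I f f' -> dif I g g' ->
  dif I (fun t => f t * g t) (fun t => f' t * g t + f t * g' t).
Proof.
move=> ff gg t It; apply: (is_derive_eq (is_deriveM (ff t It) (gg t It))).
by rewrite /GRing.scale /= mulrC addrC [X in X + _]mulrC; ring.
Qed.

Lemma difV I f f' : (forall t, I t -> f t != 0) -> dif I f f' ->
  dif I (fun t => (f t)^-1) (fun t => - f' t * (f t)^-1 * (f t)^-1).
Proof.
move=> f0 ff t It; apply: (is_derive_eq (is_deriveV (f0 t It) (ff t It))).
by rewrite /GRing.scale /=; field; exact: f0.
Qed.

(* If the derivatives of the elements of S lie in this algebra, it is closed under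
   differentiation, so that all its elements are smooth. *)
Inductive alg I (S : set (R -> R)) : set (R -> R) :=
| alg_base f : S f -> alg I S f
| alg_cst c : alg I S (fun=> c)
| alg_add f g : alg I S f -> alg I S g -> alg I S (fun t => f t + g t)
| alg_opp f : alg I S f -> alg I S (fun t => - f t)
| alg_mul f g : alg I S f -> alg I S g -> alg I S (fun t => f t * g t)
| alg_inv f : (forall t, I t -> f t != 0) -> alg I S f -> alg I S (fun t => (f t)^-1).

Lemma alg_smooth I (S : set (R -> R)) : open I ->
    (forall f, S f -> exists2 g, alg I S g & dif I f g) ->
  forall f, alg I S f -> smooth_on I f.
Proof.
move=> oI HS; apply: smooth_coind => // f; elim=> {f}.
- by move=> f; exact: HS.
- by move=> c; exists (fun=> 0); [exact: alg_cst|exact: dif_cst].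
- move=> f g _ [f' Sf ff] _ [g' Sg gg]; exists (fun t => f' t + g' t).
    exact: alg_add.
  exact: difD.
- by move=> f _ [f' Sf ff]; exists (fun t => - f' t); [exact: alg_opp|exact: difN].
- move=> f g fS [f' Sf ff] gS [g' Sg gg].
  exists (fun t => f' t * g t + f t * g' t); last exact: difM.
  by apply: alg_add; apply: alg_mul.
- move=> f f0 fS [f' Sf ff]; exists (fun t => - f' t * (f t)^-1 * (f t)^-1).
    by apply: alg_mul; [apply: alg_mul; [exact: alg_opp|]|]; exact: alg_inv.
  exact: difV.
Qed.

Let sm I : set (R -> R) := [set g : R -> R | smooth_on I g].

Let alg_smooth_on I (f : R -> R) : open I -> alg I (sm I) f -> smooth_on I f.
Proof.
move=> oI; apply: alg_smooth => // {}f /= sf; exists (derive1 f).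
  exact/(@alg_base I (sm I))/smooth_derive1.
exact: smooth_dif.
Qed.

Lemma smooth_cst I (c : R) : open I -> smooth_on I (fun=> c : R).
Proof. by move=> oI; exact/(alg_smooth_on oI)/alg_cst. Qed.

Section Ops.
Variables (I : set R) (f g : R -> R).
Hypotheses (oI : open I) (sf : smooth_on I f) (sg : smooth_on I g).

Lemma smoothD : smooth_on I (fun t => f t + g t : R).
Proof.
exact: (alg_smooth_on oI (alg_add (@alg_base I (sm I) _ sf) (@alg_base I (sm I) _ sg))).
Qed.

Lemma smoothM : smooth_on I (fun t => f t * g t : R).
Proof.
exact: (alg_smooth_on oI (alg_mul (@alg_base I (sm I) _ sf) (@alg_base I (sm I) _ sg))).
Qed.

Lemma smoothN : smooth_on I (fun t => - f t : R).
Proof. exact: (alg_smooth_on oI (alg_opp (@alg_base I (sm I) _ sf))). Qed.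

Lemma smoothV : (forall t, I t -> f t != 0) -> smooth_on I (fun t => (f t)^-1 : R).
Proof.
move=> f0; exact: (alg_smooth_on oI (alg_inv f0 (@alg_base I (sm I) _ sf))).
Qed.

End Ops.

End Scalar.

Section Matrices.
Variables m n : nat.
Implicit Types M N : R -> 'M[R]_(m, n).

Lemma dif_mxP I M N :
  dif I M N <-> forall i j, dif I (fun t => M t i j) (fun t => N t i j).
Proof.
split=> [MN i j t It|MN t It].
  have [dM eM] := MN t It; apply: DeriveDef.
    by have /derivable_mxP := dM; exact.
  by rewrite -eM derive_mx// mxE.
have dM : derivable M t 1 by apply/derivable_mxP => i j; have [] := MN i j t It.
apply: DeriveDef => //; rewrite derive_mx//; apply/matrixP => i j.
by rewrite mxE; have [_ ->] := MN i j t It.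
Qed.

(** Both directions are coinductions: on the class of entries of smooth matrices, then on the class
    of matrices with smooth entries. *)
Lemma smooth_mxP I M : open I ->
  smooth_on I M <-> forall i j, smooth_on I (fun t => M t i j : R).
Proof.
move=> oI; split=> [sM i j|sM].
  pose C := [set f : R -> R | exists2 N : R -> 'M[R]_(m, n),
    smooth_on I N & f = (fun t => N t i j)].
  have step f : C f -> exists2 g, C g & dif I f g.
    move=> [N sN ->]; exists (fun t => derive1 N t i j).
      by exists (derive1 N); [exact: smooth_derive1|].
    by have /dif_mxP := smooth_dif sN; exact.
  by apply: (smooth_coind oI step); exists M.
pose C := [set N : R -> 'M[R]_(m, n) | forall i j, smooth_on I (fun t => N t i j : R)].
have step N : C N -> exists2 N', C N' & dif I N N'.
  move=> sN; exists (fun t => \matrix_(i, j) derive1 (fun s => N s i j) t).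
    move=> i j; rewrite (_ : (fun _ => _) = derive1 (fun s => N s i j)).
      exact: smooth_derive1.
    by apply/funext => t; rewrite mxE.
  apply/dif_mxP => i j; apply: dif_eq (smooth_dif (sN i j)) _ => t _.
  by rewrite mxE.
exact: (smooth_coind oI step).
Qed.

End Matrices.
End Calculus.

(** * Vectors and covectors of R^3 *)

Opaque dif smooth_on derive1.

Section Vectors.
Variable R : realType.
Implicit Types (a b c v w x y : 'cV[R]_3) (l m p : 'rV[R]_3) (s k : R).

Lemma ord3P (P : 'I_3 -> Prop) : P 0 -> P 1 -> P 2%:R -> forall i, P i.
Proof.
move=> P0 P1 P2 i; have : (i < 3)%N by [].
case: i => -[|[|[|//]]] hi _.
- by rewrite (_ : Ordinal _ = 0) //; exact: val_inj.
- by rewrite (_ : Ordinal _ = 1) //; exact: val_inj.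
- by rewrite (_ : Ordinal _ = 2%:R) //; exact: val_inj.
Qed.

Lemma colP3 v w :
  v 0 0 = w 0 0 -> v 1 0 = w 1 0 -> v 2%:R 0 = w 2%:R 0 -> v = w.
Proof.
by move=> e0 e1 e2; apply/matrixP => i j; rewrite (ord1 j); move: i; exact: ord3P.
Qed.

Lemma rowP3 l m :
  l 0 0 = m 0 0 -> l 0 1 = m 0 1 -> l 0 2%:R = m 0 2%:R -> l = m.
Proof.
by move=> e0 e1 e2; apply/matrixP => i j; rewrite (ord1 i); move: j; exact: ord3P.
Qed.

Lemma sum3 (V : nmodType) (F : 'I_3 -> V) : \sum_i F i = F 0 + F 1 + F 2%:R.
Proof.
rewrite !big_ord_recr big_ord0 /= add0r.
by congr (F _ + F _ + F _); exact: val_inj.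
Qed.

Lemma pairing3 p v :
  pairing p v = p 0 0 * v 0 0 + p 0 1 * v 1 0 + p 0 2%:R * v 2%:R 0.
Proof. by rewrite pairingE sum3. Qed.

Let o3 : ((0 + 1 = 1 :> 'I_3) * (0 + 2%:R = 2%:R :> 'I_3) *
  (1 + 1 = 2%:R :> 'I_3) * (1 + 2%:R = 0 :> 'I_3) *
  (2%:R + 1 = 0 :> 'I_3) * (2%:R + 2%:R = 1 :> 'I_3)).
Proof. by do !split; exact: val_inj. Qed.

Lemma pairing0l v : pairing (0 : 'rV[R]_3) v = 0.
Proof. by rewrite /pairing mul0mx mxE. Qed.

Lemma pairing0r l : pairing l (0 : 'cV[R]_3) = 0.
Proof. by rewrite /pairing mulmx0 mxE. Qed.

Lemma crossE v w :
  (cross v w 0 0 = v 1 0 * w 2%:R 0 - v 2%:R 0 * w 1 0) *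
  (cross v w 0 1 = v 2%:R 0 * w 0 0 - v 0 0 * w 2%:R 0) *
  (cross v w 0 2%:R = v 0 0 * w 1 0 - v 1 0 * w 0 0).
Proof. by do !split; rewrite mxE !o3. Qed.

Lemma dcrossE p l :
  (dcross p l 0 0 = p 0 1 * l 0 2%:R - p 0 2%:R * l 0 1) *
  (dcross p l 1 0 = p 0 2%:R * l 0 0 - p 0 0 * l 0 2%:R) *
  (dcross p l 2%:R 0 = p 0 0 * l 0 1 - p 0 1 * l 0 0).
Proof. by do !split; rewrite mxE crossE !mxE. Qed.

Lemma unlock_dcross p l : dcross p l = (cross p^T l^T)^T. Proof. by []. Qed.

Variables (m n : nat).
Implicit Types (A B : 'M[R]_(m, n)).
Lemma entD A B i j : (A + B) i j = A i j + B i j. Proof. by rewrite mxE. Qed.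
Lemma entN A i j : (- A) i j = - A i j. Proof. by rewrite mxE. Qed.
Lemma entZ k A i j : (k *: A) i j = k * A i j. Proof. by rewrite mxE. Qed.
Lemma ent0 i j : (0 : 'M[R]_(m, n)) i j = 0. Proof. by rewrite mxE. Qed.
Lemma entT A i j : A^T i j = A j i. Proof. by rewrite mxE. Qed.

End Vectors.

Ltac comps := rewrite ?(entD, entN, entZ, ent0, crossE, dcrossE, pairing3, entT).
Ltac vec := first [apply: colP3 | apply: rowP3]; comps.

Definition det3 (R : realType) (a b c : 'cV[R]_3) : R := pairing (cross a b) c.

Section CrossAlgebra.
Variable R : realType.
Implicit Types (a b c v w : 'cV[R]_3) (l m p : 'rV[R]_3) (s k : R).

Lemma crossDr a b c : cross c (a + b) = cross c a + cross c b.
Proof. by vec; ring. Qed.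
Lemma crossZl k a b : cross (k *: a) b = k *: cross a b.
Proof. by vec; ring. Qed.
Lemma crossZr k a b : cross a (k *: b) = k *: cross a b.
Proof. by vec; ring. Qed.
Lemma crossvv a : cross a a = 0.
Proof. by vec; ring. Qed.
Lemma crossC a b : cross a b = - cross b a.
Proof. by vec; ring. Qed.
Lemma crossNr a b : cross a (- b) = - cross a b.
Proof. by vec; ring. Qed.
Lemma det3E a b c : det3 a b c =
  a 0 0 * (b 1 0 * c 2%:R 0 - b 2%:R 0 * c 1 0)
  - a 1 0 * (b 0 0 * c 2%:R 0 - b 2%:R 0 * c 0 0)
  + a 2%:R 0 * (b 0 0 * c 1 0 - b 1 0 * c 0 0).
Proof. by rewrite /det3 pairing3 !crossE; ring. Qed.

Lemma pairing_cross a b c : pairing (cross a b) c = det3 a b c.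
Proof. by []. Qed.
Lemma det3_rot a b c : det3 a b c = det3 b c a.
Proof. by rewrite !det3E; ring. Qed.
Lemma det3_aba a b : det3 a b a = 0. Proof. by rewrite !det3E; ring. Qed.
Lemma det3_abb a b : det3 a b b = 0. Proof. by rewrite !det3E; ring. Qed.

(** Cramer's rule with the denominator cleared, which makes it a polynomial identity. *)
Lemma det3_expand a b c (x : 'cV[R]_3) :
  det3 a b c *: x = det3 x b c *: a + det3 a x c *: b + det3 a b x *: c.
Proof. by vec; rewrite !det3E; ring. Qed.

(** The basis dual to (a, b, c) is (b x c, c x a, a x b) divided by the determinant. *)
Lemma det3_coexpand a b c p :
  det3 a b c *: p =
  pairing p a *: cross b c + pairing p b *: cross c a + pairing p c *: cross a b.
Proof. by vec; rewrite !det3E; ring. Qed.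

Lemma dcross_cross p a b :
  dcross p (cross a b) = pairing p b *: a - pairing p a *: b.
Proof. by vec; ring. Qed.

Lemma dcrossDr p l m : dcross p (l + m) = dcross p l + dcross p m.
Proof. by vec; ring. Qed.
Lemma dcrossZr k p l : dcross p (k *: l) = k *: dcross p l.
Proof. by vec; ring. Qed.
Lemma dcrossNl p l : dcross p l = - dcross l p.
Proof. by vec; ring. Qed.
Lemma dcrosspp p : dcross p p = 0.
Proof. by vec; ring. Qed.

Lemma dcross_eq0 p l : p != 0 -> dcross p l = 0 -> exists k, l = k *: p.
Proof.
move=> p0 /matrixP E.
have [i pi] : exists i, p 0 i != 0.
  apply/existsP; rewrite -negb_forall; apply: contra p0 => /forallP h.
  by apply/eqP/matrixP => i j; rewrite (ord1 i) mxE; exact/eqP.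
have := (E 0 0, E 1 0, E 2%:R 0); rewrite !dcrossE !ent0 => -[[e0 e1] e2].
(* The factor is read off at an index where [p] does not vanish. *)
exists (l 0 i / p 0 i); move: i pi; apply: ord3P => pi; vec;
  apply: (mulIf pi); rewrite mulrAC divfK//.
all: first [ring | by move: e0 e1 e2; lra].
Qed.

Lemma cross_eq0 a b : a != 0 -> cross a b = 0 -> exists k, b = k *: a.
Proof.
move=> a0 E; have aT0 : a^T != 0 by rewrite trmx_eq0.
have [|k Ek] := @dcross_eq0 a^T b^T aT0; first by rewrite unlock_dcross !trmxK E trmx0.
by exists k; rewrite -[b]trmxK Ek linearZ /= trmxK.
Qed.

Lemma frame_inj a b c (x y z : R) : det3 a b c != 0 ->
  x *: a + y *: b + z *: c = 0 -> [/\ x = 0, y = 0 & z = 0].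
Proof.
move=> d0 E.
have e1 : pairing (cross b c) (x *: a + y *: b + z *: c) = x * det3 a b c.
  by rewrite !pairing_lin !pairing_cross !det3E; ring.
have e2 : pairing (cross c a) (x *: a + y *: b + z *: c) = y * det3 a b c.
  by rewrite !pairing_lin !pairing_cross !det3E; ring.
have e3 : pairing (cross a b) (x *: a + y *: b + z *: c) = z * det3 a b c.
  by rewrite !pairing_lin !pairing_cross !det3E; ring.
rewrite E in e1 e2 e3.
by split; apply: (mulIf d0); rewrite mul0r -?e1 -?e2 -?e3 pairing0r.
Qed.

Lemma det3_neq0 a b c : det3 a b c != 0 -> [/\ a != 0, cross a b != 0 & a^T != 0].
Proof.
move=> d; have aN : a != 0.
  by apply: contra d => /eqP ->; rewrite det3E !ent0; apply/eqP; ring.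
split; rewrite ?trmx_eq0//; apply: contra d => /eqP E.
by rewrite /det3 E pairing0l.
Qed.

(** The covector is in the left kernel of the matrix with columns a, b, c. Applied to a curve and
    its first two derivatives, it is a line with contact of order 2. *)
Lemma det3_eq0 a b c : det3 a b c = 0 ->
  exists2 l : 'rV[R]_3, l != 0 & [/\ pairing l a = 0, pairing l b = 0 & pairing l c = 0].
Proof.
move=> d0; pose M : 'M[R]_3 := \matrix_(i, j)
  (if j == 0 then a i 0 else if j == 1 then b i 0 else c i 0).
have dM : \det M = det3 a b c.
  rewrite (expand_det_row _ 0) !big_ord_recl big_ord0 /cofactor.
  do 3 rewrite (expand_det_row _ 0) !big_ord_recl big_ord0 /cofactor !det_mx11.
  rewrite !mxE /= det3E.
  have e1 : lift 0 0 = 1 :> 'I_3 by exact: val_inj.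
  have e2 : lift 0 (1 : 'I_2) = 2%:R :> 'I_3 by exact: val_inj.
  have e3 : lift 0 0 = 1 :> 'I_2 by exact: val_inj.
  by rewrite e3 e1 e2 /bump /=; ring.
have /eqP/det0P[l l0 lM] : \det M = 0 by rewrite dM.
exists l => //; split.
- by move/matrixP/(_ 0 0): lM; rewrite !mxE sum3 pairing3 !mxE.
- by move/matrixP/(_ 0 1): lM; rewrite !mxE sum3 pairing3 !mxE.
- by move/matrixP/(_ 0 2%:R): lM; rewrite !mxE sum3 pairing3 !mxE.
Qed.

End CrossAlgebra.

Section VectorCalculus.
Variables (R : realType) (I : set R).
Hypothesis oI : open I.

Lemma dif_pairing p p' q q' : dif I p p' -> dif I q q' ->
  dif I (fun t => pairing (p t) (q t))
        (fun t => pairing (p' t) (q t) + pairing (p t) (q' t) : R).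
Proof.
move=> /dif_mxP pp /dif_mxP qq.
rewrite (_ : (fun _ => _) = fun t =>
  p t 0 0 * q t 0 0 + p t 0 1 * q t 1 0 + p t 0 2%:R * q t 2%:R 0); last first.
  by apply/funext => t; rewrite pairing3.
have D i := difM (pp 0 i) (qq i 0).
apply: dif_eq (difD (difD (D 0) (D 1)) (D 2%:R)) _ => t _.
by rewrite !pairing3; ring.
Qed.

Lemma dif_cross v v' w w' : dif I v v' -> dif I w w' ->
  dif I (fun t => cross (v t) (w t)) (fun t => cross (v' t) (w t) + cross (v t) (w' t)).
Proof.
move=> /dif_mxP vv /dif_mxP ww; apply/dif_mxP => i j; rewrite (ord1 i) {i}.
have D i k := difM (vv i 0) (ww k 0).
have E i k := difN (D i k).
move: j; apply: ord3P.
- under eq_fun do rewrite crossE.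
  by apply: dif_eq (difD (D 1 2%:R) (E 2%:R 1)) _ => t _; rewrite mxE !crossE; ring.
- under eq_fun do rewrite crossE.
  by apply: dif_eq (difD (D 2%:R 0) (E 0 2%:R)) _ => t _; rewrite mxE !crossE; ring.
- under eq_fun do rewrite crossE.
  by apply: dif_eq (difD (D 0 1) (E 1 0)) _ => t _; rewrite mxE !crossE; ring.
Qed.

Lemma difZ m n (f f' : R -> R) (M M' : R -> 'M[R]_(m, n)) :
  dif I f f' -> dif I M M' ->
  dif I (fun t => f t *: M t) (fun t => f' t *: M t + f t *: M' t).
Proof.
move=> ff /dif_mxP MM; apply/dif_mxP => i j.
under eq_fun do rewrite mxE.
by apply: dif_eq (difM ff (MM i j)) _ => t _; rewrite !mxE.
Qed.

Lemma dif_tr m n (M M' : R -> 'M[R]_(m, n)) : dif I M M' ->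
  dif I (fun t => (M t)^T) (fun t => (M' t)^T).
Proof.
move=> /dif_mxP MM; apply/dif_mxP => i j.
under eq_fun do rewrite mxE.
by apply: dif_eq (MM j i) _ => t _; rewrite mxE.
Qed.

Lemma smoothZ m n (f : R -> R) (M : R -> 'M[R]_(m, n)) :
  smooth_on I f -> smooth_on I M -> smooth_on I (fun t => f t *: M t).
Proof.
move=> sf /(smooth_mxP _ oI) sM; apply/(smooth_mxP _ oI) => i j.
under eq_fun do rewrite mxE.
exact: (smoothM oI sf (sM i j)).
Qed.

Lemma smoothDv m n (M N : R -> 'M[R]_(m, n)) :
  smooth_on I M -> smooth_on I N -> smooth_on I (fun t => M t + N t).
Proof.
move=> /(smooth_mxP _ oI) sM /(smooth_mxP _ oI) sN; apply/(smooth_mxP _ oI) => i j.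
under eq_fun do rewrite mxE.
exact: (smoothD oI (sM i j) (sN i j)).
Qed.

Lemma smoothNv m n (M : R -> 'M[R]_(m, n)) :
  smooth_on I M -> smooth_on I (fun t => - M t).
Proof.
move=> /(smooth_mxP _ oI) sM; apply/(smooth_mxP _ oI) => i j.
under eq_fun do rewrite mxE.
exact: (smoothN oI (sM i j)).
Qed.

Lemma smooth_tr m n (M : R -> 'M[R]_(m, n)) :
  smooth_on I M -> smooth_on I (fun t => (M t)^T).
Proof.
move=> /(smooth_mxP _ oI) sM; apply/(smooth_mxP _ oI) => i j.
under eq_fun do rewrite mxE.
exact: sM.
Qed.

Lemma smooth_pairing p q : smooth_on I p -> smooth_on I q ->
  smooth_on I (fun t => pairing (p t) (q t) : R).
Proof.
move=> /(smooth_mxP _ oI) sp /(smooth_mxP _ oI) sq.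
under eq_fun do rewrite pairing3.
have S i := smoothM oI (sp 0 i) (sq i 0).
exact: (smoothD oI (smoothD oI (S 0) (S 1)) (S 2%:R)).
Qed.

Lemma smooth_cross v w : smooth_on I v -> smooth_on I w ->
  smooth_on I (fun t => cross (v t) (w t)).
Proof.
move=> /(smooth_mxP _ oI) sp /(smooth_mxP _ oI) sq.
apply/(smooth_mxP _ oI) => i j; rewrite (ord1 i).
under eq_fun do rewrite mxE.
have S k l := smoothM oI (sp k 0) (sq l 0).
exact: (smoothD oI (S _ _) (smoothN oI (S _ _))).
Qed.

Lemma smooth_det3 u v w : smooth_on I u -> smooth_on I v -> smooth_on I w ->
  smooth_on I (fun t => det3 (u t) (v t) (w t) : R).
Proof. by move=> su sv sw; exact: (smooth_pairing (smooth_cross su sv) sw). Qed.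

Lemma dif_det3 u u' v v' w w' : dif I u u' -> dif I v v' -> dif I w w' ->
  dif I (fun t => det3 (u t) (v t) (w t))
    (fun t => det3 (u' t) (v t) (w t) + det3 (u t) (v' t) (w t)
              + det3 (u t) (v t) (w' t) : R).
Proof.
move=> du dv dw; apply: dif_eq (dif_pairing (dif_cross du dv) dw) _ => t _.
by rewrite /det3 !pairing_lin.
Qed.

End VectorCalculus.

(** Hypotheses are matched syntactically, with [constr_eq], so that none is applied through
    unfolding. In [dif_tac] the rules build the derivative, and its comparison with the expected one
    is what remains to prove. *)
Ltac dif_step := cbv beta; match goal with
  | H : dif _ ?f _ |- dif _ ?g _ => constr_eq f g; exact: H
  | H : dif _ ?f _ |- dif _ (fun t => ?g t) _ => constr_eq f g; exact: H
  | H : forall t, _ -> is_true _ |- forall t, _ -> is_true _ => exact H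
  | |- dif _ (fun _ => ?c) _ => exact: dif_cst
  | |- dif _ (fun t => @?f t + @?g t) _ => refine (@difD _ _ _ f _ g _ _ _)
  | |- dif _ (fun t => - @?f t) _ => refine (@difN _ _ _ f _ _)
  | |- dif _ (fun t => @?f t * @?g t) _ => refine (@difM _ _ f _ g _ _ _)
  | |- dif _ (fun t => @?f t *: @?g t) _ => refine (@difZ _ _ _ _ f _ g _ _ _)
  | |- dif _ (fun t => pairing (@?f t) (@?g t)) _ =>
      refine (@dif_pairing _ _ f _ g _ _ _)
  | |- dif _ (fun t => cross (@?f t) (@?g t)) _ => refine (@dif_cross _ _ f _ g _ _ _)
  | |- dif _ (fun t => det3 (@?f t) (@?g t) (@?h t)) _ =>
      refine (@dif_det3 _ _ f _ g _ h _ _ _ _)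
  | |- dif _ (fun t => (@?f t)^T) _ => refine (@dif_tr _ _ _ _ f _ _)
  | |- dif _ (fun t => (@?f t)^-1) _ => refine (@difV _ _ f _ _ _)
  end.
Ltac dif_tac := refine (@dif_eq _ _ _ _ _ _ _ _); [repeat dif_step | cbv beta].

Ltac smooth_step := cbv beta; match goal with
  | H : open ?I |- open ?J => constr_eq I J; exact: H
  | H : forall t, _ -> is_true _ |- forall t, _ -> is_true _ => exact H
  | H : smooth_on _ ?f |- smooth_on _ ?g => constr_eq f g; exact: H
  | H : smooth_on _ ?f |- smooth_on _ (fun t => ?g t) => constr_eq f g; exact: H
  | H : smooth_on _ ?f |- smooth_on _ (derive1 ?g) => constr_eq f g; exact: smooth_derive1 H
  | H : smooth_on _ ?f |- smooth_on _ (fun t => @derive1 _ _ ?g t) =>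
      constr_eq f g; exact: smooth_derive1 H
  | |- smooth_on _ (fun _ => ?c) => refine (@smooth_cst _ _ c _)
  | |- smooth_on _ (fun t => @?f t + @?g t) =>
      lazymatch type of f with _ -> ?T => let T' := eval hnf in T in lazymatch T' with
      | matrix _ _ _ => refine (@smoothDv _ _ _ _ _ f g _ _)
      | _ => refine (@smoothD _ _ f g _ _ _)
      end end
  | |- smooth_on _ (fun t => - @?f t) =>
      lazymatch type of f with _ -> ?T => let T' := eval hnf in T in lazymatch T' with
      | matrix _ _ _ => refine (@smoothNv _ _ _ _ _ f _)
      | _ => refine (@smoothN _ _ f _ _)
      end end
  | |- smooth_on _ (fun t => @?f t * @?g t) => refine (@smoothM _ _ f g _ _ _)
  | |- smooth_on _ (fun t => @?f t *: @?g t) => refine (@smoothZ _ _ _ _ _ f g _ _)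
  | |- smooth_on _ (fun t => pairing (@?f t) (@?g t)) =>
      refine (@smooth_pairing _ _ _ f g _ _)
  | |- smooth_on _ (fun t => cross (@?f t) (@?g t)) =>
      refine (@smooth_cross _ _ _ f g _ _)
  | |- smooth_on _ (fun t => det3 (@?f t) (@?g t) (@?h t)) =>
      refine (@smooth_det3 _ _ _ f g h _ _ _)
  | |- smooth_on _ (fun t => (@?f t)^T) => refine (@smooth_tr _ _ _ _ _ f _)
  | |- smooth_on _ (fun t => (@?f t)^-1) => refine (@smoothV _ _ f _ _ _)
  end.
Ltac smooth_tac := repeat smooth_step.

(** * Linear differential equations *)

Section LinearODE.
Variables (R : realType) (I : set R).
Hypotheses (oI : open I) (II : is_interval I).

(** The strict margins make x and y interior to a segment of [I], so that bounds on this compact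
    segment serve for limits and derivatives at both points. *)
Lemma open_enlarge x y : I x -> I y ->
  exists c d, [/\ I c, I d, c < x, c < y & x < d /\ y < d].
Proof.
have half e : 0 < e -> 0 < e / 2 /\ e / 2 < e :> R by move=> e0; split; lra.
have nb z : I z -> exists2 e, 0 < e & forall s, `|z - s| < e -> I s.
  by move=> Iz; have /nbhs_ballP[e e0 eI] := open_nbhs_nbhs (conj oI Iz); exists e.
have lo z : I z -> exists2 c, I c & c < z.
  move=> /nb[e e0 eI]; have [h0 h1] := half _ e0.
  exists (z - e / 2); last by lra.
  by apply: eI; rewrite opprB addrC subrK gtr0_norm.
have hi z : I z -> exists2 d, I d & z < d.
  move=> /nb[e e0 eI]; have [h0 h1] := half _ e0.
  exists (z + e / 2); last by lra.
  by apply: eI; rewrite opprD addNKr normrN gtr0_norm.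
move=> Ix Iy; have [c Ic cm] : exists2 c, I c & c < Num.min x y.
  by apply: lo; case: (leP x y).
have [d Id dm] : exists2 d, I d & Num.max x y < d.
  by apply: hi; case: (leP x y).
move: cm dm; rewrite lt_min gt_max => /andP[cx cy] /andP[dx dy].
by exists c, d; split.
Qed.

Lemma segment_sub c d t : I c -> I d -> c <= t <= d -> I t.
Proof. by move=> Ic Id; exact: II. Qed.

Lemma within_continuous (f : R -> R) c d : I c -> I d ->
  (forall t, I t -> {for t, continuous f}) -> {within `[c, d], continuous f}.
Proof.
move=> Ic Id cf; apply: continuous_in_subspaceT => t; rewrite inE /= in_itv /= => cd.
by apply: cf; exact: segment_sub cd.
Qed.

Local Notation mu := (@lebesgue_measure R).

(** The oriented integral from [t0]. To differentiate it at t, on whichever side of [t0] this point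
    lies, it is compared with an integral [G] based to the left of both: near t the two differ by a
    constant. *)
Lemma antiderivative (f : R -> R) t0 : I t0 ->
  (forall t, I t -> {for t, continuous f}) ->
  exists2 F, F t0 = 0 & dif I F f.
Proof.
move=> It0 cf.
pose F t := if t0 <= t then (\int[mu]_(x in `[t0, t]) f x)%R
            else - (\int[mu]_(x in `[t, t0]) f x)%R.
exists F; first by rewrite /F lexx set_itv1 Rintegral_set1.
move=> t It; have [c [u [Ic Iu ct ct0 [tu t0u]]]] := open_enlarge It It0.
have int a b : c <= a -> b <= u -> mu.-integrable `[a, b] (EFin \o f).
  move=> ca bu; apply: integrableS (_ : mu.-integrable `[c, u] _) => //.
    by apply: subset_itv; rewrite bnd_simp.
  apply: continuous_compact_integrable; first exact: segment_compact.
  exact: within_continuous.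
pose G s := (\int[mu]_(x in `[c, s]) f x)%R.
have GB a b : c <= a -> a <= b -> b <= u -> (\int[mu]_(x in `[a, b]) f x)%R = G b - G a.
  move=> ca ab bu; rewrite /G Rintegral_itvB.
  - rewrite Rintegral_itv_obnd_cbnd//.
    apply: integrableS (int _ _ ca bu) => //.
    exact: subset_itv_oc_cc.
  - exact: int.
  - by rewrite bnd_simp.
  - by rewrite bnd_simp.
have FG s : c <= s <= u -> F s = G s - G t0.
  move=> /andP[cs su]; rewrite /F; case: leP => [t0s|/ltW st0].
    by rewrite GB// ltW.
  by rewrite GB// ?opprB// ltW.
have dG : is_derive t (1 : R) G (f t).
  have [] := @continuous_FTC1_closed R f c t u tu (int _ _ (lexx _) (lexx _)) ct (cf _ It).
  by move=> dG; rewrite derive1E => eG; apply: DeriveDef.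
apply: (@near_eq_is_derive _ _ _ (fun s => G s - G t0)).
  near=> s; apply/esym/FG/andP; split; apply/ltW.
    by near: s; exact: lt_nbhsr.
  by near: s; exact: lt_nbhsl.
apply: is_derive_eq (is_deriveB dG (is_derive_cst (G t0) t 1)) _.
by rewrite subr0.
Unshelve. all: by end_near. Qed.

Lemma dif_within (F f : R -> R) c d : I c -> I d -> dif I F f ->
  {within `[c, d], continuous F}.
Proof. by move=> Ic Id Ff; apply: within_continuous => // t; exact: dif_continuous Ff. Qed.

(* The factor n + 1, which makes Picard iteration converge, comes from comparing
   F with (s - t0)^(n+1) by Cauchy's mean value theorem. *)
Lemma growth_bound (F f : R -> R) t0 t n A :
  I t0 -> I t -> dif I F f -> F t0 = 0 ->
  (forall s, Num.min t0 t <= s <= Num.max t0 t -> `|f s| <= A * `|s - t0| ^+ n) ->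
  `|F t| <= A * `|t - t0| ^+ n.+1 / n.+1%:R.
Proof.
move=> It0 It Ff F0 bf.
have [->|tt0] := eqVneq t t0.
  by rewrite F0 subrr normr0 expr0n /= mulr0 mul0r.
pose g (s : R) := (s - t0) ^+ n.+1; pose dg (s : R) := n.+1%:R * (s - t0) ^+ n.
have gdg : dif I g dg.
  move=> s _; rewrite /g /dg.
  have h : is_derive s (1 : R) (fun s => s - t0 : R) 1.
    apply: is_derive_eq (is_deriveB (is_derive_id s 1) (is_derive_cst t0 s 1)) _.
    by rewrite subr0.
  have := is_deriveX n.+1 h; rewrite exprfctE => hX; apply: (is_derive_eq hX).
  by rewrite /GRing.scale /= mulr1.
have g0 : g t0 = 0 by rewrite /g subrr expr0n.
(* The mean value theorem wants an ordered segment; [t0] may be either of its ends. *)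
have main a b : a < b -> I a -> I b -> t0 = a \/ t0 = b ->
    (forall s, a <= s <= b -> `|f s| <= A * `|s - t0| ^+ n) ->
    `|F b - F a| * n.+1%:R <= A * `|g b - g a|.
  move=> ab Ia Ib t0ab bnd.
  have sub x : x \in `]a, b[%R -> I x /\ x != t0.
    rewrite in_itv /= => /andP[ax xb]; split.
      by apply: (II Ia Ib); rewrite !ltW.
    by case: t0ab => ->; rewrite ?(gt_eqF ax)// (lt_eqF xb).
  have dg0 x : x \in `]a, b[%R -> dg x != 0.
    by move=> /sub[_ xt0]; rewrite mulf_neq0 ?pnatr_eq0// expf_neq0// subr_eq0.
  have gba := differentiable_subr_neq0 ab (dif_within Ia Ib gdg)
    (fun x xab => gdg _ (sub _ xab).1) dg0.
  have [c cab] := cauchy_MVT ab (dif_within Ia Ib Ff) (dif_within Ia Ib gdg)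
    (fun x xab => Ff _ (sub _ xab).1) (fun x xab => gdg _ (sub _ xab).1) dg0.
  move=> /(congr1 (fun x => x * (g b - g a))); rewrite divfK// => <-.
  rewrite in_itv /= in cab; case/andP: (cab) => ac cb.
  have fc : `|f c| <= A * `|c - t0| ^+ n by apply: bnd; rewrite !ltW.
  have ct0 : 0 < `|c - t0| ^+ n.
    rewrite exprn_gt0// normr_gt0 subr_eq0.
    by have [] := sub c; rewrite ?in_itv//= ac cb.
  rewrite normrM normf_div /dg normrM normrX ger0_norm ?ler0n//.
  rewrite mulrAC ler_wpM2r// invfM mulrA mulrAC divfK ?pnatr_eq0//.
  by rewrite ler_pdivrMr.
have : `|F t| * n.+1%:R <= A * `|g t|.
  have [lt|ge] := ltP t0 t.
    have := main t0 t lt It0 It (or_introl erefl); rewrite F0 g0 !subr0; apply.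
    by move=> s st; apply: bf; rewrite min_l ?max_r// ltW.
  have gt : t < t0 by rewrite lt_neqAle tt0.
  have := main t t0 gt It It0 (or_intror erefl); rewrite F0 g0 !sub0r !normrN; apply.
  by move=> s st; apply: bf; rewrite min_r ?max_l.
by rewrite /g normrX -ler_pdivlMr// ltr0n.
Qed.

End LinearODE.

(** * Picard iteration for linear systems with two unknowns *)

Section Picard.
Variable R : realType.

Lemma le0_geom (x D : R) : (forall n, x <= D * 2^-1 ^+ n) -> x <= 0.
Proof.
move=> xD; rewrite leNgt; apply/negP => x0.
have D0 : 0 < D by have := xD 0%N; rewrite expr0 mulr1; exact: lt_le_trans.
have : (GRing.exp (2^-1 : R) : R ^nat) @ \oo --> (0 : R).
  by apply: cvg_expr; rewrite ger0_norm ?invr_ge0// invf_lt1// ltr1n.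
move/cvgr0Pnorm_lt => /(_ (x / D)); rewrite divr_gt0// => /(_ isT)[N _ /(_ N (leqnn N))] /=.
rewrite ger0_norm ?exprn_ge0 ?invr_ge0// ltr_pdivlMr// mulrC.
by rewrite ltNge xD.
Qed.

(** The intervals [x n - w n, x n + w n] are nested, w n being the remainder of the geometric
    series, and the limit is the supremum of their left ends. This yields the rate of convergence
    together with the limit. *)
Lemma geom_lim (x : R ^nat) (D : R) : (forall n, `|x n.+1 - x n| <= D * 2^-1 ^+ n) ->
  exists l, forall n, `|l - x n| <= D * 2 * 2^-1 ^+ n.
Proof.
move=> xD; pose w n : R := D * 2 * 2^-1 ^+ n.
have wS n : w n.+1 = w n - D * 2^-1 ^+ n by rewrite /w exprS; field.
have D0 : 0 <= D by have := xD 0%N; rewrite expr0 mulr1; exact: le_trans.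
have w0 n : 0 <= w n by rewrite !mulr_ge0// exprn_ge0// invr_ge0.
have lo : {homo (fun n => x n - w n) : m n / (m <= n)%N >-> m <= n}.
  apply: homo_leq => [//|? ? ?|n]; first exact: le_trans.
  by have := xD n; rewrite wS ler_norml => /andP[]; lra.
have hi : {homo (fun n => - (x n + w n)) : m n / (m <= n)%N >-> m <= n}.
  apply: homo_leq => [//|? ? ?|n]; first exact: le_trans.
  by have := xD n; rewrite wS ler_norml => /andP[]; lra.
have lh m n : x m - w m <= x n + w n.
  have := (lo _ _ (leq_maxl m n), hi _ _ (leq_maxr m n), w0 (maxn m n)) => -[[]].
  lra.
exists (sup (range (fun n => x n - w n))) => n.
rewrite ler_norml; apply/andP; split.
  rewrite lerBrDr addrC; apply: ub_le_sup; last by exists n.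
  by exists (x 0%N + w 0%N) => _ [m _ <-].
rewrite lerBlDr addrC; apply: ge_sup; first by exists (x 0%N - w 0%N), 0%N.
by move=> _ [m _ <-].
Qed.

Lemma dist_segment (x y s t : R) :
  x <= s <= y -> x <= t <= y -> `|s - t| <= y - x.
Proof. by move=> /andP[? ?] /andP[? ?]; rewrite ler_norml; apply/andP; split; lra. Qed.

Lemma dist3 (x y z w e : R) :
  `|x - y| <= e / 3 -> `|y - z| <= e / 3 -> `|w - z| <= e / 3 -> `|x - w| <= e.
Proof.
rewrite !ler_norml => /andP[? ?] /andP[? ?] /andP[? ?].
by apply/andP; split; lra.
Qed.

Variable I : set R.
Hypotheses (oI : open I) (II : is_interval I).
Variables a b c d : R -> R.
Hypotheses (ca : forall t, I t -> {for t, continuous a})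
           (cb : forall t, I t -> {for t, continuous b})
           (cc : forall t, I t -> {for t, continuous c})
           (cd : forall t, I t -> {for t, continuous d}).

Lemma bounded_segment (f : R -> R) x y : I x -> I y ->
  (forall t, I t -> {for t, continuous f}) ->
  exists2 k, 0 <= k & forall t, x <= t <= y -> `|f t| <= k.
Proof.
move=> Ix Iy cf; have [xy|yx] := leP x y; last first.
  exists 0 => // t /andP[xt ty]; have := le_trans xt ty.
  by rewrite leNgt yx.
have := @EVT_max R (fun t => `|f t|) x y xy.
case=> [|m _ fm].
  apply: (@within_continuous R I II (fun t => `|f t|)) => // t It.
  by apply: continuous_comp; [exact: cf|exact: norm_continuous].
by exists `|f m| => // t ty; apply: fm; rewrite in_itv.
Qed.

(** The estimates are uniform on each segment of [I] around [t0]. By [growth_bound] they contain a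
    factorial, so the iteration converges on the segment whatever its length and the solution lives
    on all of [I]. *)
Lemma linear_ode t0 u0 v0 : I t0 -> exists u v,
  [/\ u t0 = u0, v t0 = v0,
      dif I u (fun t => a t * u t + b t * v t)
    & dif I v (fun t => c t * u t + d t * v t)].
Proof.
move=> It0.
(* An iterate carries the proof of its continuity, which the next integration needs. *)
have step (w : {w : (R -> R) * (R -> R) | (forall t, I t -> {for t, continuous w.1}) /\
    (forall t, I t -> {for t, continuous w.2})}) :
  {w' : {w : (R -> R) * (R -> R) | (forall t, I t -> {for t, continuous w.1}) /\
    (forall t, I t -> {for t, continuous w.2})} |
   [/\ (sval w').1 t0 = u0, (sval w').2 t0 = v0,
    dif I (sval w').1 (fun t => a t * (sval w).1 t + b t * (sval w).2 t)
    & dif I (sval w').2 (fun t => c t * (sval w).1 t + d t * (sval w).2 t)]}.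
  case: w => -[f g] /= [cf cg]; apply: cid.
  have [F F0 dF] := @antiderivative R I oI II (fun t => a t * f t + b t * g t) t0 It0
    (fun t It => cvgD (cvgM (ca It) (cf t It)) (cvgM (cb It) (cg t It))).
  have [G G0 dG] := @antiderivative R I oI II (fun t => c t * f t + d t * g t) t0 It0
    (fun t It => cvgD (cvgM (cc It) (cf t It)) (cvgM (cd It) (cg t It))).
  have dF' : dif I (fun t => u0 + F t) (fun t => a t * f t + b t * g t).
    by dif_tac => t _; rewrite add0r.
  have dG' : dif I (fun t => v0 + G t) (fun t => c t * f t + d t * g t).
    by dif_tac => t _; rewrite add0r.
  have cFG : (forall t, I t -> {for t, continuous (fun t => u0 + F t)}) /\
     (forall t, I t -> {for t, continuous (fun t => v0 + G t)}).
    by split=> t It; [exact: dif_continuous dF' It|exact: dif_continuous dG' It].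
  exists (exist _ (fun t => u0 + F t, fun t => v0 + G t) cFG) => /=.
  by split=> //; rewrite ?F0 ?G0 addr0.
have c0 : (forall t, I t -> {for t, continuous (fun=> u0 : R)}) /\
    (forall t, I t -> {for t, continuous (fun=> v0 : R)}).
  by split=> t It; exact: cvg_cst.
pose S := fix S n := if n is m.+1 then sval (step (S m))
  else exist _ (fun=> u0, fun=> v0) c0.
pose U n := (sval (S n)).1; pose V n := (sval (S n)).2.
have dU n : dif I (U n.+1) (fun t => a t * U n t + b t * V n t).
  by rewrite /U /V /=; case: (svalP (step (S n))).
have dV n : dif I (V n.+1) (fun t => c t * U n t + d t * V n t).
  by rewrite /U /V /=; case: (svalP (step (S n))).
have U0 n : U n t0 = u0.
  by case: n => // n; rewrite /U /=; case: (svalP (step (S n))).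
have V0 n : V n t0 = v0.
  by case: n => // n; rewrite /V /=; case: (svalP (step (S n))).
have cU n t : I t -> {for t, continuous (U n)} by exact: (svalP (S n)).1.
have cV n t : I t -> {for t, continuous (V n)} by exact: (svalP (S n)).2.
have between x y t s : x <= t0 <= y -> x <= t <= y ->
    Num.min t0 t <= s <= Num.max t0 t -> x <= s <= y.
  move=> /andP[xt0 t0y] /andP[xt ty] /andP[m1 m2]; apply/andP; split.
    by apply: le_trans m1; rewrite le_min xt0.
  by apply: (le_trans m2); rewrite ge_max t0y.
have coef x y : I x -> I y -> exists2 k, 0 <= k &
    forall t, x <= t <= y -> forall f g B, `|f| <= B -> `|g| <= B ->
    `|a t * f + b t * g| <= k * B /\ `|c t * f + d t * g| <= k * B.
  move=> Ix Iy; have [ka ka0 ba] := bounded_segment Ix Iy ca.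
  have [kb kb0 bb] := bounded_segment Ix Iy cb.
  have [kc kc0 bc] := bounded_segment Ix Iy cc.
  have [kd kd0 bd] := bounded_segment Ix Iy cd.
  have lin2 (p q k k' f g B : R) : 0 <= k -> 0 <= k' -> `|p| <= k -> `|q| <= k' ->
      `|f| <= B -> `|g| <= B -> `|p * f + q * g| <= (k + k') * B.
    move=> k0 k'0 pk qk fB gB; rewrite mulrDl; apply: (le_trans (ler_normD _ _)).
    by rewrite !normrM lerD// ler_pM.
  exists (ka + kb + (kc + kd)); first by rewrite !addr_ge0.
  move=> t xty f g B fB gB; have B0 : 0 <= B by exact: le_trans fB.
  split.
    apply: (le_trans (lin2 _ _ _ _ _ _ _ ka0 kb0 (ba _ xty) (bb _ xty) fB gB)).
    by rewrite ler_wpM2r// lerDl addr_ge0.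
  apply: (le_trans (lin2 _ _ _ _ _ _ _ kc0 kd0 (bc _ xty) (bd _ xty) fB gB)).
  by rewrite ler_wpM2r// lerDr addr_ge0.
have seg x y t : I x -> I y -> x <= t <= y -> I t by move=> Ix Iy; exact: II.
have unif x y : I x -> I y -> x <= t0 <= y -> exists D, forall t, x <= t <= y ->
    forall n, `|U n.+1 t - U n t| <= D * 2^-1 ^+ n /\ `|V n.+1 t - V n t| <= D * 2^-1 ^+ n.
  move=> Ix Iy xt0y; have [k k0 kb] := coef _ _ Ix Iy.
  have [B B0 hB] : exists2 B, 0 <= B & forall t, x <= t <= y ->
      `|U 1%N t - U 0%N t| <= B /\ `|V 1%N t - V 0%N t| <= B.
    have [B1 B10 h1] := @bounded_segment (fun t => U 1%N t - U 0%N t) x y Ix Iy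
      (fun t It => cvgB (cU _ _ It) (cU _ _ It)).
    have [B2 B20 h2] := @bounded_segment (fun t => V 1%N t - V 0%N t) x y Ix Iy
      (fun t It => cvgB (cV _ _ It) (cV _ _ It)).
    exists (B1 + B2); first exact: addr_ge0.
    move=> t xty; split; [apply: (le_trans (h1 _ xty))|apply: (le_trans (h2 _ xty))].
      by rewrite lerDl.
    by rewrite lerDr.
  have fine n t : x <= t <= y ->
      `|U n.+1 t - U n t| <= B * k ^+ n / n`!%:R * `|t - t0| ^+ n /\
      `|V n.+1 t - V n t| <= B * k ^+ n / n`!%:R * `|t - t0| ^+ n.
    elim: n t => [|n IH] t xty.
      by rewrite !expr0 fact0 divr1 !mulr1; exact: hB.
    have It := seg _ _ _ Ix Iy xty.
    have eA : B * k ^+ n.+1 / n.+1`!%:R * `|t - t0| ^+ n.+1 =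
        k * (B * k ^+ n / n`!%:R) * `|t - t0| ^+ n.+1 / n.+1%:R.
      by rewrite factS natrM invfM [k ^+ _]exprS; ring.
    have dUU : dif I (fun t => U n.+2 t - U n.+1 t)
      (fun t => a t * (U n.+1 t - U n t) + b t * (V n.+1 t - V n t)).
      have h1 := dU n; have h2 := dU n.+1.
      by dif_tac => s _; ring.
    have dVV : dif I (fun t => V n.+2 t - V n.+1 t)
      (fun t => c t * (U n.+1 t - U n t) + d t * (V n.+1 t - V n t)).
      have h1 := dV n; have h2 := dV n.+1.
      by dif_tac => s _; ring.
    rewrite eA; split.
      apply: (@growth_bound R I II _ _ _ _ n _ It0 It dUU); first by rewrite !U0 subrr.
      move=> s st; have xsy := between _ _ _ _ xt0y xty st.
      by have [IU IV] := IH s xsy; rewrite -[leRHS]mulrA; exact: (kb s xsy _ _ _ IU IV).1.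
    apply: (@growth_bound R I II _ _ _ _ n _ It0 It dVV); first by rewrite !V0 subrr.
    move=> s st; have xsy := between _ _ _ _ xt0y xty st.
    by have [IU IV] := IH s xsy; rewrite -[leRHS]mulrA; exact: (kb s xsy _ _ _ IU IV).2.
  (* The factor 2 trades the factorial bound for a geometric one: (k d)^n / n! = 2^-n (2 k d)^n /
     n!, and the last fraction is at most exp (2 k d). *)
  pose M := 2 * (k * (y - x)).
  exists (B * expR M) => t xty n.
  suff le : B * k ^+ n / n`!%:R * `|t - t0| ^+ n <= B * expR M * 2^-1 ^+ n.
    by have [h1 h2] := fine n t xty; split; exact: le_trans le.
  have yx : `|t - t0| <= y - x.
    exact: dist_segment.
  have M0 : 0 <= M by rewrite !mulr_ge0//; exact: le_trans yx.
  have ME : M ^+ n / n`!%:R <= expR M.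
    case: n {fine} => [|n]; first by rewrite expr0 fact0 divr1 -expR0 ler_expR.
    by apply: le_trans (expR_ge1Dxn n M0); rewrite lerDr.
  rewrite -!mulrA ler_wpM2l// exprVn ler_pdivlMr ?exprn_gt0//.
  apply: le_trans ME; rewrite /M exprMn.
  rewrite (_ : _ * 2 ^+ n = 2 ^+ n * (k * `|t - t0|) ^+ n / n`!%:R); last first.
    by rewrite exprMn; ring.
  rewrite ler_wpM2r ?invr_ge0 ?ler0n// ler_wpM2l ?exprn_ge0//.
  by apply: lerXn2r; rewrite ?nnegrE ?mulr_ge0 ?ler_wpM2l//; exact: le_trans yx.
have lims t : I t -> exists l : R * R, exists D, forall n,
    `|l.1 - U n t| <= D * 2^-1 ^+ n /\ `|l.2 - V n t| <= D * 2^-1 ^+ n.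
  move=> It; have [x [y [Ix Iy xt xt0 [ty t0y]]]] := open_enlarge oI It It0.
  have [D hD] : exists D, forall t, x <= t <= y -> forall n,
    `|U n.+1 t - U n t| <= D * 2^-1 ^+ n /\ `|V n.+1 t - V n t| <= D * 2^-1 ^+ n.
    by apply: unif => //; rewrite !ltW.
  have xty : x <= t <= y by rewrite !ltW.
  have [l hl] := @geom_lim (fun n => U n t) D (fun n => (hD t xty n).1).
  have [m hm] := @geom_lim (fun n => V n t) D (fun n => (hD t xty n).2).
  by exists (l, m), (D * 2) => n.
(* Off [I], where no convergence is known, the value 0 is a default. *)
pose L t : R * R := if pselect (I t) is left It then sval (cid (lims t It)) else 0.
have LP t : I t -> exists D, forall n,
    `|(L t).1 - U n t| <= D * 2^-1 ^+ n /\ `|(L t).2 - V n t| <= D * 2^-1 ^+ n.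
  by rewrite /L; case: pselect => // It _; exact: (svalP (cid (lims t It))).
(* The constant given by [LP] depends on the point; uniqueness of limits lets the constant of a
   whole segment replace it. *)
have Lunif x y : I x -> I y -> x <= t0 <= y -> exists2 D, 0 <= D & forall t, x <= t <= y ->
    forall n, `|(L t).1 - U n t| <= D * 2^-1 ^+ n /\ `|(L t).2 - V n t| <= D * 2^-1 ^+ n.
  move=> Ix Iy xt0y; have [D hD] := unif _ _ Ix Iy xt0y.
  have uniq l l' (w : R ^nat) D1 D2 : (forall n, `|l - w n| <= D1 * 2^-1 ^+ n) ->
      (forall n, `|l' - w n| <= D2 * 2^-1 ^+ n) -> l = l'.
    move=> h1 h2; apply/eqP; rewrite -subr_eq0 -normr_le0.
    apply: (@le0_geom _ (D1 + D2)) => n; rewrite mulrDl.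
    apply: le_trans (lerD (h1 n) (h2 n)); rewrite [`|l' - _|]distrC.
    by apply: le_trans (ler_normD _ _); rewrite addrA subrK.
  exists (D * 2).
    rewrite mulr_ge0//; have := (hD _ xt0y 0%N).1; rewrite expr0 mulr1.
    exact: le_trans.
  move=> t xty n; have [E hE] := LP t (seg _ _ _ Ix Iy xty).
  have [l hl] := @geom_lim (fun n => U n t) D (fun n => (hD t xty n).1).
  have [m hm] := @geom_lim (fun n => V n t) D (fun n => (hD t xty n).2).
  rewrite (uniq _ _ _ _ _ (fun n => (hE n).1) hl).
  by rewrite (uniq _ _ _ _ _ (fun n => (hE n).2) hm).
pose u t := (L t).1; pose v t := (L t).2.
have Lcont (f : R -> R) (w : nat -> R -> R) :
    (forall n t, I t -> {for t, continuous (w n)}) ->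
    (forall x y, I x -> I y -> x <= t0 <= y -> exists2 D, 0 <= D &
       forall t, x <= t <= y -> forall n, `|f t - w n t| <= D * 2^-1 ^+ n) ->
    forall t, I t -> {for t, continuous f}.
  move=> cw fw t It; have [x [y [Ix Iy xt xt0 [ty t0y]]]] := open_enlarge oI It It0.
  have [|D D0 hD] := fw x y Ix Iy; first by rewrite !ltW.
  apply/cvgrPdist_le => e e0.
  have [n hn] : exists n, D * 2^-1 ^+ n <= e / 3.
    apply: contrapT => /forallNP h; have : e / 3 <= 0.
      by apply: (@le0_geom _ D) => n; apply/ltW; rewrite ltNge; apply/negP; exact: h.
    by lra.
  have /cvgrPdist_le/(_ (e / 3)) := cw n t It; rewrite divr_gt0// => /(_ isT) wn.
  near=> s.
  have hs : `|f s - w n s| <= e / 3.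
    apply: le_trans hn; apply: hD; apply/andP; split; apply/ltW.
      by near: s; exact: lt_nbhsr.
    by near: s; exact: lt_nbhsl.
  have ht : `|f t - w n t| <= e / 3 by apply: le_trans hn; apply: hD; rewrite !ltW.
  have hw : `|w n t - w n s| <= e / 3 by near: s.
  exact: dist3 ht hw hs.
have cu : forall t, I t -> {for t, continuous u}.
  apply: (Lcont u U cU) => x y Ix Iy /(Lunif _ _ Ix Iy)[D D0 hD].
  by exists D => // t xty n; exact: (hD t xty n).1.
have cv : forall t, I t -> {for t, continuous v}.
  apply: (Lcont v V cV) => x y Ix Iy /(Lunif _ _ Ix Iy)[D D0 hD].
  by exists D => // t xty n; exact: (hD t xty n).2.
have [F F0 dF] := @antiderivative R I oI II (fun t => a t * u t + b t * v t) t0 It0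
  (fun t It => cvgD (cvgM (ca It) (cu t It)) (cvgM (cb It) (cv t It))).
have [G G0 dG] := @antiderivative R I oI II (fun t => c t * u t + d t * v t) t0 It0
  (fun t It => cvgD (cvgM (cc It) (cu t It)) (cvgM (cd It) (cv t It))).
(* The limit of the iteration is the integral equation, from which the derivatives of u and v are
   read off. *)
have uF t : I t -> u t = u0 + F t /\ v t = v0 + G t.
  move=> It; have [x [y [Ix Iy xt xt0 [ty t0y]]]] := open_enlarge oI It It0.
  have xt0y : x <= t0 <= y by rewrite !ltW.
  have xty : x <= t <= y by rewrite !ltW.
  have [D D0 hD] := Lunif _ _ Ix Iy xt0y; have [k k0 kb] := coef _ _ Ix Iy.
  have dUF n : dif I (fun t => U n.+1 t - u0 - F t)
     (fun t => a t * (U n t - u t) + b t * (V n t - v t)).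
    by have h1 := dU n; dif_tac => s _; ring.
  have dVG n : dif I (fun t => V n.+1 t - v0 - G t)
     (fun t => c t * (U n t - u t) + d t * (V n t - v t)).
    by have h1 := dV n; dif_tac => s _; ring.
  have bUV n s : x <= s <= y -> `|U n s - u s| <= D * 2^-1 ^+ n /\
      `|V n s - v s| <= D * 2^-1 ^+ n.
    by move=> xsy; rewrite ![`|_ n s - _|]distrC; exact: hD.
  have bnd n : `|U n.+1 t - u0 - F t| <= k * (D * 2^-1 ^+ n) * `|t - t0| /\
       `|V n.+1 t - v0 - G t| <= k * (D * 2^-1 ^+ n) * `|t - t0|.
    have e1 A : A * `|t - t0| = A * `|t - t0| ^+ 1 / 1%:R by rewrite expr1 divr1.
    rewrite e1; split.
      apply: (@growth_bound R I II _ _ _ _ 0 _ It0 It (dUF n)).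
        by rewrite U0 F0 subrr subr0.
      move=> s st; have xsy := between _ _ _ _ xt0y xty st.
      by have [h1 h2] := bUV n s xsy; rewrite expr0 mulr1; exact: (kb s xsy _ _ _ h1 h2).1.
    apply: (@growth_bound R I II _ _ _ _ 0 _ It0 It (dVG n)).
      by rewrite V0 G0 subrr subr0.
    move=> s st; have xsy := between _ _ _ _ xt0y xty st.
    by have [h1 h2] := bUV n s xsy; rewrite expr0 mulr1; exact: (kb s xsy _ _ _ h1 h2).2.
  have fin (l w : R) (W : R ^nat) : (forall n, `|W n.+1 - w| <= k * (D * 2^-1 ^+ n) * `|t - t0|) ->
     (forall n, `|W n - l| <= D * 2^-1 ^+ n) -> l = w.
    move=> h1 h2; apply/eqP; rewrite -subr_eq0 -normr_le0.
    apply: (@le0_geom _ (k * D * `|t - t0| + D)) => n.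
    have : `|l - w| <= `|W n.+1 - w| + `|W n.+1 - l|.
      rewrite [`|_ - l|]distrC (_ : l - w = W n.+1 - w + (l - W n.+1)); last by ring.
      exact: ler_normD.
    move=> /le_trans; apply; rewrite mulrDl; apply: lerD.
      by apply: (le_trans (h1 n)); rewrite le_eqVlt; apply/orP; left; apply/eqP; ring.
    apply: (le_trans (h2 n.+1)); rewrite ler_wpM2l//.
    by rewrite exprS ler_piMl ?exprn_ge0 ?invr_ge0// invf_le1// ler1n.
  split.
    apply: (fin _ _ (fun n => U n t)) => n; last exact: (bUV n t xty).1.
    by rewrite opprD addrA; exact: (bnd n).1.
  apply: (fin _ _ (fun n => V n t)) => n; last exact: (bUV n t xty).2.
  by rewrite opprD addrA; exact: (bnd n).2.
exists u, v; split.
- by rewrite (uF t0 It0).1 F0 addr0.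
- by rewrite (uF t0 It0).2 G0 addr0.
- apply: (@dif_ext _ _ _ (fun t => u0 + F t)) => //.
    by move=> t /uF[->].
  by dif_tac => t _; rewrite add0r.
- apply: (@dif_ext _ _ _ (fun t => v0 + G t)) => //.
    by move=> t /uF[_ ->].
  by dif_tac => t _; rewrite add0r.
Unshelve. all: by end_near. Qed.

End Picard.

(** * Consequences of linear equations: nonvanishing, smoothness, cube roots *)

Section Nonvanishing.
Variables (R : realType) (I : set R).
Hypotheses (oI : open I) (II : is_interval I).

Lemma dif0_const (f : R -> R) s t : I s -> I t -> dif I f (fun=> 0) -> f t = f s.
Proof.
move=> Is It df.
have df' : dif I (fun t => f t - f s) (fun=> 0) by dif_tac => u _; rewrite addr0.
have h := @growth_bound _ I II _ _ s t 0 0 Is It df'.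
apply/eqP; rewrite -subr_eq0 -normr_le0.
apply: le_trans (h _ _) _; rewrite ?subrr ?mul0r//.
by move=> u _; rewrite normr0.
Qed.

Lemma dif_expR (T f : R -> R) : dif I T f ->
  dif I (fun t => expR (T t)) (fun t => f t * expR (T t)).
Proof.
move=> Tf t It; rewrite mulrC.
exact: (is_derive1_comp (is_derive_expR (T t)) (Tf t It)).
Qed.

Lemma smooth_continuous (f : R -> R) t : smooth_on I f -> I t -> {for t, continuous f}.
Proof. by move=> /smooth_dif sf; exact: (dif_continuous sf). Qed.

(** The product of [w] with the exponential of minus an antiderivative of [f] is constant. *)
Lemma linear_nonvanishing (f w : R -> R) t0 : I t0 ->
  smooth_on I f -> dif I w (fun t => f t * w t) -> w t0 != 0 ->
  forall t, I t -> w t != 0.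
Proof.
move=> It0 sf dw w0 t It.
have [T _ dT] := antiderivative oI II It0 (fun t It => smooth_continuous sf It).
have dE := dif_expR (difN dT).
have dwE : dif I (fun t => w t * expR (- T t)) (fun=> 0) by dif_tac => s _; ring.
have E := dif0_const It0 It dwE; apply: contra w0 => /eqP wt0.
by move: E; rewrite wt0 mul0r => /esym/eqP; rewrite mulf_eq0 (gt_eqF (expR_gt0 _)) orbF.
Qed.

(** By the equations themselves, the algebra generated by u, v and the smooth functions is closed
    under differentiation. *)
Lemma linear_smooth (a b c d u v : R -> R) :
  smooth_on I a -> smooth_on I b -> smooth_on I c -> smooth_on I d ->
  dif I u (fun t => a t * u t + b t * v t) ->
  dif I v (fun t => c t * u t + d t * v t) ->
  smooth_on I u /\ smooth_on I v.
Proof.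
move=> sa sb sc sd du dv.
pose S : set (R -> R) := [set f | smooth_on I f \/ f = u \/ f = v].
have B f : S f -> alg I S f by exact: alg_base.
have Bu : alg I S u by apply: B; right; left.
have Bv : alg I S v by apply: B; right; right.
have Bs f : smooth_on I f -> alg I S f by move=> sf; apply: B; left.
have step f : S f -> exists2 g, alg I S g & dif I f g.
  case=> [sf|[->|->]].
  - by exists (derive1 f); [apply: Bs; exact: smooth_derive1|exact: smooth_dif].
  - exists (fun t => a t * u t + b t * v t); [|exact: du].
    exact: (alg_add (alg_mul (Bs _ sa) Bu) (alg_mul (Bs _ sb) Bv)).
  - exists (fun t => c t * u t + d t * v t); [|exact: dv].
    exact: (alg_add (alg_mul (Bs _ sc) Bu) (alg_mul (Bs _ sd) Bv)).
by split; apply: (alg_smooth oI step).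
Qed.

Lemma cube_root_real (x : R) : x != 0 -> exists2 y, y != 0 & y ^+ 3 = x.
Proof.
move=> x0; have ax : 0 < `|x| by rewrite normr_gt0.
pose y := expR (ln `|x| / 3); have y3 : y ^+ 3 = `|x|.
  by rewrite /y -expRM_natr divfK ?pnatr_eq0// lnK.
have y0 : y != 0 by rewrite gt_eqF ?expR_gt0.
have [xge|xlt] := leP 0 x; first by exists y; rewrite // y3 ger0_norm.
by exists (- y); rewrite ?oppr_eq0// exprNn y3 ltr0_norm// -signr_odd /= expr1; ring.
Qed.

(** A cube root of h solves g' = h' / (3 h) g. The exponential solution with the right value at one
    point is defined on all of [I], and g^3 / h is constant, so the sign of [h] matters at that
    point only. *)
Lemma smooth_cube_root (h : R -> R) : smooth_on I h -> (forall t, I t -> h t != 0) ->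
  exists2 g : R -> R, smooth_on I g & forall t, I t -> g t != 0 /\ g t ^+ 3 = h t.
Proof.
move=> sh h0; have [[t0 It0]|I0] := pselect (exists t, I t); last first.
  by exists (fun=> 0); [exact: smooth_cst|move=> t It; case: I0; exists t].
have [y y0 y3] := cube_root_real (h0 _ It0).
pose f t := 3^-1 * (derive1 h t * (h t)^-1).
have sf : smooth_on I f by rewrite /f; smooth_tac.
have [T T0 dT] := antiderivative oI II It0 (fun t It => smooth_continuous sf It).
pose g t := y * expR (T t).
have dE := dif_expR dT.
(* Padded with a second unknown equal to zero, in the form that [linear_smooth] takes. *)
have dg : dif I g (fun t => f t * g t + 0 * (fun=> 0) t).
  by rewrite /g; dif_tac => t _; ring.
have sz : smooth_on I (fun=> 0 : R) by exact: smooth_cst.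
have dz : dif I (fun=> 0 : R) (fun t => 0 * g t + 0 * (fun=> 0) t).
  by dif_tac => t _; ring.
have [sg _] := linear_smooth sf sz sz sz dg dz.
exists g => // t It; split; first by rewrite mulf_neq0// gt_eqF ?expR_gt0.
have dh := smooth_dif sh.
have dgh : dif I (fun t => g t * (g t * g t) * (h t)^-1) (fun=> 0).
  dif_tac => s Is; rewrite /f; field; exact: h0.
have E := dif0_const It0 It dgh.
have gt0 : g t0 * (g t0 * g t0) = h t0 by rewrite -y3 /g T0 expR0 mulr1; ring.
rewrite gt0 divff ?h0// in E.
by rewrite -[h t]mul1r -E divfK ?h0//; ring.
Qed.

End Nonvanishing.

(** * Osculating conics and parallel transport *)

Section FramedCurve.
Variables (R : realType) (I : set R).
Hypothesis oI : open I.

Lemma derive1n_chain (F : nat -> R -> R) n :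
  (forall j, (j < n)%N -> dif I (F j) (F j.+1)) ->
  forall t, I t -> forall j, (j <= n)%N -> derive1n j (F 0%N) t = F j t.
Proof.
move=> dF t It; elim=> [//|j IH] jn; rewrite derive1nS.
suff E s : I s -> derive1n j (F 0%N) s = F j s.
  by rewrite -(difE (dF j jn) It) !derive1E; apply: near_eq_derive;
    near=> s; apply: E; near: s; exact: open_nbhs_nbhs.
elim: j s jn {IH} => [//|j IH] s jn Is; rewrite derive1nS.
rewrite -(difE (dF j (ltnW jn)) Is) !derive1E; apply: near_eq_derive.
near=> u; apply: IH; [exact: ltnW|near: u; exact: open_nbhs_nbhs].
Unshelve. all: by end_near. Qed.

Definition bil (S : 'M[R]_3) (v w : 'cV[R]_3) : R := pairing (v^T *m S) w.

Lemma bilE S v w : bil S v w = pairing (v^T *m S) w. Proof. by []. Qed.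
Lemma bilDr S v w w' : bil S v (w + w') = bil S v w + bil S v w'.
Proof. by rewrite /bil pairingDr. Qed.
Lemma bilZr S k v w : bil S v (k *: w) = k * bil S v w.
Proof. by rewrite /bil pairingZr. Qed.
Lemma bilDl S v v' w : bil S (v + v') w = bil S v w + bil S v' w.
Proof. by rewrite /bil linearD /= mulmxDl pairingDl. Qed.
Lemma bilZl S k v w : bil S (k *: v) w = k * bil S v w.
Proof. by rewrite /bil linearZ /= -scalemxAl pairingZl. Qed.
Lemma bilC S v w : S^T = S -> bil S v w = bil S w v.
Proof.
move=> ST; rewrite /bil; have -> : pairing (v^T *m S) w = pairing w^T (v^T *m S)^T.
  by rewrite !pairing3 !entT; ring.
by rewrite trmx_mul trmxK ST /pairing mulmxA.
Qed.
Lemma bilDS S T v w : bil (S + T) v w = bil S v w + bil T v w.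
Proof. by rewrite /bil mulmxDr pairingDl. Qed.
Lemma bilZS k S v w : bil (k *: S) v w = k * bil S v w.
Proof. by rewrite /bil -scalemxAr pairingZl. Qed.
Lemma bil1 (l m : 'rV[R]_3) v w : bil (l^T *m m) v w = pairing l v * pairing m w.
Proof.
rewrite /bil /pairing mulmxA -mulmxA mxE big_ord1; congr (_ * _).
by rewrite -[v^T *m l^T]trmx_mul mxE.
Qed.

Lemma dif_bil S v v' w w' : dif I v v' -> dif I w w' ->
  dif I (fun t => bil S (v t) (w t)) (fun t => bil S (v' t) (w t) + bil S (v t) (w' t)).
Proof.
move=> dv dw; apply: dif_pairing dw; apply/dif_mxP => i j; rewrite (ord1 i) {i}.
have E (u : R -> 'cV[R]_3) :
    (fun t => ((u t)^T *m S) 0 j) = fun t => pairing (col j S)^T (u t).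
  apply/funext => t; rewrite mxE /pairing !mxE; apply: eq_bigr => k _.
  by rewrite !mxE mulrC.
rewrite !E; dif_tac => t _; rewrite (_ : pairing 0 _ = 0) ?add0r//.
by rewrite /pairing mul0mx mxE.
Qed.

Opaque bil.

(** The third and fourth derivatives enter through [v3] and [v4], so that their expressions in the
    moving frame can be substituted. *)
Lemma order4_contact S (c0 c1 c2 c3 c4 : R -> 'cV[R]_3) t : S^T = S ->
  dif I c0 c1 -> dif I c1 c2 -> dif I c2 c3 -> dif I c3 c4 -> I t ->
  forall v3 v4, c3 t = v3 -> c4 t = v4 ->
  vanishes_to_order (fun s => bil S (c0 s) (c0 s)) t 4 <->
  [/\ bil S (c0 t) (c0 t) = 0, bil S (c0 t) (c1 t) = 0,
      bil S (c1 t) (c1 t) + bil S (c0 t) (c2 t) = 0,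
      3 * bil S (c1 t) (c2 t) + bil S (c0 t) v3 = 0
    & 3 * bil S (c2 t) (c2 t) + 4 * bil S (c1 t) v3 + bil S (c0 t) v4 = 0].
Proof.
move=> ST d0 d1 d2 d3 It _ _ <- <-.
have bs v w := bilC v w ST.
(* The derivatives of S(c, c) up to order 4, with the factor 2 due to symmetry kept in front. *)
pose F := nth (fun=> 0) [:: fun s => bil S (c0 s) (c0 s);
  fun s => 2 * bil S (c0 s) (c1 s);
  fun s => 2 * (bil S (c1 s) (c1 s) + bil S (c0 s) (c2 s));
  fun s => 2 * (3 * bil S (c1 s) (c2 s) + bil S (c0 s) (c3 s));
  fun s => 2 * (3 * bil S (c2 s) (c2 s) + 4 * bil S (c1 s) (c3 s) + bil S (c0 s) (c4 s))].
have dF j : (j < 4)%N -> dif I (F j) (F j.+1).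
  have h00 := dif_bil S d0 d0; have h01 := dif_bil S d0 d1.
  have h11 := dif_bil S d1 d1; have h02 := dif_bil S d0 d2.
  have h12 := dif_bil S d1 d2; have h03 := dif_bil S d0 d3.
  case: j => [|[|[|[|//]]]] _; rewrite /F /=; dif_tac.
  - by move=> s _; rewrite (bs (c1 s) (c0 s)); ring.
  - by move=> s _; ring.
  - by move=> s _; rewrite (bs (c2 s) (c1 s)); ring.
  - by move=> s _; ring.
have FE j : (j <= 4)%N -> derive1n j (fun s => bil S (c0 s) (c0 s)) t = F j t.
  by move=> j4; rewrite (derive1n_chain dF It j4).
have two (x : R) : 2 * x = 0 -> x = 0.
  by move/eqP; rewrite mulf_eq0 pnatr_eq0 => /eqP.
split=> [vS|[e0 e1 e2 e3 e4] j j4].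
  have V j (j4 : (j <= 4)%N) : F j t = 0 by rewrite -FE// vS.
  split; [exact: (V 0%N)|apply: two; exact: (V 1%N)|apply: two; exact: (V 2%N)|
    apply: two; exact: (V 3%N)|apply: two; exact: (V 4%N)].
rewrite FE//; case: j j4 => [|[|[|[|[|//]]]]] _; rewrite /F /=.
- exact: e0.
- by rewrite e1 mulr0.
- by rewrite e2 mulr0.
- by rewrite e3 mulr0.
- by rewrite e4 mulr0.
Qed.

(** Here [v3] is the third derivative of the curve in the frame and [v4] the derivative of this
    expression. The contact conditions determine the Gram matrix of S in the frame from the single
    number S(c', c'): this is the uniqueness of the osculating conic. *)
Lemma contact_algebra S v0 v1 v2 (e a b e' a' b' : R) : S^T = S ->
  let v3 := e *: v2 + a *: v1 + b *: v0 in
  let v4 := e' *: v2 + e *: v3 + (a' *: v1 + a *: v2) + (b' *: v0 + b *: v1) in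
  [/\ bil S v0 v0 = 0, bil S v0 v1 = 0, bil S v1 v1 + bil S v0 v2 = 0,
      3 * bil S v1 v2 + bil S v0 v3 = 0
    & 3 * bil S v2 v2 + 4 * bil S v1 v3 + bil S v0 v4 = 0] <->
  [/\ bil S v0 v0 = 0, bil S v0 v1 = 0, bil S v0 v2 = - bil S v1 v1,
      bil S v1 v2 = e * bil S v1 v1 / 3
    & bil S v2 v2 = bil S v1 v1 * (- a + e' / 3 - e ^+ 2 / 9)].
Proof.
move=> ST /=; rewrite !(bilDr, bilZr) (bilC v1 v0 ST).
move: (bil S v0 v0) (bil S v0 v1) (bil S v0 v2) (bil S v1 v1) (bil S v1 v2) (bil S v2 v2).
move=> b00 b01 b02 b11 b12 b22; split=> [[-> -> h2 h3 h4]|[-> -> -> -> ->]].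
  have h02 : b02 = - b11 by move/eqP: h2; rewrite addrC addr_eq0 => /eqP.
  rewrite h02 in h3 h4 *.
  have h12 : b12 = e * b11 / 3 by apply: (mulfI (x := 3)); rewrite ?pnatr_eq0//; lra.
  rewrite h12 in h4 *; split=> //; apply: (mulfI (x := 3)); rewrite ?pnatr_eq0//.
  by apply/eqP; rewrite -subr_eq0 -[X in _ == X]h4; apply/eqP; field.
by split; field.
Qed.

Lemma bil_frame S v0 v1 v2 (X Y Z : R) : S^T = S ->
  bil S (X *: v0 + Y *: v1 + Z *: v2) (X *: v0 + Y *: v1 + Z *: v2) =
  X ^+ 2 * bil S v0 v0 + Y ^+ 2 * bil S v1 v1 + Z ^+ 2 * bil S v2 v2
  + 2 * (X * Y * bil S v0 v1 + X * Z * bil S v0 v2 + Y * Z * bil S v1 v2).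
Proof.
move=> ST; rewrite !(bilDr, bilZr, bilDl, bilZl).
by rewrite (bilC v1 v0 ST) (bilC v2 v0 ST) (bilC v2 v1 ST); ring.
Qed.

(** Otherwise [S] would kill v0. On an osculating conic S(c, c'') = - S(c', c'), so the scale S(c',
    c') is not zero. *)
Lemma nondegenerate_form S v0 v1 v2 : det3 v0 v1 v2 != 0 -> S \in unitmx ->
  bil S v0 v0 = 0 -> bil S v0 v1 = 0 -> bil S v0 v2 != 0.
Proof.
move=> d0 uS b00 b01; apply/eqP => b02.
have cS : v0^T *m S = 0.
  have : det3 v0 v1 v2 *: (v0^T *m S) = 0.
    rewrite det3_coexpand -!bilE b00 b01 b02.
    by rewrite !scale0r !addr0.
  by move/eqP; rewrite scaler_eq0 (negPf d0) /= => /eqP.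
have ct0 : v0 = 0 by apply: trmx_inj; rewrite -[LHS](mulmxK uS) cS mul0mx trmx0.
by have [/eqP] := det3_neq0 d0.
Qed.

Lemma form_exists v0 v1 v2 (e g : R) : det3 v0 v1 v2 != 0 ->
  exists S, [/\ S^T = S, S \in unitmx,
    (bil S v0 v0 = 0) * (bil S v0 v1 = 0) * (bil S v0 v2 = - 1),
    bil S v1 v1 = 1 & (bil S v1 v2 = e) * (bil S v2 v2 = g)].
Proof.
set d := det3 _ _ _ => d0.
pose x0 := d^-1 *: cross v1 v2; pose x1 := d^-1 *: cross v2 v0.
pose x2 := d^-1 *: cross v0 v1.
(* With x0, x1, x2 the dual frame, this form has the Gram matrix ((0, 0, -1), (0, 1, e), (-1, e, g))
   in the frame. *)
pose S := x1^T *m x1 + (-1) *: (x0^T *m x2) + (-1) *: (x2^T *m x0)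
  + e *: (x1^T *m x2) + e *: (x2^T *m x1) + g *: (x2^T *m x2).
have ST : S^T = S.
  have tr (x y : 'rV[R]_3) : (x^T *m y)^T = y^T *m x by rewrite trmx_mul trmxK.
  have trD (M N : 'M[R]_3) : (M + N)^T = M^T + N^T by exact: linearD.
  have trZ k (M : 'M[R]_3) : (k *: M)^T = k *: M^T by exact: linearZ.
  rewrite /S !trD !trZ !tr; congr (_ + _).
  by rewrite -!addrA; congr (_ + _); rewrite addrCA; congr (_ + (_ + _)); rewrite addrC.
have bE v w : bil S v w = pairing x1 v * pairing x1 w - pairing x0 v * pairing x2 w
   - pairing x2 v * pairing x0 w + e * (pairing x1 v * pairing x2 w)
   + e * (pairing x2 v * pairing x1 w) + g * (pairing x2 v * pairing x2 w).
  by rewrite /S !(bilDS, bilZS, bil1); ring.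
have xE : (pairing x0 v0 = 1) * (pairing x0 v1 = 0) * (pairing x0 v2 = 0) *
   (pairing x1 v0 = 0) * (pairing x1 v1 = 1) * (pairing x1 v2 = 0) *
   (pairing x2 v0 = 0) * (pairing x2 v1 = 0) * (pairing x2 v2 = 1).
  have r1 : det3 v1 v2 v0 = d by rewrite /d !det3E; ring.
  have r2 : det3 v2 v0 v1 = d by rewrite /d !det3E; ring.
  rewrite /x0 /x1 /x2 !pairing_lin !pairing_cross r1 r2 -/d mulVf//.
  by rewrite !det3_aba !det3_abb !mulr0.
exists S; split=> //; rewrite ?bE ?xE; last 3 first.
- by do !split; ring.
- by ring.
- by do !split; ring.
rewrite -row_free_unit; apply: inj_row_free => v vS.
have bv w : bil S v^T w = 0.
  by rewrite bilE trmxK vS pairing0l.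
have := (bv v0, bv v1, bv v2); rewrite !bE !xE => -[[h0 h1] h2].
have p2 : pairing x2 v^T = 0 by lra.
have p1 : pairing x1 v^T = 0 by move: h1; rewrite p2; lra.
have p0 : pairing x0 v^T = 0 by move: h2; rewrite p1 p2; lra.
apply: trmx_inj; rewrite trmx0; apply: (scalerI d0); rewrite scaler0.
rewrite {1}/d (det3_expand v0 v1 v2 v^T).
have {}p0 : det3 v^T v1 v2 = 0.
  move/eqP: p0; rewrite /x0 pairingZl mulf_eq0 invr_eq0 (negPf d0) /= => /eqP.
  by rewrite pairing_cross det3_rot det3_rot.
have {}p1 : det3 v0 v^T v2 = 0.
  move/eqP: p1; rewrite /x1 pairingZl mulf_eq0 invr_eq0 (negPf d0) /= => /eqP.
  by rewrite pairing_cross det3_rot.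
have {}p2 : det3 v0 v1 v^T = 0.
  by move/eqP: p2; rewrite /x2 pairingZl mulf_eq0 invr_eq0 (negPf d0) /= => /eqP.
by rewrite p0 p1 p2 !scale0r !addr0.
Qed.

(** [E] and [A] are parameters because they are the data of the conic and of parallel transport, to
    be compared between Q and the dual curve. *)
Record framed (c : R -> 'cV[R]_3) (E A : R -> R) : Prop := Framed {
  framed_smooth : smooth_on I c;
  framed_det : forall t, I t -> det3 (c t) (derive1 c t) (derive1 (derive1 c) t) != 0;
  framed_E : smooth_on I E;
  framed_A : smooth_on I A;
  framed_eq : exists2 B : R -> R, smooth_on I B & forall t, I t ->
    derive1 (derive1 (derive1 c)) t =
    E t *: derive1 (derive1 c) t + A t *: derive1 c t + B t *: c t }.

Definition crd (c : R -> 'cV[R]_3) t (x : 'cV[R]_3) : R * R * R :=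
  let c1 := derive1 c t in let c2 := derive1 (derive1 c) t in
  let d := det3 (c t) c1 c2 in
  (det3 x c1 c2 / d, det3 (c t) x c2 / d, det3 (c t) c1 x / d).

Definition comb (c : R -> 'cV[R]_3) t (X Y Z : R) : 'cV[R]_3 :=
  X *: c t + Y *: derive1 c t + Z *: derive1 (derive1 c) t.

(** The ratio S(c'', c'') / S(c', c') for the osculating conic S. *)
Definition cgam (E A : R -> R) t : R := - A t + derive1 E t / 3 - E t ^+ 2 / 9.

Definition conic_eq (E A : R -> R) t (X Y Z : R) : Prop :=
  Y ^+ 2 - 2 * X * Z + 2 / 3 * E t * Y * Z + cgam E A t * Z ^+ 2 = 0.

Variables (c : R -> 'cV[R]_3) (E A : R -> R).
Hypothesis fc : framed c E A.

Lemma crdK t x : I t -> let k := crd c t x in comb c t k.1.1 k.1.2 k.2 = x.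
Proof.
move=> It; have d0 := framed_det fc It; rewrite /comb /crd /=.
move: (det3_expand (c t) (derive1 c t) (derive1 (derive1 c) t) x).
set d := det3 _ _ _ in d0 *; move=> e; apply: (scalerI d0); rewrite e.
by rewrite !scalerDr !scalerA ![d * (_ / d)]mulrC !divfK.
Qed.

Lemma comb_inj t X Y Z X' Y' Z' : I t -> comb c t X Y Z = comb c t X' Y' Z' ->
  [/\ X = X', Y = Y' & Z = Z'].
Proof.
move=> It e; have [|h1 h2 h3] := @frame_inj _ _ _ _ (X - X') (Y - Y') (Z - Z') (framed_det fc It).
  rewrite !scalerBl (_ : _ + _ = comb c t X Y Z - comb c t X' Y' Z'); first by rewrite e subrr.
  by rewrite /comb !opprD [RHS]addrACA [in RHS](addrACA (X *: _)).
by split; apply/eqP; rewrite -subr_eq0 ?h1 ?h2 ?h3.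
Qed.

Lemma combK t X Y Z : I t -> crd c t (comb c t X Y Z) = (X, Y, Z).
Proof.
move=> It; have := crdK (comb c t X Y Z) It.
case: (crd _ _ _) => -[a b] k /= /(comb_inj It)[-> -> ->] //.
Qed.

Lemma osculating_eqs S t : I t -> S^T = S ->
  let b := bil S in
  let v0 := c t in let v1 := derive1 c t in let v2 := derive1 (derive1 c) t in
  vanishes_to_order (fun s => pairing ((c s)^T *m S) (c s)) t 4 <->
  [/\ b v0 v0 = 0, b v0 v1 = 0, b v0 v2 = - b v1 v1,
      b v1 v2 = E t * b v1 v1 / 3 & b v2 v2 = b v1 v1 * cgam E A t].
Proof.
move=> It ST b v0 v1 v2.
have s0 := framed_smooth fc; have s1 := smooth_derive1 s0.
have s2 := smooth_derive1 s1; have s3 := smooth_derive1 s2.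
have d3 := smooth_dif s3.
have := order4_contact ST (smooth_dif s0) (smooth_dif s1) (smooth_dif s2) d3 It.
have [B sB eB] := framed_eq fc.
have dE := smooth_dif (framed_E fc); have dA := smooth_dif (framed_A fc).
have dB := smooth_dif sB.
have e4 w : derive1 (derive1 (derive1 c)) t = w ->
    derive1 (derive1 (derive1 (derive1 c))) t =
    derive1 E t *: v2 + E t *: w
    + (derive1 A t *: v1 + A t *: v2) + (derive1 B t *: v0 + B t *: v1).
  move=> <-; have dR := smooth_dif s0; have dR1 := smooth_dif s1; have dR2 := smooth_dif s2.
  apply: (dif_unique d3 _ It (h := fun t => derive1 E t *: derive1 (derive1 c) t
    + E t *: derive1 (derive1 (derive1 c)) t
    + (derive1 A t *: derive1 c t + A t *: derive1 (derive1 c) t)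
    + (derive1 B t *: c t + B t *: derive1 c t))).
  apply: (dif_ext oI (fun s Is => esym (eB s Is))).
  exact: (difD (difD (difZ dE dR2) (difZ dA dR1)) (difZ dB dR)).
move=> /(_ _ _ (eB t It) (e4 _ (eB t It))) h.
rewrite (_ : (fun s => _) = fun s => bil S (c s) (c s)); last first.
  by apply/funext => s; rewrite bilE.
apply: iff_trans h _.
exact: (@contact_algebra S v0 v1 v2 (E t) (A t) (B t) (derive1 E t) (derive1 A t)
  (derive1 B t) ST).
Qed.

Lemma osculating_form S t : I t -> osculating_conic c t S ->
  exists2 k, k != 0 & forall X Y Z, bil S (comb c t X Y Z) (comb c t X Y Z) =
    k * (Y ^+ 2 - 2 * X * Z + 2 / 3 * E t * Y * Z + cgam E A t * Z ^+ 2).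
Proof.
move=> It [ST uS] /(osculating_eqs It ST).
move: (framed_det fc It); rewrite /comb.
move: (c t) (derive1 c t) (derive1 (derive1 c) t) (cgam E A t) => v0 v1 v2 g d0.
move=> [b00 b01 b02 b12 b22]; exists (bil S v1 v1) => [|X Y Z].
  by rewrite -oppr_eq0 -b02; apply: nondegenerate_form b01.
by rewrite bil_frame// b00 b01 b02 b12 b22; field.
Qed.

Lemma osculating_conic_exists t : I t -> exists S, osculating_conic c t S.
Proof.
move=> It; have [S [ST uS [[b00 b01] b02] b11 [b12 b22]]] :=
  form_exists (E t / 3) (cgam E A t) (framed_det fc It).
exists S; split=> //; apply/(osculating_eqs It ST).
by rewrite b11 mulr1 mul1r.
Qed.

Lemma on_osculatingP t X Y Z : I t ->
  on_osculating_conic c t (comb c t X Y Z) <-> conic_eq E A t X Y Z.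
Proof.
move=> It; split=> [[S oS]|h].
  have [k k0 e] := osculating_form It oS.
  by rewrite -bilE e => /eqP; rewrite mulf_eq0 (negPf k0) /= => /eqP.
have [S oS] := osculating_conic_exists It; exists S => //.
by have [k k0 e] := osculating_form It oS; rewrite -bilE e h mulr0.
Qed.

End FramedCurve.

(** * Parallel sections and the Riccati equation *)

Section ParallelCoordinates.
Variables (R : realType) (I : set R).
Hypothesis oI : open I.

Lemma comb_lin (c : R -> 'cV[R]_3) t a b (X Y Z X' Y' Z' : R) :
  a *: comb c t X Y Z + b *: comb c t X' Y' Z' =
  comb c t (a * X + b * X') (a * Y + b * Y') (a * Z + b * Z').
Proof.
rewrite /comb; move: (c t) (derive1 c t) (derive1 (derive1 c) t) => u v w.
by apply/matrixP => i j; rewrite !mxE; ring.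
Qed.

Lemma comb1 (c : R -> 'cV[R]_3) t : c t = comb c t 1 0 0.
Proof. by rewrite /comb !scale0r !addr0 scale1r. Qed.

Lemma comb2 (c : R -> 'cV[R]_3) t : derive1 c t = comb c t 0 1 0.
Proof. by rewrite /comb !scale0r addr0 add0r scale1r. Qed.

(** The equation for the ratio y / z in homogeneous form: both sides are multiplied by s^2 when (y,
    z) is multiplied by a function s. It thus concerns the direction only and makes sense where z =
    0. *)
Definition riccati (E A : R -> R) (y z : R -> R) t : Prop :=
  z t * derive1 y t - y t * derive1 z t =
  y t ^+ 2 / 2 + 2 / 3 * E t * y t * z t - (A t + cgam E A t / 2) * z t ^+ 2.

(* The definition of [parallel_section] in the moving frame (c, c', c''). The
   point of the osculating conic is X c + Y c' + Z c''; it is c iff Z = 0. The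
   direction is y c' + z c'' modulo c. *)
Definition parallel_coord (E A : R -> R) (y z : R -> R) : Prop :=
  exists X Y Z : R -> R, [/\ smooth_on I X, smooth_on I Y, smooth_on I Z &
    forall t, I t -> [/\ ~ [/\ X t = 0, Y t = 0 & Z t = 0],
      conic_eq E A t (X t) (Y t) (Z t),
      Z t != 0 -> Z t * (X t + derive1 Y t + A t * Z t) =
                  Y t * (Y t + derive1 Z t + E t * Z t),
      ~ (\forall s \near t, Z s = 0)
    & [/\ ~ (y t = 0 /\ z t = 0), Z t != 0 -> Y t * z t = Z t * y t
        & Z t = 0 -> z t = 0]]].

Section Frame.
Variables (c : R -> 'cV[R]_3) (E A : R -> R).
Hypothesis fc : framed I c E A.

(** The component [W] along c is left existential, since tangency to a line through c is a condition
    modulo c. *)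
Lemma dif_comb x (X Y Z X' Y' Z' : R -> R) :
  (forall t, I t -> x t = comb c t (X t) (Y t) (Z t)) ->
  dif I X X' -> dif I Y Y' -> dif I Z Z' ->
  exists W, dif I x (fun t => comb c t (W t) (X t + Y' t + A t * Z t)
    (Y t + Z' t + E t * Z t)).
Proof.
move=> xE dX dY dZ; have s0 := framed_smooth fc; have s1 := smooth_derive1 s0.
have s2 := smooth_derive1 s1.
have d0 := smooth_dif s0; have d1 := smooth_dif s1; have d2 := smooth_dif s2.
have [B _ eB] := framed_eq fc.
exists (fun t => X' t + B t * Z t).
apply: (dif_ext oI (fun t It => esym (xE t It))).
apply: dif_eq (difD (difD (difZ dX d0) (difZ dY d1)) (difZ dZ d2)) _ => t It.
move: (eB t It); rewrite /comb; move: (derive1 (derive1 (derive1 c)) t) => v3 ->.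
move: (c t) (derive1 c t) (derive1 (derive1 c) t) => u v w.
by apply/matrixP => i j; rewrite !mxE; ring.
Qed.

Lemma projeq_comb t X Y Z : I t -> ~ [/\ X = 0, Y = 0 & Z = 0] ->
  conic_eq E A t X Y Z -> projeq (comb c t X Y Z) (c t) <-> Z = 0.
Proof.
move=> It n0 ce; split=> [[a a0 e]|Z0].
  have e' : comb c t X Y Z = comb c t a 0 0.
    by rewrite e /comb !scale0r !addr0.
  by have [_ _ ->] := comb_inj fc It e'.
have Y0 : Y = 0.
  move: ce; rewrite /conic_eq Z0 expr0n /= !mulr0 subr0 !addr0 => /eqP.
  by rewrite sqrf_eq0 => /eqP.
exists X; last by rewrite /comb Y0 Z0 !scale0r !addr0.
by apply/eqP => X0; apply: n0.
Qed.

Lemma smooth_crd x : smooth_on I x ->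
  [/\ smooth_on I (fun t => (crd c t (x t)).1.1 : R),
      smooth_on I (fun t => (crd c t (x t)).1.2 : R)
    & smooth_on I (fun t => (crd c t (x t)).2 : R)].
Proof.
move=> sx; have s0 := framed_smooth fc; have s1 := smooth_derive1 s0.
have s2 := smooth_derive1 s1; have d0 := framed_det fc.
by rewrite /crd /=; split; smooth_tac.
Qed.

Lemma same_tangent_crd t v : I t ->
  same_tangent (c t) v 0 <-> (crd c t v).1.2 = 0 /\ (crd c t v).2 = 0.
Proof.
move=> It; rewrite /same_tangent subr0; split=> [[a ->]|].
  have -> : a *: c t = comb c t a 0 0 by rewrite /comb !scale0r !addr0.
  by rewrite (combK fc).
case: (crd c t v) (crdK fc v It) => -[a b] k /= <- [-> ->].
by exists a; rewrite /comb !scale0r !addr0.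
Qed.

(** Where Z is nonzero, x' lies in the span of x and c iff the components of x' along (c', c'') are
    proportional to those of x, which is the cross-multiplied equation of [parallel_coord]. *)
Lemma parallel_sectionP u : parallel_section I c u <->
  parallel_coord E A (fun t => (crd c t (u t)).1.2) (fun t => (crd c t (u t)).2).
Proof.
split=> [[x [sx x0 xh xn] xu]|[X [Y [Z [sX sY sZ h]]]]].
  have [sX sY sZ] := smooth_crd sx.
  set X := fun t => _ in sX; set Y := fun t => _ in sY; set Z := fun t => _ in sZ.
  have xE t : I t -> x t = comb c t (X t) (Y t) (Z t).
    by move=> It; rewrite /X /Y /Z (crdK fc (x t) It).
  have n0 t : I t -> ~ [/\ X t = 0, Y t = 0 & Z t = 0].
    move=> It [X0 Y0 Z0]; have [/eqP xt0 _] := x0 t It; apply: xt0.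
    by rewrite xE// X0 Y0 Z0 /comb !scale0r !addr0.
  have ce t : I t -> conic_eq E A t (X t) (Y t) (Z t).
    by move=> It; have [_] := x0 t It; rewrite xE// => /(on_osculatingP oI fc _ _ _ It).
  have pj t : I t -> projeq (x t) (c t) <-> Z t = 0.
    by move=> It; rewrite xE//; apply: projeq_comb; [|exact: n0|exact: ce].
  exists X, Y, Z; split=> // t It.
  have [W dx] := dif_comb xE (smooth_dif sX) (smooth_dif sY) (smooth_dif sZ).
  split; [exact: n0|exact: ce| | |].
  - move=> /eqP Zt; have [|a [b]] := xh t It; first by move/(pj t It).
    rewrite (difE dx It) xE// [c t]comb1 comb_lin => /(comb_inj fc It)[_ e1 e2].
    by rewrite e1 e2; ring.
  - move=> nZ; apply: (xn t It); near=> s.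
    have Is : I s by near: s; exact: open_nbhs_nbhs.
    by apply/(pj s Is); near: s.
  - have [nu u1 u2] := xu t It; rewrite (same_tangent_crd _ It) in nu.
    split=> [//|/eqP Zt|/(pj t It)/u2[a [b ub]]].
      have [|a [b]] := u1; first by move/(pj t It).
      rewrite xE// -{1}(crdK fc (u t) It) [c t]comb1 comb_lin.
      by move=> /(comb_inj fc It)[_ -> ->]; ring.
    rewrite ub [c t]comb1 comb2 comb_lin (combK fc)//=.
    by rewrite !mulr0 addr0.
pose x t := comb c t (X t) (Y t) (Z t).
have xE t : I t -> x t = comb c t (X t) (Y t) (Z t) by [].
have pj t : I t -> projeq (x t) (c t) <-> Z t = 0.
  by move=> It; have [n0 ce _ _ _] := h t It; exact: projeq_comb.
have [W dx] := dif_comb xE (smooth_dif sX) (smooth_dif sY) (smooth_dif sZ).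
exists x; first split.
- have s0 := framed_smooth fc; have s1 := smooth_derive1 s0.
  have s2 := smooth_derive1 s1; rewrite /x /comb; smooth_tac.
- move=> t It; have [n0 ce _ _ _] := h t It; split.
    apply/eqP => e; apply: n0; apply: (comb_inj fc It).
    by rewrite -/(x t) e /comb !scale0r !addr0.
  exact/(on_osculatingP oI fc).
- move=> t It npj; have [_ _ hz _ _] := h t It.
  have Z0 : Z t != 0 by apply/eqP => /(pj t It).
  (* The component along c'' forces the factor of x; the factor of c then absorbs what remains along
     c. *)
  exists ((Y t + derive1 Z t + E t * Z t) / Z t).
  exists (W t - ((Y t + derive1 Z t + E t * Z t) / Z t) * X t).
  rewrite (difE dx It) [c t]comb1 comb_lin; congr (comb c t _ _ _).
  + by rewrite mulr1 addrC subrK.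
  + by rewrite mulr0 addr0; apply: (mulfI Z0); rewrite hz//; field.
  + by rewrite mulr0 addr0 divfK.
- move=> t It nx; have [_ _ _ nZ _] := h t It; apply: nZ; near=> s.
  have Is : I s by near: s; exact: open_nbhs_nbhs.
  by apply/(pj s Is); near: s.
move=> t It; have [_ ce _ _ [nu u1 u2]] := h t It; split.
- by rewrite (same_tangent_crd _ It).
- move=> npj; have Z0 : Z t != 0 by apply/eqP => /(pj t It).
  have {}u1 := u1 Z0; case: (crd _ _ _) (crdK fc (u t) It) nu u1 u2 => -[a b] k /= <-.
  move=> nu u1 _; have k0 : k != 0.
    apply/eqP => k0; apply: nu; split=> //; move/eqP: u1.
    by rewrite k0 mulr0 eq_sym mulf_eq0 (negPf Z0) => /eqP.
  exists (X t - Z t / k * a), (Z t / k).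
  rewrite /x [c t]comb1 comb_lin; congr (comb c t _ _ _).
  + by ring.
  + by rewrite mulr0 add0r; apply: (mulIf k0); rewrite u1; field.
  + by rewrite mulr0 add0r divfK.
- move=> /(pj t It)/u2.
  case: (crd _ _ _) (crdK fc (u t) It) => -[a b] k /= <- ->.
  by exists a, b; rewrite [c t]comb1 comb2 comb_lin !mulr0 !mulr1 !addr0 add0r.
Unshelve. all: by end_near. Qed.

End Frame.

(** Where Z is nonzero the ratios y : z and Y : Z agree, and eliminating X by the equation of the
    conic turns tangency into the Riccati equation. Such times are dense in [I], and the defect [F]
    of the equation is continuous. *)
Lemma parallel_riccati (E A y z : R -> R) t : smooth_on I E -> smooth_on I A ->
  smooth_on I y -> smooth_on I z -> parallel_coord E A y z -> I t -> riccati E A y z t.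
Proof.
move=> sE sA sy sz [X [Y [Z [sX sY sZ h]]]] It.
have key s : I s -> Z s != 0 -> riccati E A y z s.
  move=> Is Z0; have [_ ce hz _ [nyz yz _]] := h s Is.
  have {}hz := hz Z0; have e := yz Z0.
  have z0 : z s != 0.
    apply/eqP => z0; apply: nyz; split=> //; move/eqP: e.
    by rewrite z0 mulr0 eq_sym mulf_eq0 (negPf Z0) => /eqP.
  have nZ : \forall r \near s, Z r != 0.
    have cZ : {for s, continuous Z} by exact: smooth_continuous sZ Is.
    have : nbhs (Z s) [set x | x != 0] by apply: open_nbhs_nbhs; split=> //; exact: open_neq.
    exact: cZ.
  have dyz := difM (smooth_dif sY) (smooth_dif sz) Is.
  have dzy := difM (smooth_dif sZ) (smooth_dif sy) Is.
  have e' : derive1 Y s * z s + Y s * derive1 z s = derive1 Z s * y s + Z s * derive1 y s.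
    rewrite -(@derive_val _ _ _ _ _ _ _ dzy).
    rewrite -(@derive_val _ _ _ _ _ _ _ dyz); apply: near_eq_derive.
    near=> r; have Ir : I r by near: r; exact: open_nbhs_nbhs.
    by have [_ _ _ _ [_ + _]] := h r Ir; apply; near: r.
  have YE : Y s = Z s / z s * y s by apply: (mulIf z0); rewrite e; field.
  move: hz ce e'; rewrite /riccati /conic_eq.
  move: (Y s) (Z s) (y s) (z s) (derive1 Y s) (derive1 Z s) (derive1 y s) (derive1 z s)
    YE Z0 z0 (X s) (cgam E A s) (E s) (A s) {e yz nyz nZ dyz dzy}.
  move=> Y0 Z0 y0 z0 Y1 Z1 y1 z1 YE Zn zn X0 g e a hz ce e'.
  have XE : X0 = (Y0 ^+ 2 + 2 / 3 * e * Y0 * Z0 + g * Z0 ^+ 2) / (2 * Z0).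
    have X2 : X0 * (2 * Z0) = Y0 ^+ 2 + 2 / 3 * e * Y0 * Z0 + g * Z0 ^+ 2.
      by apply/eqP; rewrite -subr_eq0 -oppr_eq0 -[X in _ == X]ce; apply/eqP; ring.
    by rewrite -X2 mulfK// mulf_neq0 ?pnatr_eq0.
  have Y1E : Y1 = (Z1 * y0 + Z0 * y1 - Y0 * z1) / z0 by rewrite -e'; field.
  rewrite XE Y1E YE in hz.
  (* Once X is eliminated, the tangency condition is the Riccati equation for (Y, Z), homogeneous of
     degree 2; this factor converts it into the one for (y, z). *)
  have : z0 ^+ 2 / Z0 ^+ 2 * (Z0 * ((((Z0 / z0 * y0) ^+ 2
      + 2 / 3 * e * (Z0 / z0 * y0) * Z0 + g * Z0 ^+ 2) / (2 * Z0))
      + (Z1 * y0 + Z0 * y1 - Z0 / z0 * y0 * z1) / z0 + a * Z0)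
      - Z0 / z0 * y0 * (Z0 / z0 * y0 + Z1 + e * Z0)) = 0.
    by rewrite hz subrr mulr0.
  move=> h0; apply/eqP; rewrite -subr_eq0 -[X in _ == X]h0; apply/eqP; field.
  by rewrite Zn zn.
apply/eqP; rewrite -subr_eq0; apply/negP => /negP nR.
have [_ _ _ nz _] := h t It; apply: nz.
(* Powers are written as products, the form that [smooth_tac] recognizes. *)
pose F s := z s * derive1 y s - y s * derive1 z s - (y s * y s * 2^-1
  + 2 / 3 * E s * y s * z s
  - (A s + (- A s + derive1 E s * 3^-1 - E s * E s * 9^-1) * 2^-1) * (z s * z s)).
have FE s : F s = z s * derive1 y s - y s * derive1 z s -
   (y s ^+ 2 / 2 + 2 / 3 * E s * y s * z s - (A s + cgam E A s / 2) * z s ^+ 2).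
  by rewrite /F /cgam !expr2.
have sF : smooth_on I F by rewrite /F; smooth_tac.
have cF : {for t, continuous F} by exact: smooth_continuous sF It.
have nF : \forall s \near t, F s != 0.
  have : nbhs (F t) [set x | x != 0].
    by apply: open_nbhs_nbhs; split=> /=; [exact: open_neq|rewrite FE].
  exact: cF.
near=> s; have Is : I s by near: s; exact: open_nbhs_nbhs.
apply/eqP; apply: contraT => Zs.
have /eqP : F s = 0 by rewrite FE (key s Is Zs) subrr.
by apply: contraTT => _; near: s.
Unshelve. all: by end_near. Qed.

(** The conic is parametrized by its lines through c: the line of direction y : z meets it again at
    the point with Y = y z, Z = z^2 and X given by the equation of the conic. The formula stays
    smooth at z = 0, where this point is c. *)
Lemma riccati_parallel (E A y z : R -> R) : smooth_on I E -> smooth_on I A ->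
  smooth_on I y -> smooth_on I z -> (forall t, I t -> ~ (y t = 0 /\ z t = 0)) ->
  (forall t, I t -> riccati E A y z t) -> parallel_coord E A y z.
Proof.
move=> sE sA sy sz n0 ric.
pose X t := (y t * y t + 2 / 3 * E t * y t * z t
  + (- A t + derive1 E t * 3^-1 - E t * E t * 9^-1) * (z t * z t)) * 2^-1.
pose Y t := y t * z t; pose Z t := z t * z t.
have dy := smooth_dif sy; have dz := smooth_dif sz.
have dY : dif I Y (fun t => derive1 y t * z t + y t * derive1 z t) by exact: difM.
have dZ : dif I Z (fun t => derive1 z t * z t + z t * derive1 z t) by exact: difM.
exists X, Y, Z; split; rewrite ?/X ?/Y ?/Z; try by smooth_tac.
move=> t It; rewrite -/(X t) -/(Y t) -/(Z t).
have Z0E : Z t = 0 -> z t = 0 by move/eqP; rewrite mulf_eq0 orbb => /eqP.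
split.
- case=> X0 _ /Z0E z0; apply: (n0 t It); split=> //.
  move/eqP: X0; rewrite /X z0 !mulr0 !addr0 mulf_eq0 invr_eq0 pnatr_eq0 orbF.
  by rewrite mulf_eq0 orbb => /eqP.
- by rewrite /conic_eq /cgam /X /Y /Z; field.
- move=> _; have := ric t It; rewrite (difE dY It) (difE dZ It) /riccati /cgam.
  rewrite /X /Y /Z; move: (derive1 y t) (derive1 z t) (derive1 E t) (y t) (z t) (E t) (A t).
  move=> y1 z1 e' y0 z0 e a h.
  have E1 : z0 * y1 = y0 * z1 + (z0 * y1 - y0 * z1) by ring.
  have : z0 * z0 * (z0 * y1 - y0 * z1) =
    z0 * z0 * (y0 ^+ 2 / 2 + 2 / 3 * e * y0 * z0
      - (a + (- a + e' / 3 - e ^+ 2 / 9) / 2) * z0 ^+ 2) by rewrite h.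
  move=> h2; apply/eqP; rewrite -subr_eq0; move/eqP: h2; rewrite -subr_eq0 => /eqP h2.
  by rewrite -[X in _ == X]h2; apply/eqP; field.
(* If z vanished near t, then z' would vanish at t too, and the Riccati equation would give y =
   0. *)
- move=> nz; have nz' : \forall s \near t, z s = 0.
    near=> s; have : Z s = 0 by near: s.
    by move/eqP; rewrite mulf_eq0 orbb => /eqP.
  have zt := nbhs_singleton nz'.
  have z1 : derive1 z t = 0.
    by rewrite derive1E (near_eq_derive _ (g := fun=> 0))// -derive1E derive1_cst.
  apply: (n0 t It); split=> //; have := ric t It.
  rewrite /riccati zt z1 expr0n /= !mulr0 mul0r subrr addr0 subr0 => /esym/eqP.
  by rewrite mulf_eq0 invr_eq0 pnatr_eq0 orbF sqrf_eq0 => /eqP.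
- split=> [|_|/Z0E//]; first exact: n0.
  by rewrite /Y /Z; ring.
Unshelve. all: by end_near. Qed.

End ParallelCoordinates.

(** * Independence of the homogeneous lift *)

Section Rescaling.
Variables (R : realType) (I : set R).
Hypothesis oI : open I.

Lemma derive1nD n (f g : R -> R) t : smooth_on I f -> smooth_on I g -> I t ->
  derive1n n (fun t => f t + g t) t = derive1n n f t + derive1n n g t.
Proof.
elim: n f g t => [//|n IH] f g t sf sg It; rewrite !derive1Sn.
rewrite (derive1n_eq n (g := fun t => derive1 f t + derive1 g t) oI _ It).
  by apply: IH It; exact: smooth_derive1.
by move=> s Is; rewrite (difE (difD (smooth_dif sf) (smooth_dif sg)) Is).
Qed.

(** Induction on the order: in f' g + f g' both g and g' vanish to the order k. *)
Lemma vanishes_mul k (f g : R -> R) t : smooth_on I f -> smooth_on I g -> I t ->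
  vanishes_to_order g t k -> vanishes_to_order (fun t => f t * g t) t k.
Proof.
move=> + + It; elim: k f g => [|k IH] f g sf sg vg [|j] jk //=.
- by have := vg 0%N isT; rewrite /= => ->; rewrite mulr0.
- by have := vg 0%N isT; rewrite /= => ->; rewrite mulr0.
have sf1 := smooth_derive1 sf; have sg1 := smooth_derive1 sg.
rewrite -derive1nS derive1Sn (derive1n_eq j (g := fun t => derive1 f t * g t
  + f t * derive1 g t) oI _ It).
  rewrite (derive1nD j (smoothM oI sf1 sg) (smoothM oI sf sg1) It).
  rewrite (IH _ _ sf1 sg)// ?(IH _ _ sf sg1) ?addr0//.
    by move=> i ik; rewrite -derive1Sn; apply: vg.
  by move=> i ik; apply: vg; exact: leqW.
by move=> s Is; rewrite (difE (difM (smooth_dif sf) (smooth_dif sg)) Is).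
Qed.

Variables (c : R -> 'cV[R]_3) (f : R -> R).
Hypotheses (sc : smooth_on I c) (sf : smooth_on I f) (f0 : forall t, I t -> f t != 0).
Variable fc : R -> 'cV[R]_3.
Hypothesis fcE : forall t, I t -> fc t = f t *: c t.

(** S(f c, f c) is f^2 S(c, c), and a smooth factor preserves vanishing to a given order. *)
Lemma osculating_conic_scale t S : I t -> osculating_conic c t S -> osculating_conic fc t S.
Proof.
move=> It [ST uS vS]; split=> //.
have F s : I s -> pairing ((fc s)^T *m S) (fc s) = f s * f s * bil S (c s) (c s).
  by move=> Is; rewrite -bilE fcE// bilZl bilZr mulrA.
move=> j j4; rewrite (derive1n_eq j oI F It); move: j j4.
have E : (fun s => pairing ((c s)^T *m S) (c s)) = fun s => bil S (c s) (c s).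
  by apply/funext => s; rewrite bilE.
rewrite E in vS.
refine (@vanishes_mul 4 (fun s => f s * f s) (fun s => bil S (c s) (c s)) t _ _ It vS).
  smooth_tac.
(* A combination of the rows of S, to which the smoothness rules apply. *)
have [l sl lE] : exists2 l : R -> 'rV[R]_3, smooth_on I l & forall s, (c s)^T *m S = l s.
  exists (fun s => c s 0 0 *: row 0 S + c s 1 0 *: row 1 S + c s 2%:R 0 *: row 2%:R S).
    have /(smooth_mxP _ oI) sc' := sc.
    have s0 := sc' 0 0; have s1 := sc' 1 0; have s2 := sc' 2%:R 0.
    have r i : smooth_on I (fun=> row i S).
      by apply/(smooth_mxP _ oI) => a b; exact: smooth_cst.
    exact: (smoothDv oI (smoothDv oI (smoothZ oI s0 (r _)) (smoothZ oI s1 (r _)))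
      (smoothZ oI s2 (r _))).
  by move=> s; apply/matrixP => i j; rewrite (ord1 i) !mxE sum3 !mxE.
have -> : (fun s => bil S (c s) (c s)) = fun s => pairing (l s) (c s).
  by apply/funext => s; rewrite bilE lE.
smooth_tac.
Qed.

Lemma projeq_scale x t : I t -> projeq x (fc t) <-> projeq x (c t).
Proof.
move=> It; split=> -[a a0 ->]; last first.
  by exists (a / f t); rewrite ?mulf_neq0 ?invr_eq0 ?f0// fcE// scalerA divfK ?f0.
by exists (a * f t); rewrite ?mulf_neq0 ?f0// fcE// scalerA.
Qed.

(** The same x is a witness, because conics, joining lines and tangent directions do not see the
    lift. The comparison of v with u is pointwise, each being any representative of the
    direction. *)
Lemma parallel_section_scale u v : parallel_section I c u ->
  (forall t, I t -> exists2 s : R, s != 0 & exists k, v t = s *: u t + k *: c t) ->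
  parallel_section I fc v.
Proof.
move=> [x [sx x0 xh xn] xu] uv.
have dfc := dif_ext oI (fun s Is => esym (fcE Is)) (difZ (smooth_dif sf) (smooth_dif sc)).
exists x; first split=> //.
- move=> t It; have [xt0 [S oS Sx]] := x0 t It; split=> //.
  by exists S => //; exact: osculating_conic_scale.
- move=> t It /(projeq_scale _ It) npj; have [a [b ->]] := xh t It npj.
  by exists a, (b / f t); rewrite fcE// scalerA divfK ?f0.
- move=> t It nx; apply: (xn t It); near=> s.
  have Is : I s by near: s; exact: open_nbhs_nbhs.
  by apply/(projeq_scale _ Is); near: s.
move=> t It; have [s s0 [k vE]] := uv t It; have [nu u1 u2] := xu t It; split.
- move=> [a]; rewrite subr0 vE => e; apply: nu; exists (s^-1 * (a * f t - k)).
  by rewrite subr0 -scalerA scalerBl -scalerA -fcE// -e addrK scalerA mulVf// scale1r.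
- move=> /(projeq_scale _ It)/u1[a [b ->]].
  exists ((a - b * s^-1 * k) / f t), (b * s^-1).
  rewrite vE fcE//; apply/matrixP => i j; rewrite !mxE.
  by field; rewrite s0 f0.
- move=> /(projeq_scale _ It)/u2[a [b ub]].
  exists ((s * a + k - s * b / f t * derive1 f t) / f t), (s * b / f t).
  rewrite (difE dfc It) vE ub fcE//.
  move: (derive1 c t) (derive1 f t) => c1 f1; apply/matrixP => i j; rewrite !mxE.
  by field; exact: f0.
Unshelve. all: by end_near. Qed.

End Rescaling.

Section FrameExists.
Variables (R : realType) (I : set R).
Hypothesis oI : open I.

Lemma framed_exists (c : R -> 'cV[R]_3) : smooth_on I c ->
  (forall t, I t -> det3 (c t) (derive1 c t) (derive1 (derive1 c) t) != 0) ->
  exists E A, framed I c E A.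
Proof.
move=> s0 d0; have s1 := smooth_derive1 s0; have s2 := smooth_derive1 s1.
have s3 := smooth_derive1 s2.
exists (fun t => det3 (c t) (derive1 c t) (derive1 (derive1 (derive1 c)) t) *
  (det3 (c t) (derive1 c t) (derive1 (derive1 c) t))^-1).
exists (fun t => det3 (c t) (derive1 (derive1 (derive1 c)) t) (derive1 (derive1 c) t) *
  (det3 (c t) (derive1 c t) (derive1 (derive1 c) t))^-1).
split; [exact: s0|exact: d0|smooth_tac|smooth_tac|].
exists (fun t => det3 (derive1 (derive1 (derive1 c)) t) (derive1 c t) (derive1 (derive1 c) t)
  * (det3 (c t) (derive1 c t) (derive1 (derive1 c) t))^-1); first smooth_tac.
move=> t It; move: (d0 t It).
move: (c t) (derive1 c t) (derive1 (derive1 c) t) (derive1 (derive1 (derive1 c)) t).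
move=> v0 v1 v2 v3 dn; have := det3_expand v0 v1 v2 v3.
move: (det3 v0 v1 v2) (det3 v3 v1 v2) (det3 v0 v3 v2) (det3 v0 v1 v3) dn => d x y z dn e.
apply: (scalerI dn); rewrite e !scalerDr !scalerA ![d * _]mulrC !divfK//.
by rewrite addrC [x *: _ + _]addrC addrA.
Qed.

End FrameExists.

Opaque crd.

(** No-twist for the lifts, with v |-> Q x v in the role of psi. *)
Definition dual_transport (R : realType) (I : set R) (Q : R -> 'cV[R]_3)
    (P : R -> 'rV[R]_3) : Prop :=
  forall u, parallel_section I Q u ->
  parallel_section I (fun t => (P t)^T) (fun t => (cross (Q t) (u t))^T).

(** * The moving frame of the dual curve *)

Section NormalizedPair.
Variables (R : realType) (I : set R).
Hypotheses (oI : open I) (II : is_interval I).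

Lemma derive1_dif2 (V : normedModType R) (c c1 c2 : R -> V) t :
  dif I c c1 -> dif I c1 c2 -> I t -> derive1 (derive1 c) t = c2 t.
Proof.
move=> d0 d1 It; apply: (difE (I := I)) It.
by apply: (dif_ext oI _ d1) => s Is; rewrite (difE d0 Is).
Qed.

Lemma derive1_dif3 (V : normedModType R) (c c1 c2 c3 : R -> V) t :
  dif I c c1 -> dif I c1 c2 -> dif I c2 c3 -> I t ->
  derive1 (derive1 (derive1 c)) t = c3 t.
Proof.
move=> d0 d1 d2 It; apply: (difE (I := I)) It.
by apply: (dif_ext oI _ d2) => s Is; rewrite (derive1_dif2 d0 d1 Is).
Qed.

Lemma parallel_coord_ext (E A A' y y' z z' : R -> R) :
  (forall t, I t -> A t = A' t) -> (forall t, I t -> y t = y' t) ->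
  (forall t, I t -> z t = z' t) ->
  parallel_coord I E A y z -> parallel_coord I E A' y' z'.
Proof.
move=> eA ey ez [X [Y [Z [sX sY sZ h]]]]; exists X, Y, Z; split=> // t It.
by have := h t It; rewrite /conic_eq /cgam eA// ey// ez.
Qed.

Variables (Q : R -> 'cV[R]_3) (P : R -> 'rV[R]_3) (al : R -> R).
Hypotheses (sQ : smooth_on I Q) (sP : smooth_on I P) (sal : smooth_on I al).
Hypothesis PQ1 : forall t, I t -> pairing (P t) (Q t) = 1.
Hypothesis P'E : forall t, I t ->
  derive1 P t = cross (Q t) (derive1 Q t) + al t *: P t.
Variables E A : R -> R.
Hypothesis fQ : framed I Q E A.

Let Q1 := derive1 Q.
Let Q2 := derive1 Q1.
Let dQ : dif I Q Q1 := smooth_dif sQ.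
Let dQ1 : dif I Q1 Q2 := smooth_dif (smooth_derive1 sQ).
Let dal : dif I al (derive1 al) := smooth_dif sal.

Let P1 t := cross (Q t) (Q1 t) + al t *: P t.
Let P2 t := cross (Q t) (Q2 t) + derive1 al t *: P t + al t *: P1 t.

Lemma dif_P1 : dif I P P1.
Proof. exact: dif_eq (smooth_dif sP) P'E. Qed.

Lemma dif_P2 : dif I P1 P2.
Proof.
have dP := dif_P1; rewrite /P1; dif_tac => t _.
by rewrite crossvv add0r /P2 -addrA.
Qed.

(** Derivative of P Q = 1, where (Q x Q') Q = 0. *)
Lemma pairing_PQ1 t : I t -> pairing (P t) (Q1 t) = - al t.
Proof.
move=> It; have d1 : dif I (fun t => pairing (P t) (Q t)) (fun=> 0).
  by apply: (dif_ext oI _ (dif_cst (1 : R))) => s Is; rewrite PQ1.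
have := dif_unique d1 (dif_pairing dif_P1 dQ) It.
rewrite /P1 !pairing_lin PQ1// pairing_cross det3_aba add0r mulr1 => /esym/eqP.
by rewrite addrC addr_eq0 => /eqP.
Qed.

Lemma pairing_PQ2 t : I t -> pairing (P t) (Q2 t) = al t ^+ 2 - derive1 al t.
Proof.
move=> It; have d1 : dif I (fun t => pairing (P t) (Q1 t)) (fun t => - derive1 al t).
  by apply: (dif_ext oI _ (difN dal)) => s Is; rewrite pairing_PQ1.
have := dif_unique d1 (dif_pairing dif_P1 dQ1) It.
rewrite {1}/P1 !pairing_lin pairing_cross det3_abb add0r pairing_PQ1// => ->.
by ring.
Qed.

Let PT t := (P t)^T.
Let Ah t := A t - E t * al t + 3 * derive1 al t.

Lemma dual_derive t : I t ->
  derive1 PT t = (P1 t)^T /\ derive1 (derive1 PT) t = (P2 t)^T.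
Proof.
move=> It; have d1 := dif_tr dif_P1; have d2 := dif_tr dif_P2.
by split; [exact: (difE d1 It)|exact: derive1_dif2 d1 d2 It].
Qed.

(** The third derivative of P contains Q' x Q''. Expanding P in the basis dual to (Q, Q', Q'')
    expresses this covector through P, Q x Q' and Q x Q'', and the coefficients in the frame of P
    are then collected. *)
Lemma framed_dual : framed I PT E Ah.
Proof.
have sQ1 : smooth_on I Q1 := smooth_derive1 sQ.
have sal1 := smooth_derive1 sal; have sal2 := smooth_derive1 sal1.
have dal1 := smooth_dif sal1.
have d0 := dif_P1; have d1 := dif_P2.
have [B sB eB] := framed_eq fQ; have sE := framed_E fQ; have sA := framed_A fQ.
have sQ2 : smooth_on I Q2 := smooth_derive1 sQ1.
have dQ2 : dif I Q2 (derive1 Q2) := smooth_dif sQ2.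
split.
- exact: smooth_tr.
- move=> t It; have [-> ->] := dual_derive It.
  (* Modulo the earlier members of the frame, P' and P'' are Q x Q' and Q x Q'', whose cross product
     is the determinant times Q. *)
  have -> : det3 (PT t) (P1 t)^T (P2 t)^T =
      pairing (P t) (Q t) * det3 (Q t) (Q1 t) (Q2 t).
    rewrite /P2 /P1 /PT; move: (P t) (Q t) (Q1 t) (Q2 t) (al t) (derive1 al t).
    move=> p v v1 v2 a a'; rewrite !det3E; comps; ring.
  rewrite PQ1// mul1r. exact (framed_det fQ It).
- exact: sE.
- rewrite /Ah; smooth_tac.
pose D t := det3 (Q t) (Q1 t) (Q2 t).
exists (fun t => D t + al t * (al t * al t) - E t * derive1 al t - A t * al t
  + derive1 (derive1 al) t).
  rewrite /D; smooth_tac.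
move=> t It; have [-> ->] := dual_derive It.
pose P3 t := cross (Q1 t) (Q2 t) + cross (Q t) (derive1 Q2 t)
  + derive1 (derive1 al) t *: P t + 2 * derive1 al t *: P1 t + al t *: P2 t.
have d2 : dif I P2 P3.
  rewrite /P2; dif_tac => s _; rewrite /P3 -/(P2 s).
  move: (P1 s) (P2 s) (P s) (cross (Q1 s) (Q2 s)) (cross (Q s) (derive1 Q2 s)).
  move: (derive1 (derive1 al) s) (derive1 al s) (al s) => a2 a1 a0 u v w m n.
  by apply/matrixP => i j; rewrite !(entD, entZ); ring.
rewrite (derive1_dif3 (dif_tr d0) (dif_tr d1) (dif_tr d2) It).
have e3 := eB t It.
have := det3_coexpand (Q t) (Q1 t) (Q2 t) (P t).
rewrite PQ1// pairing_PQ1// pairing_PQ2// scale1r -/(D t) => eD.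
have {}eD : cross (Q1 t) (Q2 t) = D t *: P t - al t *: cross (Q t) (Q2 t)
    - (al t ^+ 2 - derive1 al t) *: cross (Q t) (Q1 t).
  rewrite eD crossC [cross (Q2 t) (Q t)]crossC; move: (cross _ _) (cross _ _) (cross _ _).
  by move=> u v w; apply/matrixP => i j; rewrite !(entD, entN, entZ); ring.
rewrite /P3 eD (e3 : derive1 Q2 t = _) /Ah /P2 /P1 /PT.
rewrite crossDr [cross _ (_ + A t *: _)]crossDr !crossZr crossvv scaler0 addr0.
move: (cross (Q t) (Q1 t)) (cross (Q t) (Q2 t)) (P t) (D t) (E t) (A t).
move: (derive1 al t) (derive1 (derive1 al) t) (al t) => a1 a2 a m1 m2 p d e a0.
by apply/matrixP => i j; rewrite !(entT, entD, entN, entZ); ring.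
Qed.

Lemma crd_dual t u : I t -> let k := crd Q t u in
  (crd PT t (cross (Q t) u)^T).1.2 = k.1.2 - al t * k.2 /\
  (crd PT t (cross (Q t) u)^T).2 = k.2.
Proof.
move=> It; case: (crd Q t u) (crdK fQ u It) => -[x y] z /= <-.
have [e1 e2] := dual_derive It.
suff [W ->] : exists W, (cross (Q t) (comb Q t x y z))^T = comb PT t W (y - al t * z) z.
  by rewrite (combK framed_dual).
exists (- al t * y - (derive1 al t) * z).
rewrite /comb e1 e2 /PT /P2 /P1 !crossDr !crossZr crossvv -/Q1 -/Q2.
move: (cross (Q t) (Q1 t)) (cross (Q t) (Q2 t)) (P t) => m1 m2 p.
by apply/matrixP => i j; rewrite !(entT, entD, entN, entZ, ent0); ring.
Qed.

(** With [al] zero, the dual coefficient is A and Q x u has the coordinates of u, so both sides are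
    the same condition. *)
Lemma dual_transport0 : (forall t, I t -> al t = 0) -> dual_transport I Q P.
Proof.
move=> al0 u /(parallel_sectionP oI fQ) h; apply/(parallel_sectionP oI framed_dual).
apply: parallel_coord_ext h => t It.
- have a1 : derive1 al t = 0.
    apply: (difE (I := I)) It; apply: (dif_ext oI _ (dif_cst (0 : R))).
    by move=> s /al0 ->.
  by rewrite /Ah a1 al0// !mulr0 subr0 addr0.
- have [e _] := crd_dual (u t) It; apply: etrans (esym e).
  by rewrite (al0 _ It) mul0r subr0.
- have [_ e] := crd_dual (u t) It; exact: esym e.
Qed.

Lemma al_eq0_of_dual_transport : dual_transport I Q P -> forall t, I t -> al t = 0.
Proof.
move=> NT t0 It0.
have sE := framed_E fQ; have sA := framed_A fQ.
have sE1 := smooth_derive1 sE; have sal1 := smooth_derive1 sal.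
(* The choice z' = - y / 2 linearizes the Riccati equation: - y z' accounts for y^2 / 2, and z y'
   for the other terms. *)
pose a t := 2 / 3 * E t.
pose b t := - (A t + (- A t + derive1 E t * 3^-1 - E t * E t * 9^-1) * 2^-1).
have sa : smooth_on I a by rewrite /a; smooth_tac.
have sb : smooth_on I b by rewrite /b; smooth_tac.
have s0 k : smooth_on I (fun=> k : R) by exact: smooth_cst.
have cont (f : R -> R) : smooth_on I f -> forall t, I t -> {for t, continuous f}.
  by move=> sf t It; exact: smooth_continuous sf It.
have ode y0 z0 := linear_ode oI II (cont _ sa) (cont _ sb) (cont _ (s0 (- 2^-1)))
  (cont _ (s0 0)) y0 z0 It0.
(* The difference of the Riccati equations of (y, z) and of its image (y - al z, z), taken at
   [t0]. *)
have key (y z : R -> R) : smooth_on I y -> smooth_on I z ->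
    dif I y (fun t => a t * y t + b t * z t) ->
    dif I z (fun t => - 2^-1 * y t + 0 * z t) ->
    (forall t, I t -> ~ (y t = 0 /\ z t = 0)) ->
    - derive1 al t0 * z t0 ^+ 2 = - al t0 * y t0 * z t0
      + (al t0 ^+ 2 / 2 - 2 / 3 * E t0 * al t0 + (E t0 * al t0 - 3 * derive1 al t0) / 2)
        * z t0 ^+ 2.
  move=> sy sz dy dz nyz.
  have ric t : I t -> riccati E A y z t.
    by move=> It; rewrite /riccati (difE dy It) (difE dz It) /a /b /cgam; field.
  have pc := riccati_parallel oI sE sA sy sz nyz ric.
  pose u t := comb Q t 0 (y t) (z t).
  have pu : parallel_section I Q u.
    apply/(parallel_sectionP oI fQ); apply: parallel_coord_ext pc => // t It;
      by have ku := combK fQ 0 (y t) (z t) It; rewrite /u ku.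
  have /(parallel_sectionP oI framed_dual) pd := NT u pu.
  have pd' : parallel_coord I E Ah (fun t => y t - al t * z t) z.
    apply: parallel_coord_ext pd => // t It; have ku := combK fQ 0 (y t) (z t) It.
      by have [e _] := crd_dual (u t) It; apply: etrans e _; rewrite /u ku.
    by have [_ e] := crd_dual (u t) It; apply: etrans e _; rewrite /u ku.
  have sAh : smooth_on I Ah := framed_A framed_dual.
  have sh : smooth_on I (fun t => y t - al t * z t) by smooth_tac.
  have := parallel_riccati oI sE sAh sh sz pd' It0.
  have dh : dif I (fun t => y t - al t * z t)
    (fun t => a t * y t + b t * z t - (derive1 al t * z t + al t * (- 2^-1 * y t + 0 * z t))).
    by dif_tac.
  rewrite /riccati (difE dh It0) (difE dz It0) /a /b /cgam /Ah.
  move: (y t0) (z t0) (E t0) (A t0) (derive1 E t0) (al t0) (derive1 al t0).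
  move=> y1 z1 e a1 e1 al0 al1 h; apply/eqP; rewrite -subr_eq0.
  move/eqP: h; rewrite -subr_eq0 => /eqP h; rewrite -[X in _ == X]h.
  by apply/eqP; field.
(* The initial values (0, 1) and (1, 1) have the same z, so the two instances of [key] differ by
   [al t0] alone. *)
have [y [z [y0 z0 dy dz]]] := ode 0 1.
have [v [w [v0 w0 dv dw]]] := ode 1 1.
have [sy sz] := linear_smooth oI sa sb (s0 _) (s0 _) dy dz.
have [sv sw] := linear_smooth oI sa sb (s0 _) (s0 _) dv dw.
(* The Wronskian satisfies w' = a w, where a is the trace of the system. It is nonzero at [t0], so
   (y, z) and (v, w) never vanish. *)
have W t : I t -> y t * w t - v t * z t != 0.
  apply: (@linear_nonvanishing _ _ oI II a (fun t => y t * w t - v t * z t) _ It0 sa).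
    by dif_tac => s _; ring.
  by rewrite y0 z0 v0 w0; apply/eqP; lra.
have nyz t : I t -> ~ (y t = 0 /\ z t = 0).
  by move=> It [h1 h2]; have /eqP := W t It; apply; rewrite h1 h2; ring.
have nvw t : I t -> ~ (v t = 0 /\ w t = 0).
  by move=> It [h1 h2]; have /eqP := W t It; apply; rewrite h1 h2; ring.
have := (key y z sy sz dy dz nyz, key v w sv sw dv dw nvw).
rewrite y0 z0 v0 w0 !mulr1 !mulr0 !expr1n; move: (derive1 al t0) => a1 [].
move: (al t0) (E t0) => a0 e h1 h2; rewrite !mulr1 in h1 h2.
by apply/eqP; rewrite -oppr_eq0; apply/eqP; lra.
Qed.

End NormalizedPair.

(** * Rolling maps and normalized lifts *)

Section RollingMaps.
Variable R : realType.
Implicit Types (q v w : 'cV[R]_3) (p : 'rV[R]_3) (m : 'M[R]_3).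

Lemma linD m v w : lin m (v + w) = lin m v + lin m w.
Proof. by rewrite /lin mulmxDr linearD. Qed.
Lemma linZ m k v : lin m (k *: v) = k *: lin m v.
Proof. by rewrite /lin -scalemxAr linearZ. Qed.

(* psi is determined by its projectivization up to a factor, and v |-> q x v is
   one representative. *)
Lemma in_PC_cross q p m v1 v2 : in_PC q p m -> det3 q v1 v2 != 0 ->
  exists2 mu : R, mu != 0 & forall v, same_tangent p (lin m v) (mu *: cross q v).
Proof.
move=> [r0 [a mq] minj mproj] d0; pose r := pairing p q.
have p0 : p != 0.
  by apply: contra r0 => /eqP ->; rewrite pairing0l.
have HE v : dcross (cross q v) p = r *: v - pairing p v *: q.
  by rewrite dcrossNl dcross_cross opprB.
have nt y z : (y, z) != 0 -> ~ same_tangent q (y *: v1 + z *: v2) 0.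
  move=> yz [k]; rewrite subr0 => e.
  have [|_ y0 z0] := @frame_inj _ q v1 v2 (- k) y z d0.
    by rewrite -addrA e scaleNr addNr.
  by move: yz; rewrite y0 z0 eqxx.
have lam y z : (y, z) != 0 -> exists2 k, k != 0 &
    dcross p (lin m (y *: v1 + z *: v2)) = k *: (r *: (y *: v1 + z *: v2)
      - pairing p (y *: v1 + z *: v2) *: q).
  by move=> yz; have [k k0 e] := mproj _ (nt _ _ yz); exists k; rewrite // e HE.
have n10 : ((1 : R), (0 : R)) != 0 by rewrite -pair_eqE /= negb_and oner_eq0.
have n01 : ((0 : R), (1 : R)) != 0 by rewrite -pair_eqE /= negb_and oner_eq0 orbT.
have n11 : ((1 : R), (1 : R)) != 0 by rewrite -pair_eqE /= negb_and oner_eq0.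
have [k1 k10 e1] := lam _ _ n10; have [k2 k20 e2] := lam _ _ n01.
have [k3 k30 e3] := lam _ _ n11.
rewrite !scale1r !scale0r ?add0r ?addr0 in e1 e2 e3.
(* A linear map preserving every line modulo q is scalar: its factors on v1, v2 and v1 + v2 are
   compared. *)
have k12 : k1 = k3 /\ k2 = k3.
  have [|_ h1 h2] := @frame_inj _ q v1 v2
    (k3 * (pairing p v1 + pairing p v2) - k1 * pairing p v1 - k2 * pairing p v2)
    (r * (k1 - k3)) (r * (k2 - k3)) d0.
    have : dcross p (lin m (v1 + v2)) = dcross p (lin m v1) + dcross p (lin m v2).
      by rewrite linD dcrossDr.
    rewrite e1 e2 e3 pairingDr => /eqP; rewrite eq_sym -subr_eq0 => /eqP e; rewrite -[RHS]e.
    move: (pairing p v1) (pairing p v2) => x y.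
    by apply/matrixP => i j; rewrite !(entD, entN, entZ); ring.
  by split; apply/eqP; rewrite -subr_eq0; [move/eqP: h1|move/eqP: h2];
    rewrite mulf_eq0 (negPf r0) /=.
case: k12 => E1 E2; rewrite E1 in e1; rewrite E2 in e2.
(* The sign comes from the antisymmetry of [dcross], whose arguments occur in both orders. *)
exists (- k3) => [|v]; first by rewrite oppr_eq0.
have [|k ek] := @dcross_eq0 _ p (lin m v - (- k3) *: cross q v) p0; last by exists k.
apply: (scalerI d0); rewrite scaler0 -dcrossZr.
have -> : det3 q v1 v2 *: (lin m v - - k3 *: cross q v) =
    lin m (det3 q v1 v2 *: v) + k3 *: cross q (det3 q v1 v2 *: v).
  by rewrite linZ crossZr scalerBr !scalerA mulrN scaleNr opprK [k3 * _]mulrC.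
rewrite (det3_expand q v1 v2 v) !linD !linZ !crossDr !crossZr crossvv scaler0 add0r.
have -> : lin m q = a *: p by rewrite -mq subr0.
rewrite !dcrossDr !dcrossZr !dcrossDr !dcrossZr dcrosspp !scaler0 add0r e1 e2.
rewrite !dcross_cross -/r.
move: (pairing p v1) (pairing p v2) (det3 _ _ _) (det3 _ _ _) => x y z w.
by apply/matrixP => i j; rewrite !(entD, entN, entZ, ent0); ring.
Qed.

Definition skew q : 'M[R]_3 := \matrix_(i, j) cross q (delta_mx j 0) 0 i.

Lemma lin_skew k q v : lin (k *: skew q) v = k *: cross q v.
Proof.
rewrite /lin -scalemxAl linearZ /=; congr (_ *: _).
have e (i : 'I_3) : skew q i 0 * v 0 0 + skew q i 1 * v 1 0 + skew q i 2%:R * v 2%:R 0 =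
    cross q v 0 i.
  rewrite ![skew _ _ _]mxE; move: i; apply: ord3P; rewrite !crossE !mxE /=;
  by rewrite ?eqxx /=; ring.
by apply/matrixP => i j; rewrite (ord1 i) [LHS]mxE [LHS]mxE sum3 e.
Qed.

Lemma in_PC_skew q p k : pairing p q != 0 -> k != 0 -> in_PC q p (k *: skew q).
Proof.
move=> r0 k0; have q0 : q != 0.
  by apply: contra r0 => /eqP ->; rewrite pairing0r.
split=> //.
- by rewrite lin_skew crossvv scaler0; exists 0; rewrite subr0 scale0r.
- move=> v [a]; rewrite lin_skew subr0 => e.
  (* Pairing with q kills q x v but not p, so the multiple of p is zero. *)
  have : pairing (k *: cross q v) q = pairing (a *: p) q by rewrite e.
  rewrite !pairingZl pairing_cross det3_aba mulr0 => /esym/eqP.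
  rewrite mulf_eq0 (negPf r0) orbF => /eqP a0.
  move/eqP: e; rewrite a0 scale0r scaler_eq0 (negPf k0) /= => /eqP.
  by move=> /(cross_eq0 q0)[b ->]; exists b; rewrite subr0.
- move=> v _; exists (- k); first by rewrite oppr_eq0.
  by rewrite lin_skew dcrossZr [dcross (cross _ _) _]dcrossNl scalerN scaleNr opprK.
Qed.

Lemma dancing_self (q v : 'cV[R]_3) (p l : 'rV[R]_3) : pairing p q != 0 ->
  dancing (q, p) (v, l) (v, l) =
  - 2 * (pairing l v * pairing p q - pairing l q * pairing p v) / pairing p q ^+ 2.
Proof.
by move=> r0; rewrite /dancing /neutral /horizontal_lift /= !pairing_lin; field.
Qed.

Lemma dancing_self_eq0 (q v : 'cV[R]_3) (p l : 'rV[R]_3) : pairing p q != 0 ->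
  dancing (q, p) (v, l) (v, l) = 0 <->
  pairing l v * pairing p q = pairing l q * pairing p v.
Proof.
move=> r0; rewrite dancing_self//; split=> [/eqP|->]; last by rewrite subrr mulr0 mul0r.
rewrite mulf_eq0 invr_eq0 sqrf_eq0 (negPf r0) orbF mulf_eq0 oppr_eq0 pnatr_eq0 /=.
by rewrite subr_eq0 => /eqP.
Qed.

(** After subtraction of a multiple of p the covector kills q; nullity says that it also kills v,
    hence it is a multiple of q x v. The factor is found by pairing with w. *)
Lemma null_decomposition (q v w : 'cV[R]_3) (p l : 'rV[R]_3) :
  pairing p q != 0 -> det3 q v w != 0 ->
  pairing l v * pairing p q = pairing l q * pairing p v ->
  let a := pairing l q / pairing p q in
  l = ((pairing l w - a * pairing p w) / det3 q v w) *: cross q v + a *: p.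
Proof.
move=> r0 d0 nul a; apply/eqP; rewrite -subr_eq0; apply/eqP.
set mu := _ / det3 _ _ _; set x := (X in X = 0).
have xq : pairing x q = 0.
  by rewrite /x !pairing_lin pairing_cross det3_aba /a; field.
have xv : pairing x v = 0.
  rewrite /x !pairing_lin pairing_cross det3_abb mulr0 add0r /a.
  by apply: (mulIf r0); rewrite mul0r mulrBl nul; field.
have xw : pairing x w = 0.
  by rewrite /x !pairing_lin pairing_cross /mu; field.
apply: (scalerI d0); rewrite (det3_coexpand q v w x) xq xv xw.
by rewrite !scale0r scaler0 !addr0.
Qed.

Lemma null_of_decomposition (q v : 'cV[R]_3) (p l : 'rV[R]_3) (mu a : R) :
  l = mu *: cross q v + a *: p ->
  pairing l v * pairing p q = pairing l q * pairing p v.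
Proof.
by move=> ->; rewrite !pairing_lin !pairing_cross det3_abb det3_aba; ring.
Qed.

End RollingMaps.

(** * Normalized lifts and integral curves *)

Section Normalization.
Variables (R : realType) (I : set R).
Hypotheses (oI : open I) (II : is_interval I).
Variables (q : R -> 'cV[R]_3) (p : R -> 'rV[R]_3).
Hypotheses (sq : smooth_on I q) (sp : smooth_on I p).
Hypothesis r0 : forall t, I t -> pairing (p t) (q t) != 0.
Hypothesis d0 : forall t, I t -> det3 (q t) (derive1 q t) (derive1 (derive1 q) t) != 0.
Hypothesis preg : forall t, I t -> forall a, derive1 p t <> a *: p t.

Let null := forall t, I t -> pairing (derive1 p t) (derive1 q t) * pairing (p t) (q t)
  = pairing (derive1 p t) (q t) * pairing (p t) (derive1 q t).

(* P = g p and Q = f q are the lifts with P Q = 1 and P' = Q x Q' + al P. *)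
Record normalization (mu a f g al : R -> R) : Prop := Normalization {
  nz_smooth : [/\ smooth_on I mu, smooth_on I a, smooth_on I f, smooth_on I g
                & smooth_on I al];
  nz_neq0 : forall t, I t -> [/\ mu t != 0, f t != 0 & g t != 0];
  nz_p' : forall t, I t -> derive1 p t = mu t *: cross (q t) (derive1 q t) + a t *: p t;
  nz_fgr : forall t, I t -> f t * g t * pairing (p t) (q t) = 1;
  nz_gmu : forall t, I t -> g t * mu t = f t ^+ 2;
  nz_al : forall t, I t -> al t = derive1 g t / g t + a t }.

Lemma normalization_exists : null -> exists mu a f g al, normalization mu a f g al.
Proof.
move=> nul; have sq1 := smooth_derive1 sq; have sq2 := smooth_derive1 sq1.
have sp1 := smooth_derive1 sp.
pose a t := pairing (derive1 p t) (q t) * (pairing (p t) (q t))^-1.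
have sa : smooth_on I a by rewrite /a; smooth_tac.
pose mu t := (pairing (derive1 p t) (derive1 (derive1 q) t)
  - a t * pairing (p t) (derive1 (derive1 q) t))
  * (det3 (q t) (derive1 q t) (derive1 (derive1 q) t))^-1.
have smu : smooth_on I mu by rewrite /mu; smooth_tac.
have p'E t : I t -> derive1 p t = mu t *: cross (q t) (derive1 q t) + a t *: p t.
  by move=> It; exact: null_decomposition (r0 It) (d0 It) (nul t It).
(* Regularity of the dual curve enters here: mu = 0 would make p' a multiple of p. *)
have mu0 t : I t -> mu t != 0.
  move=> It; apply/eqP => m0; apply: (preg It (a := a t)).
  by rewrite p'E// m0 scale0r add0r.
(* The value that f g r = 1 and g mu = f^2 impose on g^3, where r = p q. *)
pose h t := (mu t * (pairing (p t) (q t) * pairing (p t) (q t)))^-1.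
have h0' t : I t -> mu t * (pairing (p t) (q t) * pairing (p t) (q t)) != 0.
  by move=> It; exact: mulf_neq0 (mu0 t It) (mulf_neq0 (r0 It) (r0 It)).
have sh : smooth_on I h by rewrite /h; smooth_tac.
have h0 t : I t -> h t != 0 by move=> It; rewrite invr_eq0 h0'.
have [g sg gP] := smooth_cube_root oI II sh h0.
have g0 t : I t -> g t != 0 by move=> /gP[].
have gr0 t : I t -> g t * pairing (p t) (q t) != 0.
  by move=> It; exact: mulf_neq0 (g0 t It) (r0 It).
pose f t := (g t * pairing (p t) (q t))^-1.
have sg1 := smooth_derive1 sg.
exists mu, a, f, g, (fun t => derive1 g t * (g t)^-1 + a t); split.
- split; rewrite ?/f; smooth_tac.
- by move=> t It; split; [exact: mu0|rewrite invr_eq0 gr0|exact: g0].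
- exact: p'E.
- by move=> t It; rewrite /f -mulrA mulVf ?gr0.
- move=> t It; have [_ g3] := gP t It; rewrite /h in g3.
  rewrite /f; apply: (mulIf (h0' t It)); apply: (mulIf (g0 t It)); apply: (mulIf (g0 t It)).
  transitivity (g t ^+ 3 * mu t * (mu t * (pairing (p t) (q t) * pairing (p t) (q t)))).
    by ring.
  by rewrite g3; field; rewrite g0 ?mu0 ?r0.
- by [].
Qed.

Section WithNormalization.
Variables mu a f g al : R -> R.
Hypothesis nz : normalization mu a f g al.
Let Q t := f t *: q t.
Let P t := g t *: p t.

Let sf : smooth_on I f. Proof. by have [] := nz_smooth nz. Qed.
Let sg : smooth_on I g. Proof. by have [] := nz_smooth nz. Qed.
Let sal : smooth_on I al. Proof. by have [] := nz_smooth nz. Qed.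

Lemma smooth_Q : smooth_on I Q. Proof. exact: smoothZ. Qed.
Lemma smooth_P : smooth_on I P. Proof. exact: smoothZ. Qed.

Lemma normalized_PQ t : I t -> pairing (P t) (Q t) = 1.
Proof.
by move=> It; rewrite /P /Q pairingZl pairingZr -(nz_fgr nz It); ring.
Qed.

Lemma derive_Q t : I t -> derive1 Q t = derive1 f t *: q t + f t *: derive1 q t.
Proof. by move=> It; exact: (difE (difZ (smooth_dif sf) (smooth_dif sq)) It). Qed.

Lemma derive_P t : I t -> derive1 P t = derive1 g t *: p t + g t *: derive1 p t.
Proof. by move=> It; exact: (difE (difZ (smooth_dif sg) (smooth_dif sp)) It). Qed.

Lemma normalized_P' t : I t -> derive1 P t = cross (Q t) (derive1 Q t) + al t *: P t.
Proof.
move=> It; have [_ _ g0] := nz_neq0 nz It.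
rewrite derive_P// derive_Q// /Q /P (nz_p' nz It) (nz_al nz It).
rewrite crossZl crossDr !crossZr crossvv scaler0 add0r scalerA -expr2 -(nz_gmu nz It).
move: (cross _ _) (derive1 g t) => m g1.
by apply/matrixP => i j; rewrite !(entD, entZ); field.
Qed.

Lemma det_Q t : I t -> det3 (Q t) (derive1 Q t) (derive1 (derive1 Q) t) != 0.
Proof.
move=> It; have [_ f0 _] := nz_neq0 nz It.
have df := smooth_dif sf; have df1 := smooth_dif (smooth_derive1 sf).
have dq := smooth_dif sq; have dq1 := smooth_dif (smooth_derive1 sq).
have dQ := difZ df dq; have dQ1 := difD (difZ df1 dq) (difZ df dq1).
rewrite (derive1_dif2 oI dQ dQ1 It) (difE dQ It) /Q.
have -> : det3 (f t *: q t) (derive1 f t *: q t + f t *: derive1 q t)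
  (derive1 (derive1 f) t *: q t + derive1 f t *: derive1 q t
   + (derive1 f t *: derive1 q t + f t *: derive1 (derive1 q) t)) =
  f t ^+ 3 * det3 (q t) (derive1 q t) (derive1 (derive1 q) t).
  move: (q t) (derive1 q t) (derive1 (derive1 q) t) (f t) (derive1 f t) (derive1 (derive1 f) t).
  by move=> v0 v1 v2 f0' f1 f2; rewrite !det3E; comps; ring.
by rewrite mulf_neq0 ?d0// expf_neq0.
Qed.

Lemma projects_al0 : (forall t, I t -> al t = 0) -> projects_from_integral_curve I q p.
Proof.
move=> al0; exists Q, P; split.
  split; [exact: smooth_Q|exact: smooth_P|move=> t It; split].
    exact: normalized_PQ.
  by rewrite normalized_P'// al0// scale0r addr0.
move=> t It; have [_ f0 g0] := nz_neq0 nz It.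
by split; [exists (f t)|exists (g t)].
Qed.

(** For another lift (phi Q, P / phi), pairing the equation of D with Q gives phi' = al phi, and
    pairing it with Q'' gives phi^3 = 1. The derivative of the latter is 3 al phi^3 = 0. *)
Lemma al0_projects : projects_from_integral_curve I q p -> forall t, I t -> al t = 0.
Proof.
move=> [Q1 [P1 [[sQ1 sP1 h] pj]]].
(* The factor between the lifts is given for each t separately; this formula shows that it is
   smooth. *)
pose phi t := pairing (P t) (Q1 t).
have sphi : smooth_on I phi by have := smooth_P => sP; rewrite /phi; smooth_tac.
have Q1E t : I t -> Q1 t = phi t *: Q t.
  move=> It; have [[b b0 e] _] := pj t It; have [_ f0 g0] := nz_neq0 nz It.
  rewrite /phi e /Q /P !pairingZl pairingZr scalerA.
  congr (_ *: _); rewrite -[LHS]mulr1 -(nz_fgr nz It); ring.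
have phi0 t : I t -> phi t != 0.
  move=> It; apply/eqP => e; have [] := h t It; rewrite /Q5 /= Q1E// e scale0r.
  by rewrite pairing0r => /eqP; rewrite eq_sym oner_eq0.
have P1E t : I t -> P1 t = (phi t)^-1 *: P t.
  move=> It; have [_ [b b0 e]] := pj t It; have [_ f0 g0] := nz_neq0 nz It.
  have e' : P1 t = (b / g t) *: P t by rewrite e /P scalerA divfK.
  have [] := h t It; rewrite /Q5 /= Q1E// e' pairingZl pairingZr normalized_PQ// mulr1 => E _.
  by congr (_ *: _); apply: (mulIf (phi0 t It)); rewrite mulVf ?phi0.
have dphi := smooth_dif sphi.
have dQ := smooth_dif smooth_Q; have dP := smooth_dif smooth_P.
have key t : I t -> derive1 phi t = al t * phi t /\ phi t * (phi t * phi t) = 1.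
  move=> It; have [_] := h t It.
  have d1 : dif I Q1 (fun t => derive1 phi t *: Q t + phi t *: derive1 Q t).
    exact: (dif_ext oI (fun s Is => esym (Q1E s Is)) (difZ dphi dQ)).
  have d2 : dif I P1 (fun t => (- derive1 phi t * (phi t)^-1 * (phi t)^-1) *: P t
      + (phi t)^-1 *: derive1 P t).
    exact: (dif_ext oI (fun s Is => esym (P1E s Is)) (difZ (difV phi0 dphi) dP)).
  rewrite (difE d1 It) (difE d2 It) Q1E// normalized_P'//.
  have ph := phi0 t It; move: (det_Q It) (normalized_PQ It).
  move: (derive1 phi t) (phi t) (al t) (derive1 (derive1 Q) t) ph => x y z w y0.
  move: (derive1 Q t) (Q t) (P t) => v q0 p0 dn PQ.
  rewrite (crossZl y) crossDr !crossZr crossvv scaler0 add0r => e.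
  have e1 : x = z * y.
    have := congr1 (fun l => pairing l q0) e.
    rewrite !pairing_lin !pairing_cross det3_aba PQ !mulr0 !add0r !mulr1 => e1.
    apply/eqP; rewrite -subr_eq0 -oppr_eq0.
    have : y ^+ 2 * (- x / y / y + y^-1 * z) = 0 by rewrite e1 mulr0.
    by move=> e2; rewrite -[X in _ == X]e2; apply/eqP; field.
  split=> //.
  have := congr1 (fun l => pairing l w) e.
  rewrite !pairing_lin !pairing_cross e1 => e2; apply: (mulIf dn); rewrite mul1r.
  have : y * (y * (y * det3 q0 v w)) = y * (- (z * y) / y / y * pairing p0 w
    + y^-1 * (det3 q0 v w + z * pairing p0 w)) by rewrite e2.
  move=> e3; rewrite -!mulrA e3; field.
  exact: y0.
move=> t It; have [e1 e3] := key t It.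
have d3 : dif I (fun t => phi t * (phi t * phi t)) (fun=> 0).
  apply: (dif_ext oI _ (dif_cst (1 : R))) => s Is.
  by have [_ ->] := key s Is.
have := dif_unique d3 (difM dphi (difM dphi dphi)) It; rewrite e1 => e4.
apply/eqP; have : 3 * (phi t * (phi t * phi t)) * al t == 0.
  by rewrite e4; apply/eqP; ring.
by rewrite !mulf_eq0 pnatr_eq0 (negPf (phi0 t It)).
Qed.

End WithNormalization.

(** For (Q, P) the covector P' kills both Q and Q'. Once the factors x and y are known to be smooth,
    this can be differentiated back to an equation for (q, p). *)
Lemma null_projects : projects_from_integral_curve I q p -> null.
Proof.
move=> [Q [P [[sQ sP h] pj]]] t It.
pose x t := pairing (p t) (Q t) * (pairing (p t) (q t))^-1.
pose y t := pairing (P t) (q t) * (pairing (p t) (q t))^-1.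
have sx : smooth_on I x by rewrite /x; smooth_tac.
have sy : smooth_on I y by rewrite /y; smooth_tac.
have xE s : I s -> Q s = x s *: q s.
  move=> Is; have [[b b0 e] _] := pj s Is.
  by rewrite /x e pairingZr mulfK// r0.
have yE s : I s -> P s = y s *: p s.
  move=> Is; have [_ [b b0 e]] := pj s Is.
  by rewrite /y e pairingZl mulfK// r0.
have dQ := dif_ext oI (fun s Is => esym (xE s Is)) (difZ (smooth_dif sx) (smooth_dif sq)).
have dP := dif_ext oI (fun s Is => esym (yE s Is)) (difZ (smooth_dif sy) (smooth_dif sp)).
have [PQ PQ'] := h t It.
have n1 : pairing (derive1 P t) (derive1 Q t) = 0 by rewrite PQ' pairing_cross det3_abb.
have n2 : pairing (derive1 P t) (Q t) = 0 by rewrite PQ' pairing_cross det3_aba.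
move: PQ n1 n2; rewrite /Q5 /= xE// yE// (difE dQ It) (difE dP It) !pairing_lin.
move: (derive1 x t) (derive1 y t) (x t) (y t) (pairing (p t) (q t)) => x1 y1 x0 y0 r.
move: (pairing (p t) (derive1 q t)) (pairing (derive1 p t) (q t)) => b a.
move: (pairing (derive1 p t) (derive1 q t)) => d e1 n1 n2.
have xy : x0 * y0 != 0.
  apply/eqP => e; move: e1; rewrite (_ : y0 * (x0 * r) = x0 * y0 * r); last by ring.
  by rewrite e mul0r => /eqP; rewrite eq_sym oner_eq0.
have x00 : x0 != 0 by apply: contra xy => /eqP ->; rewrite mul0r.
have n3 : y1 * r + y0 * a = 0 by apply: (mulIf x00); rewrite mul0r -n2; ring.
apply: (mulfI xy); apply/eqP; rewrite -subr_eq0; apply/eqP.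
have := congr1 (fun z => z * r) n1; rewrite mul0r => n1'.
have -> : x0 * y0 * (d * r) - x0 * y0 * (a * b) =
  (y1 * (x1 * r + x0 * b) + y0 * (x1 * a + x0 * d)) * r
  - (y1 * r + y0 * a) * (x1 * r + x0 * b) by ring.
rewrite n3 mul0r subr0 -[RHS]n1'; ring.
Qed.

End Normalization.

(** * Self-dual null planes *)

Section Hodge.
Variable R : realType.

Definition o0 : 'I_(2 + 2) := @Ordinal 4 0 isT.
Definition o1 : 'I_(2 + 2) := @Ordinal 4 1 isT.
Definition o2 : 'I_(2 + 2) := @Ordinal 4 2 isT.
Definition o3 : 'I_(2 + 2) := @Ordinal 4 3 isT.

Lemma sum4 (V : nmodType) (F : 'I_(2 + 2) -> V) :
  \sum_i F i = F o0 + F o1 + F o2 + F o3.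
Proof.
rewrite (@big_ord_recr _ _ _ 3) /= !big_ord_recr big_ord0 /= add0r.
by congr (F _ + F _ + F _ + F _); exact: val_inj.
Qed.

Lemma det2 (M : 'M[R]_2) : \det M = M 0 0 * M 1 1 - M 0 1 * M 1 0.
Proof.
rewrite (expand_det_row M 0) !big_ord_recl big_ord0 /cofactor !det_mx11 !mxE.
have e1 : lift 0 0 = 1 :> 'I_2 by exact: val_inj.
have e2 : lift 1 0 = 0 :> 'I_2 by exact: val_inj.
by rewrite e1 e2 /=; ring.
Qed.

Lemma det3x3 (M : 'M[R]_3) : \det M =
  M 0 0 * (M 1 1 * M 2%:R 2%:R - M 1 2%:R * M 2%:R 1)
  - M 0 1 * (M 1 0 * M 2%:R 2%:R - M 1 2%:R * M 2%:R 0)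
  + M 0 2%:R * (M 1 0 * M 2%:R 1 - M 1 1 * M 2%:R 0).
Proof.
pose m a b := M (inord a) (inord b).
have mE i j : M i j = m i j by rewrite /m !inord_val.
rewrite (expand_det_row M 0) !big_ord_recl big_ord0 /cofactor !det2 !mxE !mE /=.
by rewrite /bump /=; ring.
Qed.

Lemma det4 (M : 'M[R]_(2 + 2)) : \det M =
  M o0 o0 * (M o1 o1 * (M o2 o2 * M o3 o3 - M o2 o3 * M o3 o2)
    - M o1 o2 * (M o2 o1 * M o3 o3 - M o2 o3 * M o3 o1)
    + M o1 o3 * (M o2 o1 * M o3 o2 - M o2 o2 * M o3 o1))
  - M o0 o1 * (M o1 o0 * (M o2 o2 * M o3 o3 - M o2 o3 * M o3 o2)
    - M o1 o2 * (M o2 o0 * M o3 o3 - M o2 o3 * M o3 o0)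
    + M o1 o3 * (M o2 o0 * M o3 o2 - M o2 o2 * M o3 o0))
  + M o0 o2 * (M o1 o0 * (M o2 o1 * M o3 o3 - M o2 o3 * M o3 o1)
    - M o1 o1 * (M o2 o0 * M o3 o3 - M o2 o3 * M o3 o0)
    + M o1 o3 * (M o2 o0 * M o3 o1 - M o2 o1 * M o3 o0))
  - M o0 o3 * (M o1 o0 * (M o2 o1 * M o3 o2 - M o2 o2 * M o3 o1)
    - M o1 o1 * (M o2 o0 * M o3 o2 - M o2 o2 * M o3 o0)
    + M o1 o2 * (M o2 o0 * M o3 o1 - M o2 o1 * M o3 o0)).
Proof.
pose m a b := M (inord a) (inord b).
have mE i j : M i j = m i j by rewrite /m !inord_val.
rewrite (@expand_det_row R 4 M 0) !big_ord_recl big_ord0 /cofactor !det3x3 !mxE !mE /=.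
by rewrite /bump /=; ring.
Qed.

(* The Hodge star of a 2-form is computed by complementary indices. *)
Definition compl (N : 'M[R]_(2 + 2)) : 'M[R]_(2 + 2) :=
  \matrix_(i, j) \sum_k \sum_l eps4 R k l i j * N k l.

Lemma eps4E k l i j : eps4 R k l i j =
  \det (\matrix_(a < 2 + 2, b < 2 + 2) (nth k [:: k; l; i; j] a == b)%:R : 'M[R]_(2+2)).
Proof. by congr (\det _); apply/matrixP => a b; rewrite !mxE (tnth_nth k). Qed.

Lemma eps4_explicit k l i j (d := fun a b : 'I_(2 + 2) => (a == b)%:R : R) :
  eps4 R k l i j =
  d k o0 * (d l o1 * (d i o2 * d j o3 - d i o3 * d j o2)
    - d l o2 * (d i o1 * d j o3 - d i o3 * d j o1)
    + d l o3 * (d i o1 * d j o2 - d i o2 * d j o1))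
  - d k o1 * (d l o0 * (d i o2 * d j o3 - d i o3 * d j o2)
    - d l o2 * (d i o0 * d j o3 - d i o3 * d j o0)
    + d l o3 * (d i o0 * d j o2 - d i o2 * d j o0))
  + d k o2 * (d l o0 * (d i o1 * d j o3 - d i o3 * d j o1)
    - d l o1 * (d i o0 * d j o3 - d i o3 * d j o0)
    + d l o3 * (d i o0 * d j o1 - d i o1 * d j o0))
  - d k o3 * (d l o0 * (d i o1 * d j o2 - d i o2 * d j o1)
    - d l o1 * (d i o0 * d j o2 - d i o2 * d j o0)
    + d l o2 * (d i o0 * d j o1 - d i o1 * d j o0)).
Proof. by rewrite eps4E det4 !mxE. Qed.

Lemma complE (N : 'M[R]_(2 + 2)) i j (d := fun a b : 'I_(2 + 2) => (a == b)%:R : R)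
    (A := fun a b => N a b - N b a) :
  compl N i j =
  A o0 o1 * (d i o2 * d j o3 - d i o3 * d j o2)
  - A o0 o2 * (d i o1 * d j o3 - d i o3 * d j o1)
  + A o0 o3 * (d i o1 * d j o2 - d i o2 * d j o1)
  + A o1 o2 * (d i o0 * d j o3 - d i o3 * d j o0)
  - A o1 o3 * (d i o0 * d j o2 - d i o2 * d j o0)
  + A o2 o3 * (d i o0 * d j o1 - d i o1 * d j o0).
Proof.
rewrite mxE !sum4 !eps4_explicit /A {A}.
have dd a b : d a b = (a == b)%:R by [].
rewrite -!dd.
have e : (d o0 o0 = 1) * (d o0 o1 = 0) * (d o0 o2 = 0) * (d o0 o3 = 0) *
  (d o1 o0 = 0) * (d o1 o1 = 1) * (d o1 o2 = 0) * (d o1 o3 = 0) *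
  (d o2 o0 = 0) * (d o2 o1 = 0) * (d o2 o2 = 1) * (d o2 o3 = 0) *
  (d o3 o0 = 0) * (d o3 o1 = 0) * (d o3 o2 = 0) * (d o3 o3 = 1) by [].
rewrite !e; move: (d i o0) (d i o1) (d i o2) (d i o3) (d j o0) (d j o1) (d j o2) (d j o3).
by move=> *; ring.
Qed.

Lemma lift2P (P : 'I_2 -> Prop) : P 0 -> P 1 -> forall i, P i.
Proof.
move=> P0 P1 i; have : (i < 2)%N by [].
case: i => -[|[|//]] hi _.
- by rewrite (_ : Ordinal _ = 0) //; exact: val_inj.
- by rewrite (_ : Ordinal _ = 1) //; exact: val_inj.
Qed.

Lemma ord4P (P : 'I_(2 + 2) -> Prop) : P o0 -> P o1 -> P o2 -> P o3 -> forall i, P i.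
Proof.
move=> P0 P1 P2 P3 i; have : (i < 2 + 2)%N by [].
case: i => -[|[|[|[|//]]]] hi _.
- by rewrite (_ : Ordinal _ = o0) //; exact: val_inj.
- by rewrite (_ : Ordinal _ = o1) //; exact: val_inj.
- by rewrite (_ : Ordinal _ = o2) //; exact: val_inj.
- by rewrite (_ : Ordinal _ = o3) //; exact: val_inj.
Qed.

Lemma lshift_o : (lshift 2 (0 : 'I_2) = o0) * (lshift 2 (1 : 'I_2) = o1) *
  (rshift 2 (0 : 'I_2) = o2) * (rshift 2 (1 : 'I_2) = o3).
Proof. by do !split; exact: val_inj. Qed.

Lemma sum2 (V : nmodType) (F : 'I_2 -> V) : \sum_i F i = F 0 + F 1.
Proof.
rewrite !big_ord_recr big_ord0 /= add0r.
by congr (F _ + F _); exact: val_inj.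
Qed.

Lemma block4 (A B C D : 'M[R]_2) (M := block_mx A B C D) :
  (M o0 o0 = A 0 0) * (M o0 o1 = A 0 1) * (M o1 o0 = A 1 0) * (M o1 o1 = A 1 1) *
  (M o0 o2 = B 0 0) * (M o0 o3 = B 0 1) * (M o1 o2 = B 1 0) * (M o1 o3 = B 1 1) *
  (M o2 o0 = C 0 0) * (M o2 o1 = C 0 1) * (M o3 o0 = C 1 0) * (M o3 o1 = C 1 1) *
  (M o2 o2 = D 0 0) * (M o2 o3 = D 0 1) * (M o3 o2 = D 1 0) * (M o3 o3 = D 1 1).
Proof.
by rewrite -!lshift_o /M !(block_mxEul, block_mxEur, block_mxEdl, block_mxEdr).
Qed.

(** The matrix ((0, 1), (-1, 0)), which spans the antisymmetric 2 x 2 matrices. *)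
Definition J2 : 'M[R]_2 := \matrix_(i, j) ((j : nat)%:R - (i : nat)%:R).

Lemma J2E : (J2 0 0 = 0) * (J2 0 1 = 1) * (J2 1 0 = - 1) * (J2 1 1 = 0).
Proof. by rewrite !mxE /= !subrr subr0 sub0r. Qed.

(** The shape of the metric in a chart of M^4, where both factors of the tangent space are null. *)
Definition null_gram (B : 'M[R]_2) : 'M[R]_(2 + 2) := block_mx 0 B B^T 0.

Lemma det_null_gram B : \det (null_gram B) = \det B ^+ 2.
Proof. by rewrite det4 /null_gram !block4 det2 !(ent0, entT); ring. Qed.

Lemma posdef2 (S : 'M[R]_2) : positive_definite S -> S 0 1 = S 1 0 ->
  0 < S 0 0 * S 1 1 - S 0 1 * S 0 1.
Proof.
move=> pS sym.
have q (x y : R) : (x, y) != 0 ->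
    0 < x * x * S 0 0 + 2 * (x * y * S 0 1) + y * y * S 1 1.
  move=> xy; pose a : 'rV[R]_2 := \row_j (if j == 0 then x else y).
  have a0 : a 0 0 = x by rewrite mxE.
  have a1 : a 0 1 = y by rewrite mxE.
  have : a != 0.
    apply: contra xy => /eqP a00; apply/eqP; congr (_, _).
      by rewrite -a0 a00 mxE.
    by rewrite -a1 a00 mxE.
  move=> /pS; rewrite mxE sum2 ![(a *m S) _ _]mxE !sum2 !entT a0 a1 sym.
  by congr (_ < _); ring.
have n10 : ((1 : R), (0 : R)) != 0 by rewrite -pair_eqE /= negb_and oner_eq0.
have S0 : 0 < S 0 0 by have := q _ _ n10; congr (_ < _); ring.
(* On this vector the form is S00 times the determinant. *)
have n : (- S 0 1, S 0 0) != 0 by rewrite -pair_eqE /= negb_and (gt_eqF S0) orbT.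
have := q _ _ n; rewrite (_ : _ + _ = S 0 0 * (S 0 0 * S 1 1 - S 0 1 * S 0 1)); last by ring.
by rewrite pmulr_rgt0.
Qed.

(** Write V = (A, C) and X = A B C^T. The Gram matrix X + X^T of V is positive definite, which
    forces det X > 0. As det e = 4 det A det C, the orientation has the sign of det B, while the
    volume factor is |det B|. *)
Lemma oriented_sign B e : oriented_basis (null_gram B) e ->
  Num.sg (\det e) * Num.sqrt `|\det (null_gram B)| = \det B.
Proof.
move=> [V pV ->].
pose A := lsubmx V; pose C := rsubmx V; have VE : V = row_mx A C by rewrite hsubmxK.
have eE : col_mx V (V *m Kmx R) = block_mx A C A (- C).
  by rewrite VE /Kmx mul_row_block !mulmx0 addr0 add0r mulmx1 mulmxN mulmx1.
have dE : \det (col_mx V (V *m Kmx R)) = 4 * (\det A * \det C).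
  by rewrite eE det4 !block4 !entN !det2; ring.
pose X := A *m B *m C^T.
have SE : V *m null_gram B *m V^T = X + X^T.
  rewrite VE /null_gram tr_row_mx mul_row_block !mulmx0 addr0 add0r mul_row_col.
  by rewrite addrC /X !trmx_mul trmxK mulmxA.
rewrite SE in pV; have := posdef2 pV _; rewrite !entD !entT addrC => /(_ erefl) h.
have dX : 0 < \det A * \det B * \det C.
  rewrite -(det_tr C) -!det_mulmx -/X det2.
  have h2 : 0 <= (X 0 1 - X 1 0) ^+ 2 by exact: sqr_ge0.
  nra.
rewrite dE det_null_gram ger0_norm ?sqr_ge0// sqrtr_sqr sgrM sgr_nat mul1r.
have [B0|B0|B0] := ltgtP (\det B) 0.
- rewrite ltr0_sg ?ltr0_norm//; first by ring.
  by rewrite ltNge; apply/negP => AC; move: dX; rewrite ltNge; nra.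
- rewrite gtr0_sg ?gtr0_norm//; first by ring.
  by rewrite ltNge; apply/negP => AC; move: dX; rewrite ltNge; nra.
- by rewrite B0 normr0 mulr0.
Qed.

Lemma null_gram_unit B : \det B != 0 -> null_gram B \in unitmx.
Proof. by move=> B0; rewrite unitmxE unitfE det_null_gram expf_neq0. Qed.

Lemma hodgeE B e w : \det B != 0 -> oriented_basis (null_gram B) e ->
  exists2 N, w = null_gram B *m N *m null_gram B
    & hodge (null_gram B) e w = (2^-1 * \det B) *: compl N.
Proof.
move=> B0 oe; have uG := null_gram_unit B0; set G := null_gram B in uG *.
have GT : G^T = G by rewrite /G /null_gram tr_block_mx !trmx0 trmxK.
exists (invmx G *m w *m (invmx G)^T).
  rewrite trmx_inv GT -!mulmxA mulVmx// mulmx1 mulmxA mulmxV// mul1mx//.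
apply/matrixP => i j; rewrite mxE [RHS]mxE [compl _ _ _]mxE -(oriented_sign oe) -/G.
by rewrite !mulrA.
Qed.

(** The diagonal blocks of an antisymmetric w are multiples of J2 anyway; self-duality forces the
    off-diagonal block to be a multiple of B. *)
Lemma self_dual_block B e w : \det B != 0 -> oriented_basis (null_gram B) e ->
  w^T = - w -> hodge (null_gram B) e w = w ->
  exists lam s s', w = block_mx (s *: J2) (lam *: B) (- lam *: B^T) (s' *: J2).
Proof.
move=> B0 oe wT hw; have [N wE hE] := hodgeE w B0 oe.
rewrite hw in hE.
have wA i j : w i j = - w j i by have /matrixP/(_ j i) := wT; rewrite !mxE.
have w0 i : w i i = 0.
  by have /eqP := wA i i; rewrite -addr_eq0 -mulr2n mulrn_eq0 /= => /eqP.
have we i j : w i j = 2^-1 * \det B * compl N i j by rewrite hE mxE.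
pose A a b := N a b - N b a.
(* The off-diagonal entries are computed twice, by the Hodge star and by lowering the indices of N.
   Comparison shows that the matrix of the [Y] is scalar. *)
have r02 : w o0 o2 = - \det B * A o1 o3 / 2.
  by rewrite we complE /=; rewrite /A; field.
have r03 : w o0 o3 = \det B * A o1 o2 / 2.
  by rewrite we complE /=; rewrite /A; field.
have r12 : w o1 o2 = \det B * A o0 o3 / 2.
  by rewrite we complE /=; rewrite /A; field.
have r13 : w o1 o3 = - \det B * A o0 o2 / 2.
  by rewrite we complE /=; rewrite /A; field.
have gE i j : w i j = \sum_l \sum_k null_gram B i k * N k l * null_gram B l j.
  by rewrite wE mxE; apply: eq_bigr => l _; rewrite mxE mulr_suml.
have aE i j : 2 * w i j = w i j - w j i by rewrite [w j i]wA opprK; ring.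
pose P00 := A o0 o2 / 2; pose P01 := A o0 o3 / 2; pose P10 := A o1 o2 / 2.
pose P11 := A o1 o3 / 2.
pose Y00 := P00 * B 0 0 + P10 * B 1 0; pose Y01 := P00 * B 0 1 + P10 * B 1 1.
pose Y10 := P01 * B 0 0 + P11 * B 1 0; pose Y11 := P01 * B 0 1 + P11 * B 1 1.
have g02 : w o0 o2 = - (B 0 0 * Y00 + B 0 1 * Y10).
  apply: (mulfI (x := 2)) => //; rewrite aE !gE !sum4 /null_gram !block4 !(ent0, entT).
  by rewrite /Y00 /Y10 /P00 /P01 /P10 /P11 /A; field.
have g03 : w o0 o3 = - (B 0 0 * Y01 + B 0 1 * Y11).
  apply: (mulfI (x := 2)) => //; rewrite aE !gE !sum4 /null_gram !block4 !(ent0, entT).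
  by rewrite /Y01 /Y11 /P00 /P01 /P10 /P11 /A; field.
have g12 : w o1 o2 = - (B 1 0 * Y00 + B 1 1 * Y10).
  apply: (mulfI (x := 2)) => //; rewrite aE !gE !sum4 /null_gram !block4 !(ent0, entT).
  by rewrite /Y00 /Y10 /P00 /P01 /P10 /P11 /A; field.
have g13 : w o1 o3 = - (B 1 0 * Y01 + B 1 1 * Y11).
  apply: (mulfI (x := 2)) => //; rewrite aE !gE !sum4 /null_gram !block4 !(ent0, entT).
  by rewrite /Y01 /Y11 /P00 /P01 /P10 /P11 /A; field.
have D : \det B = B 0 0 * B 1 1 - B 0 1 * B 1 0 by rewrite det2.
have y1 : Y00 = Y11.
  apply: (mulfI B0); transitivity (- (B 1 1 * w o0 o2 - B 0 1 * w o1 o2)).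
    by rewrite g02 g12 D; ring.
  by rewrite r02 r12 /Y11 /P01 /P11; field.
have y2 : Y01 = 0.
  apply: (mulfI (x := 2)) => //; apply: (mulfI B0); rewrite !mulr0.
  transitivity (- (B 1 1 * w o0 o3 - B 0 1 * w o1 o3) + \det B * Y01).
    by rewrite g03 g13 D; ring.
  by rewrite r03 r13 /Y01 /P00 /P10; field.
have y3 : Y10 = 0.
  apply: (mulfI (x := 2)) => //; apply: (mulfI B0); rewrite !mulr0.
  transitivity (- (B 0 0 * w o1 o2 - B 1 0 * w o0 o2) + \det B * Y10).
    by rewrite g02 g12 D; ring.
  by rewrite r02 r12 /Y10 /P01 /P11; field.
exists (- Y00), (w o0 o1), (w o2 o3); apply/matrixP.
rewrite y1 y2 y3 in g02 g03 g12 g13.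
have w20 := wA o2 o0; have w30 := wA o3 o0; have w21 := wA o2 o1; have w31 := wA o3 o1.
have w10 := wA o1 o0; have w32 := wA o3 o2.
rewrite g02 in w20; rewrite g03 in w30; rewrite g12 in w21; rewrite g13 in w31.
by apply: ord4P; apply: ord4P;
  rewrite !block4 !(entZ, entT, J2E) ?w0 ?g02 ?g03 ?g12 ?g13 ?w20 ?w30 ?w21 ?w31 ?w10 ?w32
    ?y1; ring.
Qed.

Lemma self_dual_of_block B e lam s s' : \det B != 0 -> oriented_basis (null_gram B) e ->
  let w := block_mx (s *: J2) (lam *: B) (- lam *: B^T) (s' *: J2) in
  hodge (null_gram B) e w = w.
Proof.
move=> B0 oe w; have [N wE ->] := hodgeE w B0 oe; have uG := null_gram_unit B0.
pose d := (\det B)^-1.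
have J1 (M : 'M[R]_2) : M *m J2 *m M^T = \det M *: J2.
  apply/matrixP; apply: lift2P; apply: lift2P;
  rewrite mxE sum2 ![(M *m J2) _ _]mxE !sum2 !(entT, entZ, J2E) det2; by ring.
(* The indices of w raised, with the inverse of B written through its adjugate. *)
pose N' : 'M[R]_(2 + 2) := block_mx (s' * d *: J2) (- lam * d *: (\adj B)^T)
  (lam * d *: \adj B) (s * d *: J2).
have bd k : k * d * \det B = k by rewrite divfK.
have NE : N = N'.
  apply: (can_inj (mulKmx uG)); apply: (can_inj (mulmxK uG)); rewrite -wE.
  rewrite /null_gram /N' /w !mulmx_block !mul0mx !mulmx0 !addr0 !add0r.
  have J3 := J1 B^T; rewrite trmxK det_tr in J3.
  rewrite -!scalemxAr -!scalemxAl J1 J3 !scalerA !bd.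
  rewrite mul_mx_adj mul_scalar_mx scalerA bd -trmx_mul mul_adj_mx tr_scalar_mx.
  by rewrite mul_scalar_mx scalerA bd.
have aE : (\adj B 0 0 = B 1 1) * (\adj B 0 1 = - B 0 1) *
    (\adj B 1 0 = - B 1 0) * (\adj B 1 1 = B 0 0).
  have e1 : lift 0 0 = 1 :> 'I_2 by exact: val_inj.
  have e2 : lift 1 0 = 0 :> 'I_2 by exact: val_inj.
  by rewrite !mxE /cofactor !det_mx11 !mxE e1 e2 /=; do !split; ring.
rewrite NE; apply/matrixP => i j; rewrite [LHS]mxE complE /= /N' !block4 !(entZ, entT, J2E, aE).
move: i j; apply: ord4P; apply: ord4P; rewrite /= /w !block4 !(entZ, entT, J2E) /d;
  move: (\det B) B0 (B 0 0) (B 0 1) (B 1 0) (B 1 1) => b b0 b00 b01 b10 b11; by field.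
Qed.

End Hodge.

(** * Self-dual null planes as graphs *)

Section SelfDualPlanes.
Variable R : realType.
Local Notation J2 := (J2 R).

Lemma J2T : J2^T = - J2.
Proof.
by apply/matrixP; apply: lift2P; apply: lift2P; rewrite entT entN !J2E ?oppr0 ?opprK.
Qed.

Lemma J2_inj (a : 'rV[R]_2) : J2 *m a^T = 0 -> a = 0.
Proof.
move=> /matrixP E; have := (E 0 0, E 1 0).
rewrite !mxE !sum2 !(J2E, entT) !mul0r add0r addr0 mul1r mulN1r => -[e0 e1].
apply/matrixP => i j; rewrite (ord1 i) mxE; move: j; apply: lift2P => //.
by apply/eqP; rewrite -oppr_eq0 e1.
Qed.

Lemma wedge_neq0 (theta : 'M[R]_(2, 2 + 2)) : row_free theta ->
  wedge (row 0 theta) (row 1 theta) != 0.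
Proof.
move=> fr; apply/eqP => /matrixP w0.
have inj (v : 'rV[R]_2) : v *m theta = 0 -> v = 0.
  by move=> e; apply: (row_free_inj fr); rewrite mul0mx.
have E i j : theta 0 i * theta 1 j = theta 1 i * theta 0 j.
  have := w0 i j; rewrite !mxE !big_ord1 !mxE => /eqP.
  by rewrite subr_eq0 => /eqP.
pose v m : 'rV[R]_2 := \row_i (if i == 0 then - theta 1 m else theta 0 m).
have v0 m : v m = 0.
  apply: inj; apply/matrixP => i j; rewrite (ord1 i) !mxE sum2 !mxE /=.
  by rewrite [theta 0 m * _]E; ring.
have t0 m : theta 0 m = 0.
  by have /matrixP/(_ 0 1) := v0 m; rewrite !mxE.
pose d : 'rV[R]_2 := \row_i (if i == 0 then 1 else 0).
have d0 : d = 0.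
  apply: inj; apply/matrixP => i j; rewrite (ord1 i) !mxE sum2 !mxE /= t0.
  by rewrite mulr0 mul0r addr0.
by have /matrixP/(_ 0 0) := d0; rewrite !mxE /= => /eqP; rewrite oner_eq0.
Qed.

(* The other self-dual null planes are the two factors of the tangent space,
   which contain no vector with two nonzero components. *)
Lemma self_dual_plane_graph (B : 'M[R]_2) W (x : 'rV[R]_(2 + 2)) :
  \det B != 0 -> self_dual_plane (null_gram B) W -> (x <= W)%MS ->
  lsubmx x != 0 -> rsubmx x != 0 ->
  exists k, forall u : 'rV[R]_(2 + 2), (u <= W)%MS ->
    rsubmx u *m B^T = k *: (lsubmx u *m J2).
Proof.
move=> B0 [theta [fr tW [e oe hw]]] xW xl xr.
set w := wedge _ _ in hw.
have wT : w^T = - w.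
  by rewrite /w /wedge linearB /= !trmx_mul !trmxK opprB.
have [lam [s [s' wE]]] := self_dual_block B0 oe wT hw.
(* The 2-form contracts to zero with vectors that both covectors annihilate. *)
have wu (u : 'rV[R]_(2 + 2)) : (u <= W)%MS -> w *m u^T = 0.
  move=> /submxP[D ->]; rewrite trmx_mul mulmxA /w /wedge mulmxBl -!mulmxA.
  rewrite -!row_mul tW !row0 !mulmx0 subrr mul0mx//.
have eq (u : 'rV[R]_(2 + 2)) : (u <= W)%MS ->
    s *: (J2 *m (lsubmx u)^T) + lam *: (B *m (rsubmx u)^T) = 0 /\
   - lam *: (B^T *m (lsubmx u)^T) + s' *: (J2 *m (rsubmx u)^T) = 0.
  move=> uW; have := wu u uW; rewrite wE -{1}[u]hsubmxK tr_row_mx mul_block_col -!scalemxAl.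
  by move/eqP; rewrite -col_mx0 => /eqP/eq_col_mx.
have [lam0|lam0] := eqVneq lam 0; last first.
  exists (s / lam) => u /eq[e1 _].
  apply: trmx_inj; rewrite trmx_mul trmxK linearZ /= trmx_mul J2T mulNmx.
  apply: (scalerI lam0); rewrite scalerA scalerN mulrC divfK//.
  by apply/eqP; rewrite -addr_eq0 addrC e1.
have [e1 e2] := eq x xW; exfalso.
rewrite lam0 oppr0 !scale0r ?addr0 ?add0r in e1 e2.
have s0 : s = 0.
  move/eqP: e1; rewrite scaler_eq0 => /orP[/eqP//|/eqP/J2_inj x0].
  by rewrite x0 eqxx in xl.
have s'0 : s' = 0.
  move/eqP: e2; rewrite scaler_eq0 => /orP[/eqP//|/eqP/J2_inj x0].
  by rewrite x0 eqxx in xr.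
have /eqP := wedge_neq0 fr; apply; rewrite -/w wE lam0 s0 s'0 oppr0 !scale0r.
by rewrite block_mx0.
Qed.

Lemma oriented_basis_exists (B : 'M[R]_2) : \det B != 0 ->
  exists e, oriented_basis (null_gram B) e.
Proof.
move=> B0; have uB : B \in unitmx by rewrite unitmxE unitfE.
(* Chosen so that the Gram matrix of V is twice the identity. *)
pose V : 'M[R]_(2, 2 + 2) := row_mx 1%:M (invmx B)^T.
exists (col_mx V (V *m Kmx R)), V => //.
have -> : V *m null_gram B *m V^T = 2%:M.
  rewrite /V /null_gram tr_row_mx mul_row_block !mulmx0 addr0 add0r mul_row_col.
  rewrite trmxK trmx1 mulmx1 mul1mx mulmxV// -trmx_mul mulmxV// trmx1.
  by rewrite -raddfD.
move=> a a0; rewrite mul_mx_scalar -scalemxAl mxE mxE sum2 !entT.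
rewrite mulr_gt0// -!expr2 lt_neqAle addr_ge0 ?sqr_ge0// andbT eq_sym.
rewrite paddr_eq0 ?sqr_ge0// !sqrf_eq0; apply: contra a0 => /andP[/eqP h0 /eqP h1].
apply/eqP/matrixP => i j; rewrite (ord1 i) mxE.
by move: j; apply: lift2P.
Qed.

Lemma graph_self_dual_plane (B S : 'M[R]_2) k : \det B != 0 ->
  S *m B^T = k *: J2 -> self_dual_plane (null_gram B) (row_mx 1%:M S).
Proof.
move=> B0 SB; have uB : B \in unitmx by rewrite unitmxE unitfE.
(* This annihilates the graph because B S^T is the transpose of k J2, that is - k J2. *)
pose theta : 'M[R]_(2, 2 + 2) := row_mx (k *: J2) B.
exists theta; split.
- apply: inj_row_free => v; rewrite /theta mul_mx_row => /eqP.
  rewrite -row_mx0 => /eqP/eq_row_mx[_ vB].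
  by rewrite -[v](mulmxK uB) vB mul0mx.
- rewrite /theta tr_row_mx mul_row_col trmx1 mulmx1.
  have -> : B *m S^T = (S *m B^T)^T by rewrite trmx_mul trmxK.
  by rewrite SB linearZ /= J2T scalerN subrr.
have [e oe] := oriented_basis_exists B0; exists e => //.
have -> : wedge (row 0 theta) (row 1 theta) =
   block_mx (k ^+ 2 *: J2) (k *: B) (- k *: B^T) (\det B *: J2).
  have th a : (theta a o0 = k * J2 a 0) * (theta a o1 = k * J2 a 1) *
     (theta a o2 = B a 0) * (theta a o3 = B a 1).
    by rewrite -!lshift_o /theta !row_mxEl !row_mxEr !entZ.
  apply/matrixP => i j.
  have -> : wedge (row 0 theta) (row 1 theta) i j =
      theta 0 i * theta 1 j - theta 1 i * theta 0 j by rewrite !mxE !big_ord1 !mxE.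
  move: i j.
  apply: ord4P; apply: ord4P; rewrite !th !block4 !(entZ, entT, J2E) ?det2; ring.
exact: self_dual_of_block.
Qed.

End SelfDualPlanes.

(** * The dancing metric and its Levi-Civita connection *)

Section Charts.
Variable R : realType.
Variable k : 'I_3 * 'I_3.
Implicit Types (x y u v w : 'rV[R]_(2 + 2)).
Local Notation L := (dunchart k).

Lemma unlift_ind n (i : 'I_n.+1) (P : 'I_n.+1 -> Prop) :
  P i -> (forall a, P (lift i a)) -> forall j, P j.
Proof. by move=> Pi Pl j; case: (unliftP i j) => [a ->|->]. Qed.

Lemma affine_point_lift (i : 'I_3) (y : 'rV[R]_2) a :
  affine_point i y (lift i a) 0 = y 0 a.
Proof. by rewrite mxE liftK. Qed.

Lemma affine_point_diag (i : 'I_3) (y : 'rV[R]_2) : affine_point i y i 0 = 1.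
Proof. by rewrite mxE unlift_none. Qed.

Lemma dunchart1_lift w a : (L w).1 (lift k.1 a) 0 = lsubmx w 0 a.
Proof. by rewrite entD entN !affine_point_lift linear0 ent0 subr0. Qed.

Lemma dunchart1_diag w : (L w).1 k.1 0 = 0.
Proof. by rewrite entD entN !affine_point_diag subrr. Qed.

Lemma dunchart2_lift w a : (L w).2 0 (lift k.2 a) = rsubmx w 0 a.
Proof.
by rewrite entD entN !entT !affine_point_lift linear0 ent0 subr0.
Qed.

Lemma dunchart2_diag w : (L w).2 0 k.2 = 0.
Proof. by rewrite entD entN !entT !affine_point_diag subrr. Qed.

Lemma dunchart_lin a u v :
  (L (a *: u + v)).1 = a *: (L u).1 + (L v).1 /\
  (L (a *: u + v)).2 = a *: (L u).2 + (L v).2.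
Proof.
split; apply/matrixP => i j; rewrite ?(ord1 i) ?(ord1 j).
- move: i; apply: (unlift_ind (i := k.1)) => [|b]; rewrite [RHS]entD [in RHS]entZ.
    by rewrite !dunchart1_diag mulr0 addr0.
  by rewrite !dunchart1_lift !mxE.
- move: j; apply: (unlift_ind (i := k.2)) => [|b]; rewrite [RHS]entD [in RHS]entZ.
    by rewrite !dunchart2_diag mulr0 addr0.
  by rewrite !dunchart2_lift !mxE.
Qed.

Lemma dunchart_surj (v : 'cV[R]_3) (l : 'rV[R]_3) : v k.1 0 = 0 -> l 0 k.2 = 0 ->
  exists w, (L w).1 = v /\ (L w).2 = l.
Proof.
move=> v0 l0.
exists (row_mx (\row_a v (lift k.1 a) 0) (\row_a l 0 (lift k.2 a))); split.
- apply/matrixP => i j; rewrite (ord1 j); move: i.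
  apply: (unlift_ind (i := k.1)) => [|b]; first by rewrite dunchart1_diag.
  by rewrite dunchart1_lift row_mxKl mxE.
- apply/matrixP => i j; rewrite (ord1 i); move: j.
  apply: (unlift_ind (i := k.2)) => [|b]; first by rewrite dunchart2_diag.
  by rewrite dunchart2_lift row_mxKr mxE.
Qed.

Lemma dunchart_inj1 w : (L w).1 = 0 -> lsubmx w = 0.
Proof.
move=> e; apply/matrixP => i j; rewrite (ord1 i) -dunchart1_lift e !ent0//.
Qed.

Lemma dunchart_inj2 w : (L w).2 = 0 -> rsubmx w = 0.
Proof.
move=> e; apply/matrixP => i j; rewrite (ord1 i) -dunchart2_lift e !ent0//.
Qed.

Lemma dunchart0 w : lsubmx w = 0 -> (L w).1 = 0.
Proof.
move=> e; apply/matrixP => i j; rewrite (ord1 j) ent0; move: i.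
apply: (unlift_ind (i := k.1)) => [|b]; first by rewrite dunchart1_diag.
by rewrite dunchart1_lift e ent0.
Qed.

Lemma dunchart0r w : rsubmx w = 0 -> (L w).2 = 0.
Proof.
move=> e; apply/matrixP => i j; rewrite (ord1 i) ent0; move: j.
apply: (unlift_ind (i := k.2)) => [|b]; first by rewrite dunchart2_diag.
by rewrite dunchart2_lift e ent0.
Qed.

Lemma dunchartE x :
  (L x).1 = (unchart k x).1 - (unchart k 0).1 /\ (L x).2 = (unchart k x).2 - (unchart k 0).2.
Proof. by []. Qed.

Lemma unchart_line x v h :
  unchart k (h *: v + x) = ((unchart k x).1 + h *: (L v).1, (unchart k x).2 + h *: (L v).2).
Proof.
have E1 y : (unchart k y).1 = (unchart k 0).1 + (L y).1.
  by rewrite [RHS]addrC [RHS]subrK.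
have E2 y : (unchart k y).2 = (unchart k 0).2 + (L y).2.
  by rewrite [RHS]addrC [RHS]subrK.
have [e1 e2] := dunchart_lin h v x.
rewrite [LHS]surjective_pairing; congr (_, _).
  by rewrite E1 e1 (E1 x) addrCA addrC.
by rewrite E2 e2 (E2 x) addrCA addrC.
Qed.

Lemma unchart_diag x : (unchart k x).1 k.1 0 = 1 /\ (unchart k x).2 0 k.2 = 1.
Proof. by split; rewrite ?entT affine_point_diag. Qed.

Lemma unchart_chart (q : 'cV[R]_3) (p : 'rV[R]_3) : in_chart k q p ->
  unchart k (chart k q p) = ((q k.1 0)^-1 *: q, (p 0 k.2)^-1 *: p).
Proof.
move=> [q0 p0]; rewrite /unchart /chart row_mxKl row_mxKr; congr (_, _).
  apply/matrixP => i j; rewrite (ord1 j); move: i.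
  apply: (unlift_ind (i := k.1)) => [|b]; first by rewrite affine_point_diag entZ mulVf.
  by rewrite affine_point_lift entZ mxE mulrC.
apply/matrixP => j i; rewrite (ord1 j) entT; move: i.
apply: (unlift_ind (i := k.2)) => [|b]; first by rewrite affine_point_diag entZ mulVf.
by rewrite affine_point_lift entZ mxE mulrC !entT.
Qed.

Lemma chart_lift (q : 'cV[R]_3) (p : 'rV[R]_3) a :
  chart k q p 0 (lshift 2 a) = (q k.1 0)^-1 * q (lift k.1 a) 0 /\
  chart k q p 0 (rshift 2 a) = (p 0 k.2)^-1 * p 0 (lift k.2 a).
Proof. by rewrite /chart row_mxEl row_mxEr !mxE; split; rewrite mulrC. Qed.

Lemma dif_dunchart (J : set R) (V V' : R -> 'rV[R]_(2 + 2)) : dif J V V' ->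
  dif J (fun s => (L (V s)).1) (fun s => (L (V' s)).1) /\
  dif J (fun s => (L (V s)).2) (fun s => (L (V' s)).2).
Proof.
move=> /dif_mxP dV; split; apply/dif_mxP => i j; rewrite ?(ord1 i) ?(ord1 j).
- move: i; apply: (unlift_ind (i := k.1)) => [|b].
    under eq_fun do rewrite dunchart1_diag.
    by apply: dif_eq (dif_cst (0 : R)) _ => t _; rewrite dunchart1_diag.
  under eq_fun do rewrite dunchart1_lift mxE.
  by apply: dif_eq (dV 0 (lshift 2 b)) _ => t _; rewrite dunchart1_lift mxE.
- move: j; apply: (unlift_ind (i := k.2)) => [|b].
    under eq_fun do rewrite dunchart2_diag.
    by apply: dif_eq (dif_cst (0 : R)) _ => t _; rewrite dunchart2_diag.
  under eq_fun do rewrite dunchart2_lift mxE.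
  by apply: dif_eq (dV 0 (rshift 2 b)) _ => t _; rewrite dunchart2_lift mxE.
Qed.

End Charts.

(** * First derivatives of the dancing metric *)

Section DancingDerivative.
Variable R : realType.
Implicit Types (z u v w : 'cV[R]_3 * 'rV[R]_3).

Lemma dancingE z u w : pairing z.2 z.1 != 0 -> let r := pairing z.2 z.1 in
  dancing z u w = - (pairing u.2 w.1 + pairing w.2 u.1) / r
    + (pairing u.2 z.1 * pairing z.2 w.1 + pairing w.2 z.1 * pairing z.2 u.1) / r ^+ 2.
Proof.
move=> r0 /=; rewrite /dancing /neutral /horizontal_lift /= !pairing_lin.
by field.
Qed.

(** The derivative of [dancing z u w] when z moves along v with u and w fixed, as the quotient rule
    gives it on [dancingE]. *)
Definition ddancing z v u w : R :=
  let r := pairing z.2 z.1 in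
  let r1 := pairing v.2 z.1 + pairing z.2 v.1 in
  (pairing u.2 w.1 + pairing w.2 u.1) * r1 / r ^+ 2
  + (pairing u.2 v.1 * pairing z.2 w.1 + pairing u.2 z.1 * pairing v.2 w.1
     + pairing w.2 v.1 * pairing z.2 u.1 + pairing w.2 z.1 * pairing v.2 u.1) / r ^+ 2
  - 2 * (pairing u.2 z.1 * pairing z.2 w.1 + pairing w.2 z.1 * pairing z.2 u.1)
    * r1 / r ^+ 3.

Lemma is_derive_dancing z v u w : pairing z.2 z.1 != 0 ->
  is_derive (0 : R) 1 (fun h => dancing (z.1 + h *: v.1, z.2 + h *: v.2) u w)
    (ddancing z v u w).
Proof.
move=> r0.
pose r h := pairing (z.2 + h *: v.2) (z.1 + h *: v.1).
(* The factors r^-1 and r are left uncancelled, so that the equality [FE] of functions holds for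
   every h, including zeros of r. *)
pose F a b h := (r h)^-1 * (pairing (a : 'rV[R]_3) (b : 'cV[R]_3)
  - 2 * ((r h)^-1 * (pairing (z.2 + h *: v.2) b * pairing a (z.1 + h *: v.1)))
  + (r h)^-1 * ((r h)^-1 * (r h * (pairing (z.2 + h *: v.2) b * pairing a (z.1 + h *: v.1))))).
have FE : (fun h => dancing (z.1 + h *: v.1, z.2 + h *: v.2) u w) =
    fun h => - (F u.2 w.1 h + F w.2 u.1 h).
  apply/funext => h; rewrite /dancing /neutral /horizontal_lift /F /=.
  set q := z.1 + _; set p := z.2 + _; rewrite -/p -/q /r -/p -/q.
  move: q p => q p; rewrite !pairing_lin; ring.
rewrite FE.
have d1 : dif [set (0 : R)] (fun h : R => h) (fun=> 1).
  by move=> h _; exact: is_derive_id.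
have nr : forall t, [set (0 : R)] t -> r t != 0.
  by move=> t ->; rewrite /r !scale0r !addr0.
suff h : dif [set (0 : R)] (fun h => - (F u.2 w.1 h + F w.2 u.1 h)) (fun=> ddancing z v u w).
  exact: h.
have nr' : forall t : R, [set (0 : R)] t -> pairing (z.2 + t *: v.2) (z.1 + t *: v.1) != 0.
  exact: nr.
rewrite /F /r; dif_tac; try exact: nr'.
move=> t ->; rewrite !scale0r !addr0 !add0r !scale1r.
rewrite ?pairing0l ?pairing0r /ddancing; field.
exact: r0.
Qed.

Lemma derive_line (V : normedModType R) (f : V -> R) (x v : V) (d : R) :
  is_derive (0 : R) 1 (fun h => f (h *: v + x)) d -> 'D_v f x = d.
Proof.
move=> [_ <-]; pose g h := f (h *: v + x).
have E : (fun h : R => h^-1 *: ((f \o shift x) (h *: v) - f x)) =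
    (fun h : R => h^-1 *: ((g \o shift 0) (h *: 1) - g 0)).
  by apply/funext => h /=; rewrite /g /= addr0 scale0r add0r [h *: 1]mulr1.
by rewrite /derive E.
Qed.

(** The Koszul formula: the terms subtracted from V' are the Christoffel correction, tested against
    an arbitrary w. *)
Lemma koszul z X V V' w (r := pairing z.2 z.1) : r != 0 ->
  dancing z (V'.1 - (pairing z.2 X.1 / r) *: V.1 - (pairing z.2 V.1 / r) *: X.1,
             V'.2 - (pairing X.2 z.1 / r) *: V.2 - (pairing V.2 z.1 / r) *: X.2) w =
  dancing z V' w + 2^-1 * (ddancing z X V w + ddancing z V X w - ddancing z w X V).
Proof.
move=> r0; rewrite !dancingE// /ddancing /= !pairing_lin -/r; field.
exact: r0.
Qed.

End DancingDerivative.

Opaque dunchart unchart.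

Section DancingPerp.
Variable R : realType.
Implicit Types (u : 'cV[R]_3 * 'rV[R]_3).

Lemma entry_comb0 m n (a b c : 'M[R]_(m, n)) i j (s t : R) :
  a i j = 0 -> b i j = 0 -> c i j = 0 -> (a - s *: b - t *: c) i j = 0.
Proof. by move=> a0 b0 c0; rewrite !(entD, entN, entZ) a0 b0 c0 !mulr0 !subr0. Qed.

(** The difference y of the two sides is killed by p and by every covector whose entry m is zero. As
    this entry of p is 1, these span the dual space. *)
Lemma dancing_perp1 (q : 'cV[R]_3) (p : 'rV[R]_3) u m : pairing p q != 0 -> p 0 m = 1 ->
  (forall l : 'rV[R]_3, l 0 m = 0 -> dancing (q, p) u (0, l) = 0) ->
  u.1 = (pairing p u.1 / pairing p q) *: q.
Proof.
case: u => a b r0 p1 h /=; apply/eqP; rewrite -subr_eq0; apply/eqP; set y := _ - _.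
have py : pairing p y = 0 by rewrite /y !pairing_lin; field.
have ly (l : 'rV[R]_3) : l 0 m = 0 -> pairing l y = 0.
  move=> /h; rewrite dancingE//= /y !pairing_lin.
  rewrite !pairing0r mulr0 !add0r => e.
  apply: (mulfI (x := - (pairing p q)^-1)); first by rewrite oppr_eq0 invr_eq0.
  by rewrite mulr0 -[RHS]e; field.
apply/matrixP => i j; rewrite (ord1 j) ent0.
have := ly (delta_mx 0 i - (delta_mx 0 i : 'rV[R]_3) 0 m *: p).
rewrite pairingDl pairingNl pairingZl py mulr0 subr0 => <-.
  rewrite pairingE (bigD1 i)//= big1 ?addr0 => [|n ni]; rewrite !mxE !eqxx ?mul1r//.
  by rewrite (negPf ni) mul0r.
by rewrite entD entN entZ p1 mulr1 subrr.
Qed.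

Lemma dancing_perp2 (q : 'cV[R]_3) (p : 'rV[R]_3) u m : pairing p q != 0 -> q m 0 = 1 ->
  (forall l : 'cV[R]_3, l m 0 = 0 -> dancing (q, p) u (l, 0) = 0) ->
  u.2 = (pairing u.2 q / pairing p q) *: p.
Proof.
case: u => a b r0 q1 h /=; apply/eqP; rewrite -subr_eq0; apply/eqP; set y := _ - _.
have yq : pairing y q = 0 by rewrite /y !pairing_lin; field.
have yl (l : 'cV[R]_3) : l m 0 = 0 -> pairing y l = 0.
  move=> /h; rewrite dancingE//= /y !pairing_lin.
  rewrite !pairing0l mul0r !addr0 => e.
  apply: (mulfI (x := - (pairing p q)^-1)); first by rewrite oppr_eq0 invr_eq0.
  by rewrite mulr0 -[RHS]e; field.
apply/matrixP => j i; rewrite (ord1 j) ent0.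
have := yl (delta_mx i 0 - (delta_mx i 0 : 'cV[R]_3) m 0 *: q).
rewrite pairingDr pairingNr pairingZr yq mulr0 subr0 => <-.
  rewrite pairingE (bigD1 i)//= big1 ?addr0 => [|n ni]; rewrite !mxE !eqxx ?mulr1//.
  by rewrite (negPf ni) mulr0.
by rewrite entD entN entZ q1 mulr1 subrr.
Qed.

End DancingPerp.

(** * Christoffel symbols and the Gram matrix *)

Section LeviCivita.
Variable R : realType.
Variable k : 'I_3 * 'I_3.
Implicit Types (x y u v w : 'rV[R]_(2 + 2)).
Local Notation L := (dunchart k).
Local Notation e_ a := (delta_mx 0 a : 'rV[R]_(2 + 2)).

Lemma linear_sum (f : 'rV[R]_(2 + 2) -> R) : (forall a u v, f (a *: u + v) = a * f u + f v) ->
  forall v, f v = \sum_i v 0 i * f (e_ i).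
Proof.
move=> fl v; have f0 : f 0 = 0.
  have := fl (-1) 0 0; rewrite scaler0 addr0 => /eqP.
  by rewrite mulN1r addNr => /eqP.
have fs (s : seq 'I_(2 + 2)) : f (\sum_(i <- s) v 0 i *: e_ i) = \sum_(i <- s) v 0 i * f (e_ i).
  elim: s => [|i s IH]; first by rewrite !big_nil.
  by rewrite !big_cons fl IH.
by rewrite -fs -row_sum_delta.
Qed.

Variable x : 'rV[R]_(2 + 2).
Local Notation z := (unchart k x).
Local Notation G := (gram k x).
Hypothesis r0 : pairing z.2 z.1 != 0.

Lemma dancing_linl u v a (w : 'cV[R]_3 * 'rV[R]_3) :
  dancing z (L (a *: u + v)) w = a * dancing z (L u) w + dancing z (L v) w.
Proof.
by rewrite !dancingE//; have [-> ->] := dunchart_lin k a u v; rewrite !pairing_lin; field.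
Qed.

Lemma dancingC (t u w : 'cV[R]_3 * 'rV[R]_3) : dancing t u w = dancing t w u.
Proof. by rewrite /dancing /neutral addrC. Qed.

Lemma dancing_linr u v a (w : 'cV[R]_3 * 'rV[R]_3) :
  dancing z w (L (a *: u + v)) = a * dancing z w (L u) + dancing z w (L v).
Proof. by rewrite ![dancing z w _]dancingC dancing_linl. Qed.

Lemma gram_sym : G^T = G.
Proof. by apply/matrixP => a b; rewrite !mxE dancingC. Qed.

Lemma gramE u w : (u *m G *m w^T) 0 0 = dancing z (L u) (L w).
Proof.
rewrite (linear_sum (f := fun w => dancing z (L u) (L w))); last first.
  by move=> *; exact: dancing_linr.
rewrite mxE; apply: eq_bigr => j _; rewrite entT mulrC; congr (_ * _).
rewrite (linear_sum (f := fun u => dancing z (L u) (L (e_ j)))); last first.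
  by move=> *; exact: dancing_linl.
by rewrite mxE; apply: eq_bigr => i _; rewrite mxE.
Qed.

Lemma dancing_nondegenerate u : (forall w, dancing z (L u) (L w) = 0) -> u = 0.
Proof.
have [q1 p1] := unchart_diag k x; move: r0 q1 p1.
case: z => q p /= r' q1 p1 h.
have e1 : (L u).1 = (pairing p (L u).1 / pairing p q) *: q.
  apply: dancing_perp1 r' p1 _ => l l0.
  have [|w [w1 w2]] := dunchart_surj (k := k) (v := 0) _ l0; first by rewrite ent0.
  by rewrite -(h w) [L w]surjective_pairing w1 w2.
have e2 : (L u).2 = (pairing (L u).2 q / pairing p q) *: p.
  apply: dancing_perp2 r' q1 _ => l l0.
  have [|w [w1 w2]] := dunchart_surj (k := k) (l := 0) l0; first by rewrite ent0.
  by rewrite -(h w) [L w]surjective_pairing w1 w2.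
have l0 : lsubmx u = 0.
  apply: (@dunchart_inj1 _ k); rewrite e1; move/(congr1 (fun v : 'cV[R]_3 => v k.1 0)): e1.
  by rewrite dunchart1_diag entZ q1 mulr1 => <-; rewrite scale0r.
have rr0 : rsubmx u = 0.
  apply: (@dunchart_inj2 _ k); rewrite e2; move/(congr1 (fun v : 'rV[R]_3 => v 0 k.2)): e2.
  by rewrite dunchart2_diag entZ p1 mulr1 => <-; rewrite scale0r.
by rewrite -[u]hsubmxK l0 rr0 row_mx0.
Qed.

Lemma gram_unit : G \in unitmx.
Proof.
rewrite -row_free_unit; apply: inj_row_free => v vG.
by apply: dancing_nondegenerate => w; rewrite -gramE vG mul0mx mxE.
Qed.

Lemma gram_derive v (a b : 'I_(2 + 2)) :
  'D_v (fun y => gram k y a b) x = ddancing z (L v) (L (e_ a)) (L (e_ b)).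
Proof.
apply: derive_line.
rewrite (_ : (fun h => _) = fun h => dancing (z.1 + h *: (L v).1, z.2 + h *: (L v).2)
    (L (e_ a)) (L (e_ b))); first exact: is_derive_dancing.
by apply/funext => h; rewrite mxE unchart_line.
Qed.

Lemma ddancing_lin a u v (s t : 'cV[R]_3 * 'rV[R]_3) :
  (ddancing z (L (a *: u + v)) s t = a * ddancing z (L u) s t + ddancing z (L v) s t) *
  (ddancing z s (L (a *: u + v)) t = a * ddancing z s (L u) t + ddancing z s (L v) t) *
  (ddancing z s t (L (a *: u + v)) = a * ddancing z s t (L u) + ddancing z s t (L v)).
Proof.
rewrite /ddancing; have [-> ->] := dunchart_lin k a u v; rewrite !pairing_lin.
by do !split; field.
Qed.

Opaque ddancing.

Lemma ddancing_sum (X V : 'rV[R]_(2 + 2)) (F : 'cV[R]_3 * 'rV[R]_3 -> 'cV[R]_3 * 'rV[R]_3 -> R) :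
  (forall a u v s, F (L (a *: u + v)) s = a * F (L u) s + F (L v) s) ->
  (forall a u v s, F s (L (a *: u + v)) = a * F s (L u) + F s (L v)) ->
  F (L X) (L V) = \sum_i \sum_j F (L (e_ i)) (L (e_ j)) * X 0 i * V 0 j.
Proof.
move=> Fl Fr; rewrite (linear_sum (f := fun X => F (L X) (L V))); last by move=> *; rewrite Fl.
apply: eq_bigr => i _; rewrite (linear_sum (f := fun V => F (L (e_ i)) (L V))); last first.
  by move=> *; rewrite Fr.
by rewrite mulr_sumr; apply: eq_bigr => j _; ring.
Qed.

(** Lowering the index with G cancels the inverse matrix in [christoffel]; multilinearity then
    passes from the chart basis to X, V and w. *)
Lemma christoffel_gram (X V : 'rV[R]_(2 + 2)) w :
  ((\row_l \sum_i \sum_j christoffel (gram k) x l i j * X 0 i * V 0 j) *m G *m w^T) 0 0 =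
  2^-1 * (ddancing z (L X) (L V) (L w) + ddancing z (L V) (L X) (L w)
          - ddancing z (L w) (L X) (L V)).
Proof.
pose K i j l := ddancing z (L (e_ i)) (L (e_ j)) (L (e_ l))
  + ddancing z (L (e_ j)) (L (e_ i)) (L (e_ l)) - ddancing z (L (e_ l)) (L (e_ i)) (L (e_ j)).
pose kap : 'rV[R]_(2 + 2) := \row_l \sum_i \sum_j (2^-1 * K i j l) * X 0 i * V 0 j.
have chE l i j : christoffel (gram k) x l i j = \sum_m (2^-1 * K i j m) * invmx G l m.
  rewrite /christoffel mulr_sumr; apply: eq_bigr => m _; rewrite !gram_derive /K; ring.
have -> : (\row_l \sum_i \sum_j christoffel (gram k) x l i j * X 0 i * V 0 j) =
    kap *m (invmx G)^T.
  apply/matrixP => a l; rewrite !mxE.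
  transitivity (\sum_m \sum_i \sum_j (2^-1 * K i j m) * X 0 i * V 0 j * invmx G l m).
    rewrite [RHS]exchange_big /=; apply: eq_bigr => i _.
    rewrite [RHS]exchange_big /=; apply: eq_bigr => j _.
    by rewrite chE !mulr_suml; apply: eq_bigr => m _; ring.
  apply: eq_bigr => m _; rewrite !mxE mulr_suml; apply: eq_bigr => i _.
  by rewrite mulr_suml; apply: eq_bigr => j _.
rewrite trmx_inv gram_sym -[kap *m _ *m _]mulmxA mulVmx ?gram_unit// mulmx1.
rewrite mxE; under eq_bigr do rewrite entT.
rewrite (linear_sum (f := fun w => 2^-1 * (ddancing z (L X) (L V) (L w)
   + ddancing z (L V) (L X) (L w) - ddancing z (L w) (L X) (L V)))); last first.
  by move=> a u v; rewrite !ddancing_lin; ring.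
apply: eq_bigr => l _; rewrite mulrC; congr (_ * _).
rewrite mxE (ddancing_sum X V (F := fun s t => 2^-1 * (ddancing z s t (L (e_ l))
  + ddancing z t s (L (e_ l)) - ddancing z (L (e_ l)) s t))); last 2 first.
- by move=> a u v s; rewrite !ddancing_lin; ring.
- by move=> a u v s; rewrite !ddancing_lin; ring.
by [].
Qed.

End LeviCivita.

Section Covariant.
Variable R : realType.
Variable k : 'I_3 * 'I_3.
Local Notation L := (dunchart k).

(* The Levi-Civita connection in homogeneous coordinates: on the first factor,
   D v = v' - (p q' / p q) v - (p v / p q) q' modulo q. *)
Lemma covariantE (x V : R -> 'rV[R]_(2 + 2)) t (z := unchart k (x t)) (r := pairing z.2 z.1)
    (X := L (derive1 x t)) (W := L (V t)) (W' := L (derive1 V t)) : r != 0 ->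
  (L (covariant (gram k) x V t)).1 =
    W'.1 - (pairing z.2 X.1 / r) *: W.1 - (pairing z.2 W.1 / r) *: X.1 /\
  (L (covariant (gram k) x V t)).2 =
    W'.2 - (pairing X.2 z.1 / r) *: W.2 - (pairing W.2 z.1 / r) *: X.2.
Proof.
(* The claimed expression has zero entries at k.1 and k.2, so it is a chart vector w. It is
   identified with the covariant derivative by pairing both with every u. *)
move=> r0; have [||w [w1 w2]] := dunchart_surj (k := k)
  (v := W'.1 - (pairing z.2 X.1 / r) *: W.1 - (pairing z.2 W.1 / r) *: X.1)
  (l := W'.2 - (pairing X.2 z.1 / r) *: W.2 - (pairing W.2 z.1 / r) *: X.2).
- by apply: entry_comb0; exact: dunchart1_diag.
- by apply: entry_comb0; exact: dunchart2_diag.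
suff -> : covariant (gram k) x V t = w by [].
apply/eqP; rewrite -subr_eq0; apply/eqP; apply: (dancing_nondegenerate r0) => u.
have -> : covariant (gram k) x V t - w = (-1) *: w + covariant (gram k) x V t.
  by rewrite scaleN1r addrC.
rewrite dancing_linl// mulN1r addrC; apply/eqP; rewrite subr_eq0; apply/eqP.
rewrite /covariant -[derive1 V t]scale1r dancing_linl// mul1r.
rewrite -[dancing _ (L (\row_l _)) _](gramE r0) (christoffel_gram r0 (derive1 x t) (V t) u).
rewrite -(koszul (L (derive1 x t)) (L (V t)) (L (derive1 V t)) (L u) r0).
by rewrite [L w]surjective_pairing w1 w2.
Qed.

End Covariant.

Opaque covariant chart.

(** * Covariant derivative of a section of the graph *)

Section GraphDerivative.
Variable R : realType.
Implicit Types (q v : 'cV[R]_3) (p l : 'rV[R]_3).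

(** Project a and b along q to the kernel of p: the cross product of the projections is a multiple
    of p. *)
Lemma cross_slide p q a b :
  pairing p q *: cross a b =
  pairing p a *: cross q b - pairing p b *: cross q a + det3 q a b *: p.
Proof. by vec; rewrite det3E; ring. Qed.

(** In the product rule, q' x v is rewritten modulo p by [cross_slide]. Its component (p q' / r) q x
    v, a second such term from the connection on v, and the term in p' q from the connection on l
    make up [K]. *)
Lemma graph_derivative p p1 q q1 v v1 l l1 (mu mu1 c c1 K : R) (r := pairing p q) :
  r != 0 -> l = mu *: cross q v + c *: p ->
  l1 = mu1 *: cross q v + mu *: (cross q1 v + cross q v1) + (c1 *: p + c *: p1) ->
  K = mu1 + 2 * mu * (pairing p q1 / r) - mu * (pairing p1 q / r) ->
  exists d, l1 - (pairing p1 q / r) *: l - (pairing l q / r) *: p1 =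
    mu *: cross q (v1 - (pairing p q1 / r) *: v - (pairing p v / r) *: q1)
    + K *: cross q v + d *: p.
Proof.
move=> r0 lE -> ->; exists (mu * det3 q q1 v / r + c1 - pairing p1 q / r * c).
have -> : pairing l q = c * r by rewrite lE !pairing_lin pairing_cross det3_aba mulr0 add0r.
rewrite mulfK// lE {lE}.
have -> : cross q1 v = (pairing p q1 / r) *: cross q v - (pairing p v / r) *: cross q q1
    + (det3 q q1 v / r) *: p.
  apply: (scalerI r0); rewrite /r cross_slide !scalerDr scalerN !scalerA.
  by rewrite ![pairing p q * _]mulrC !divfK.
rewrite !crossDr !crossNr !crossZr.
move: (pairing p1 q) (pairing p v) (pairing p q1) (det3 q q1 v) => A1 A2 A3 A4.
move: (cross q v1) (cross q q1) (cross q v) => X Y Z; clearbody r.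
by apply/matrixP => i j; rewrite !(entD, entN, entZ); field.
Qed.

End GraphDerivative.

Section GraphPlane.
Variable R : realType.
Variable k : 'I_3 * 'I_3.
Implicit Types (u w : 'rV[R]_(2 + 2)).
Local Notation L := (dunchart k).

Lemma dunchart1_eq u w : lsubmx u = lsubmx w -> (L u).1 = (L w).1.
Proof.
move=> e; apply/matrixP => i j; rewrite (ord1 j); move: i.
apply: (unlift_ind (i := k.1)) => [|b]; first by rewrite !dunchart1_diag.
by rewrite !dunchart1_lift e.
Qed.

Lemma dunchart2_eq u w : rsubmx u = rsubmx w -> (L u).2 = (L w).2.
Proof.
move=> e; apply/matrixP => i j; rewrite (ord1 i); move: j.
apply: (unlift_ind (i := k.2)) => [|b]; first by rewrite !dunchart2_diag.
by rewrite !dunchart2_lift e.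
Qed.

Definition chart_vector (c : 'I_2) : 'cV[R]_3 := (L (row_mx (delta_mx 0 c) 0)).1.
Local Notation f_ := chart_vector.

Lemma chart_vector_diag c : f_ c k.1 0 = 0.
Proof. exact: dunchart1_diag. Qed.

Lemma chart_vector_lift c a : f_ c (lift k.1 a) 0 = (a == c)%:R.
Proof. by rewrite dunchart1_lift row_mxKl mxE eqxx. Qed.

Lemma dunchart1_expand u : (L u).1 = \sum_c lsubmx u 0 c *: f_ c.
Proof.
apply/matrixP => i j; rewrite (ord1 j) sum2 /= [RHS]entD ![in RHS]entZ; move: i.
apply: (unlift_ind (i := k.1)) => [|b].
  by rewrite dunchart1_diag !chart_vector_diag !mulr0 addr0.
rewrite dunchart1_lift !chart_vector_lift; move: b.
by apply: lift2P; rewrite ?mulr1 ?mulr0 ?addr0 ?add0r.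
Qed.

Lemma pairing_chart_vector (l : 'rV[R]_3) c : pairing l (f_ c) = l 0 (lift k.1 c).
Proof.
rewrite pairingE (bigD1_ord k.1) //= chart_vector_diag mulr0 add0r (bigD1 c)//= big1.
  by rewrite addr0 chart_vector_lift eqxx mulr1.
by move=> a ac; rewrite chart_vector_lift (negPf ac) mulr0.
Qed.

Lemma det3_chart_vector (q : 'cV[R]_3) : q k.1 0 = 1 -> det3 q (f_ 0) (f_ 1) != 0.
Proof.
move=> q1; apply/eqP => /det3_eq0[l l0 [lq lf0 lf1]].
have l' c : l 0 (lift k.1 c) = 0.
  by move: c; apply: lift2P; rewrite -pairing_chart_vector.
move: lq; rewrite pairingE (bigD1_ord k.1) //= q1 mulr1 big1 ?addr0 => [lk|a _].
  move/eqP: l0; apply; apply/matrixP => i j; rewrite (ord1 i) ent0; move: j.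
  exact: (unlift_ind (i := k.1)).
by rewrite l' mul0r.
Qed.

Section AtPoint.
Variable x : 'rV[R]_(2 + 2).
Local Notation q := (unchart k x).1.
Local Notation p := (unchart k x).2.
Local Notation G := (gram k x).
Hypothesis r0 : pairing p q != 0.

Definition gram_block : 'M[R]_2 := ursubmx G.
Local Notation B := gram_block.

Lemma gram_null : G = null_gram B.
Proof.
rewrite /null_gram -{1}[G]submxK; congr block_mx.
- apply/matrixP => a b; rewrite !mxE dancingE//.
  rewrite ![(L (delta_mx _ (lshift _ _))).2]dunchart0r; last 2 first.
  + by apply/matrixP => i j; rewrite !mxE eq_rlshift andbF.
  + by apply/matrixP => i j; rewrite !mxE eq_rlshift andbF.
  by rewrite !pairing0l; field.
- by apply/matrixP => a b; rewrite !mxE dancingC.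
- apply/matrixP => a b; rewrite !mxE dancingE//.
  rewrite ![(L (delta_mx _ (rshift _ _))).1]dunchart0; last 2 first.
  + by apply/matrixP => i j; rewrite !mxE eq_lrshift andbF.
  + by apply/matrixP => i j; rewrite !mxE eq_lrshift andbF.
  by rewrite !pairing0r; field.
Qed.

Lemma gram_block_neq0 : \det B != 0.
Proof.
have := gram_unit r0; rewrite unitmxE unitfE gram_null det_null_gram.
by rewrite sqrf_eq0.
Qed.

Lemma gram_blockE u c : (rsubmx u *m B^T) 0 c =
  - (pairing (L u).2 (f_ c) - pairing (L u).2 q * pairing p (f_ c) / pairing p q)
  / pairing p q.
Proof.
pose w := row_mx 0 (rsubmx u) : 'rV[R]_(2 + 2).
have -> : (rsubmx u *m B^T) 0 c = ((row_mx (delta_mx 0 c) 0 : 'rV[R]_(2 + 2)) *m G *m w^T) 0 0.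
  rewrite gram_null /null_gram mul_row_block !mulmx0 !mul0mx !add0r addr0.
  rewrite tr_row_mx mul_row_col !mul0mx add0r -[RHS]entT !trmx_mul trmxK trmx_delta.
  by rewrite mulmxA -colE [RHS]mxE.
rewrite gramE// dancingE//.
have -> : (L w).1 = 0 by apply: dunchart0; rewrite row_mxKl.
have -> : (L (row_mx (delta_mx 0 c) 0)).2 = 0 :> 'rV[R]_3.
  by apply: dunchart0r; rewrite row_mxKr.
have -> : (L w).2 = (L u).2 by apply: dunchart2_eq; rewrite row_mxKr.
rewrite -/(f_ c) !pairing0l mul0r !add0r; field.
exact: r0.
Qed.

(* The self-dual null planes are the graphs of v |-> m q x v modulo p. *)
Lemma graph_iff u m :
  rsubmx u *m B^T = (- m * det3 q (f_ 0) (f_ 1) / pairing p q) *: (lsubmx u *m J2 R) <->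
  exists c, (L u).2 = m *: cross q (L u).1 + c *: p.
Proof.
have [q1 _] := unchart_diag k x; have s0 := det3_chart_vector q1.
have JE c : (lsubmx u *m J2 R) 0 c * det3 q (f_ 0) (f_ 1) = det3 q (L u).1 (f_ c).
  rewrite dunchart1_expand sum2 /= mxE sum2 /=.
  by move: c; apply: lift2P; move: (f_ 0) (f_ 1) (lsubmx u 0 0) (lsubmx u 0 1) => f0 f1 a0 a1;
    rewrite !J2E !det3E; comps; ring.
have E c : ((- m * det3 q (f_ 0) (f_ 1) / pairing p q) *: (lsubmx u *m J2 R)) 0 c =
    - (m * det3 q (L u).1 (f_ c)) / pairing p q.
  by rewrite entZ -JE; ring.
split=> [e|[c]]; last first.
  move=> e; apply/matrixP => i j; rewrite (ord1 i) E gram_blockE; move: e.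
  move: (L u).1 (L u).2 (f_ j) => v l f ->.
  by rewrite !pairing_lin !pairing_cross det3_aba; field.
exists (pairing (L u).2 q / pairing p q); apply/eqP; rewrite -subr_eq0; apply/eqP.
have yf c : pairing (L u).2 (f_ c) = m * det3 q (L u).1 (f_ c)
    + pairing (L u).2 q / pairing p q * pairing p (f_ c).
  have := congr1 (fun M : 'rV[R]_2 => M 0 c) e; rewrite E gram_blockE.
  move: (pairing (L u).2 (f_ c)) (pairing (L u).2 q) (pairing p (f_ c)) (det3 q _ _) => A1 A2 A3 A4.
  move: (pairing p q) r0 => r r1 h.
  apply: (mulIf (x := - r^-1)); first by rewrite oppr_eq0 invr_eq0.
  apply/eqP; rewrite -subr_eq0; apply/eqP; move/eqP: h; rewrite -subr_eq0 => /eqP <-.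
  by field.
move: (f_ 0) (f_ 1) (yf 0) (yf 1) s0 => f0 f1; clear E JE e yf.
move: (L u).1 (L u).2 => v l yf0 yf1 s0; set y := (X in X = 0).
have yq : pairing y q = 0.
  by rewrite /y !pairing_lin pairing_cross det3_aba; field.
have y0 : pairing y f0 = 0 by rewrite /y !pairing_lin pairing_cross yf0; ring.
have y1 : pairing y f1 = 0 by rewrite /y !pairing_lin pairing_cross yf1; ring.
by apply: (scalerI s0); rewrite (det3_coexpand q f0 f1 y) yq y0 y1 !scale0r scaler0 !addr0.
Qed.

End AtPoint.
End GraphPlane.

Opaque gram_block chart_vector.

(** * The tangent plane of a normalized curve in a chart *)

Section CurveInChart.
Variable R : realType.
Variable k : 'I_3 * 'I_3.
Local Notation L := (dunchart k).
Local Notation z_ y := (unchart k y).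
Variables (J : set R) (x : R -> 'rV[R]_(2 + 2)).
Hypotheses (oJ : open J) (sx : smooth_on J x).
Variables (Q : R -> 'cV[R]_3) (P : R -> 'rV[R]_3) (phi chi al : R -> R).
Hypotheses (sQ : smooth_on J Q) (sP : smooth_on J P).
Hypotheses (sphi : smooth_on J phi) (schi : smooth_on J chi).
Hypothesis phi0 : forall t, J t -> phi t != 0.
Hypothesis chi0 : forall t, J t -> chi t != 0.
Hypothesis xE1 : forall t, J t -> (z_ (x t)).1 = phi t *: Q t.
Hypothesis xE2 : forall t, J t -> (z_ (x t)).2 = chi t *: P t.
Hypothesis PQ1 : forall t, J t -> pairing (P t) (Q t) = 1.
Hypothesis P'E : forall t, J t ->
  derive1 P t = cross (Q t) (derive1 Q t) + al t *: P t.
Hypothesis Q0 : forall t, J t -> cross (Q t) (derive1 Q t) != 0.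

Let r_neq0 t : J t -> pairing (z_ (x t)).2 (z_ (x t)).1 != 0.
Proof.
by move=> Jt; rewrite xE1// xE2// pairingZl pairingZr PQ1// mulr1 mulf_neq0 ?phi0 ?chi0.
Qed.

Lemma pairing_P'Q t : J t -> pairing (derive1 P t) (Q t) = al t.
Proof.
by move=> Jt; rewrite P'E// pairingDl pairingZl pairing_cross det3_aba add0r PQ1// mulr1.
Qed.

Lemma pairing_PQ' t : J t -> pairing (P t) (derive1 Q t) = - al t.
Proof.
exact: (pairing_PQ1 oJ sQ sP PQ1 P'E).
Qed.

Let dif_x (t : R) : J t ->
  (L (derive1 x t)).1 = derive1 phi t *: Q t + phi t *: derive1 Q t /\
  (L (derive1 x t)).2 = derive1 chi t *: P t + chi t *: derive1 P t.
Proof.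
have [d1 d2] := dif_dunchart k (smooth_dif sx).
have e1 s : J s -> (L (x s)).1 = phi s *: Q s + - (unchart k 0).1.
  by move=> Js; rewrite -xE1//; have [] := dunchartE k (x s).
have e2 s : J s -> (L (x s)).2 = chi s *: P s + - (unchart k 0).2.
  by move=> Js; rewrite -xE2//; have [] := dunchartE k (x s).
have d1' := dif_ext oJ (fun s Js => esym (e1 s Js))
  (difD (difZ (smooth_dif sphi) (smooth_dif sQ)) (dif_cst (- (unchart k 0).1))).
have d2' := dif_ext oJ (fun s Js => esym (e2 s Js))
  (difD (difZ (smooth_dif schi) (smooth_dif sP)) (dif_cst (- (unchart k 0).2))).
move=> Jt; split; first by rewrite (dif_unique d1 d1' Jt) addr0.
by rewrite (dif_unique d2 d2' Jt) addr0.
Qed.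

(** The factor mu of the chart representatives phi Q and chi P: in chi P' the covector Q x Q' is
    phi^-2 times the cross product of phi Q with its derivative. *)
Definition slope t := chi t * ((phi t)^-1 * (phi t)^-1).

Lemma slope_neq0 t : J t -> slope t != 0.
Proof. by move=> Jt; rewrite !mulf_neq0 ?invr_eq0 ?phi0 ?chi0. Qed.

Lemma cross_chart t : J t ->
  cross (z_ (x t)).1 (L (derive1 x t)).1 = phi t ^+ 2 *: cross (Q t) (derive1 Q t).
Proof.
move=> Jt; have [-> _] := dif_x Jt; rewrite xE1// crossZl crossDr !crossZr crossvv.
by rewrite scaler0 add0r scalerA -expr2.
Qed.

Lemma cross_chart_neq0 t : J t -> cross (z_ (x t)).1 (L (derive1 x t)).1 != 0.
Proof.
by move=> Jt; rewrite cross_chart// scaler_eq0 negb_or expf_neq0 ?phi0// Q0.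
Qed.

Lemma tangent_graph t : J t -> exists c,
  (L (derive1 x t)).2 = slope t *: cross (z_ (x t)).1 (L (derive1 x t)).1 + c *: (z_ (x t)).2.
Proof.
move=> Jt; exists (derive1 chi t / chi t + al t).
rewrite cross_chart// xE2//; have [_ ->] := dif_x Jt; rewrite P'E// /slope.
move: (phi0 Jt) (chi0 Jt); move: (derive1 chi t) (cross _ _) (phi t) (chi t) => A B C D C0 D0.
by apply/matrixP => i j; rewrite !(entD, entZ); field; rewrite C0 D0.
Qed.

(** In the [K] of [graph_derivative] the derivatives of phi and chi cancel against the logarithmic
    derivative of the slope. What remains is - 3 al times the slope, from P Q' = - al counted twice
    and P' Q = al once. *)
Lemma covariant_graph (V : R -> 'rV[R]_(2 + 2)) : smooth_on J V ->
    (forall t, J t -> exists c,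
       (L (V t)).2 = slope t *: cross (z_ (x t)).1 (L (V t)).1 + c *: (z_ (x t)).2) ->
  forall t, J t -> exists d, let W := covariant (gram k) x V t in
    (L W).2 = slope t *: cross (z_ (x t)).1 (L W).1
      + (- 3 * al t * chi t / phi t ^+ 2) *: cross (z_ (x t)).1 (L (V t)).1
      + d *: (z_ (x t)).2.
Proof.
move=> sV graph t Jt; cbv zeta.
have [W1 W2] := covariantE (k := k) (x := x) V (r_neq0 Jt).
rewrite W1 W2 {W1 W2}.
have dz1 : dif J (fun s => (z_ (x s)).1) (fun s => (L (derive1 x s)).1).
  have e s : J s -> (L (x s)).1 + (unchart k 0).1 = (z_ (x s)).1.
    by have [-> _] := dunchartE k (x s); rewrite subrK.
  have [d _] := dif_dunchart k (smooth_dif sx).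
  by apply: dif_eq (dif_ext oJ e (difD d (dif_cst (unchart k 0).1))) _ => s _; rewrite addr0.
have dz2 : dif J (fun s => (z_ (x s)).2) (fun s => (L (derive1 x s)).2).
  have e s : J s -> (L (x s)).2 + (unchart k 0).2 = (z_ (x s)).2.
    by have [_ ->] := dunchartE k (x s); rewrite subrK.
  have [_ d] := dif_dunchart k (smooth_dif sx).
  by apply: dif_eq (dif_ext oJ e (difD d (dif_cst (unchart k 0).2))) _ => s _; rewrite addr0.
have [dV1 dV2] := dif_dunchart k (smooth_dif sV).
(* The coefficient of p exists for each s separately; as a quotient of pairings it can be
   differentiated. *)
pose c s := pairing (L (V s)).2 (z_ (x s)).1 * (pairing (z_ (x s)).2 (z_ (x s)).1)^-1.
have cE s : J s -> (L (V s)).2 = slope s *: cross (z_ (x s)).1 (L (V s)).1 + c s *: (z_ (x s)).2.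
  move=> Js; have [c' E] := graph s Js; rewrite {1}E /c E.
  rewrite !pairing_lin pairing_cross det3_aba mulr0 add0r mulfK//; exact: r_neq0.
have dr := difV r_neq0 (dif_pairing dz2 dz1).
have dc : dif J c _ := difM (dif_pairing dV2 dz1) dr.
have dslope : dif J slope (fun s => derive1 chi s * ((phi s)^-1 * (phi s)^-1)
    + chi s * (2 * (- derive1 phi s * (phi s)^-1 * (phi s)^-1 * (phi s)^-1))).
  have sp := smooth_dif sphi; have sc := smooth_dif schi.
  by rewrite /slope; dif_tac => // s Js; ring.
have dV2' := dif_ext oJ (fun s Js => esym (cE s Js))
  (difD (difZ dslope (dif_cross dz1 dV1)) (difZ dc dz2)).
apply: (graph_derivative (r_neq0 Jt) (cE t Jt) (dif_unique dV2 dV2' Jt)).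
have [X1 X2] := dif_x Jt.
rewrite /slope X1 X2 (xE1 Jt) (xE2 Jt) !pairing_lin (pairing_P'Q Jt) (pairing_PQ' Jt) (PQ1 Jt).
move: (derive1 phi t) (derive1 chi t) (phi0 Jt) (chi0 Jt) => A B.
move: (phi t) (chi t) (al t) => C D E C0 D0.
by field; rewrite C0 D0.
Qed.

(** Pairing with q separates q x v from p. *)
Lemma graph_slope_eq0 (q v : 'cV[R]_3) (p : 'rV[R]_3) (m c : R) :
  pairing p q != 0 -> cross q v != 0 -> m *: cross q v = c *: p -> m = 0.
Proof.
move=> r0 v0 e; have : pairing (m *: cross q v) q = 0.
  by rewrite pairingZl pairing_cross det3_aba mulr0.
rewrite e pairingZl => /eqP; rewrite mulf_eq0 (negPf r0) orbF => /eqP c0.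
by move/eqP: e; rewrite c0 scale0r scaler_eq0 (negPf v0) orbF => /eqP.
Qed.

(** The velocity has two nonzero components, so the plane is a graph of some factor m, and the
    velocity itself forces m to be the slope. *)
Lemma self_dual_tangent_graph W t : J t -> self_dual_plane (gram k (x t)) W ->
    (derive1 x t <= W)%MS -> forall u, (u <= W)%MS -> exists c,
  (L u).2 = slope t *: cross (z_ (x t)).1 (L u).1 + c *: (z_ (x t)).2.
Proof.
move=> Jt sd xW u uW; have r0 := r_neq0 Jt; rewrite (gram_null r0) in sd.
have cn := cross_chart_neq0 Jt; have [c1 e1] := tangent_graph Jt.
have nz : (L (derive1 x t)).2 != 0.
  apply/eqP => e; have := slope_neq0 Jt.
  have -> : slope t = 0; last by rewrite eqxx.
  by apply: (graph_slope_eq0 (c := - c1) r0 cn); apply/eqP; rewrite scaleNr -addr_eq0 -e1 e.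
have lx : lsubmx (derive1 x t) != 0.
  apply: contra cn => /eqP /dunchart0 ->.
  by rewrite -(scale0r (0 : 'cV[R]_3)) crossZr scale0r.
have rx : rsubmx (derive1 x t) != 0 by apply: contra nz => /eqP /dunchart0r ->.
have [kap H] := self_dual_plane_graph (gram_block_neq0 r0) sd xW lx rx.
have [q1 _] := unchart_diag k (x t); have s0 := det3_chart_vector q1.
pose m := - (kap * pairing (z_ (x t)).2 (z_ (x t)).1
  / det3 (z_ (x t)).1 (chart_vector R k 0) (chart_vector R k 1)).
have kapE : kap = - m * det3 (z_ (x t)).1 (chart_vector R k 0) (chart_vector R k 1)
    / pairing (z_ (x t)).2 (z_ (x t)).1.
  by rewrite /m opprK divfK// mulfK.
have G w : (w <= W)%MS -> exists c,
    (L w).2 = m *: cross (z_ (x t)).1 (L w).1 + c *: (z_ (x t)).2.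
  by move=> wW; apply/(graph_iff r0); rewrite -kapE; exact: H.
have [c2 e2] := G _ xW.
have mE : m = slope t.
  apply/eqP; rewrite -subr_eq0; apply/eqP; apply: (graph_slope_eq0 (c := c1 - c2) r0 cn).
  by apply/eqP; rewrite !scalerBl subr_eq addrAC eq_sym subr_eq addrC -e1 e2 addrC.
by rewrite -mE; exact: G.
Qed.

(** The first row of W is a section V whose covariant derivative must lie in the graph; the extra
    term of [covariant_graph] is then a multiple of p and vanishes. *)
Lemma parallel_plane_al0 (W : R -> 'M[R]_(2, 2 + 2)) : smooth_on J W ->
    (forall t, J t -> [/\ row_free (W t), self_dual_plane (gram k (x t)) (W t),
       (derive1 x t <= W t)%MS
     & forall a : 'I_2, (covariant (gram k) x (fun s => row a (W s)) t <= W t)%MS]) ->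
  forall t, J t -> al t = 0.
Proof.
move=> sW H t Jt; have r0 := r_neq0 Jt.
have G s : J s -> forall u, (u <= W s)%MS -> exists c,
    (L u).2 = slope s *: cross (z_ (x s)).1 (L u).1 + c *: (z_ (x s)).2.
  by move=> Js; have [_ sd xW _] := H s Js; exact: self_dual_tangent_graph.
pose V s := row 0 (W s).
have sV : smooth_on J V.
  apply/(smooth_mxP _ oJ) => i j; under eq_fun do rewrite mxE.
  by move/(smooth_mxP _ oJ): sW => /(_ 0 j).
have GV s : J s -> exists c,
    (L (V s)).2 = slope s *: cross (z_ (x s)).1 (L (V s)).1 + c *: (z_ (x s)).2.
  by move=> Js; apply: G => //; exact: row_sub.
have [d] := covariant_graph sV GV Jt; cbv zeta => e.
have [fW _ _ /(_ 0) cW] := H t Jt; have [c e'] := G t Jt _ cW.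
have [q1 p1] := unchart_diag k (x t).
(* If q x v were zero, the entry 0 at k.1 would force v = 0, then the graph would force V = 0,
   against the independence of the rows. *)
have vn : cross (z_ (x t)).1 (L (V t)).1 != 0.
  apply/eqP => v0.
  have q0 : (z_ (x t)).1 != 0.
    by apply/eqP => q0; move: q1; rewrite q0 ent0 => /eqP; rewrite eq_sym oner_eq0.
  have [b eb] := cross_eq0 q0 v0.
  have b0 : b = 0.
    have := congr1 (fun v : 'cV[R]_3 => v k.1 0) eb.
    by rewrite dunchart1_diag entZ q1 mulr1.
  have [c' e2] := GV t Jt; rewrite v0 scaler0 add0r in e2.
  have c'0 : c' = 0.
    have := congr1 (fun v : 'rV[R]_3 => v 0 k.2) e2.
    by rewrite dunchart2_diag entZ p1 mulr1.
  have V0 : V t = 0.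
    rewrite -[V t]hsubmxK (@dunchart_inj1 _ k) ?eb ?b0 ?scale0r//.
    by rewrite (@dunchart_inj2 _ k) ?e2 ?c'0 ?scale0r// row_mx0.
  have : (delta_mx 0 0 : 'rV[R]_2) *m W t = 0 *m W t by rewrite -rowE mul0mx.
  move/(row_free_inj fW)/matrixP/(_ 0 0); rewrite !mxE !eqxx => /eqP.
  by rewrite oner_eq0.
have K0 : - 3 * al t * chi t / phi t ^+ 2 = 0.
  apply: (graph_slope_eq0 (c := c - d) r0 vn).
  by apply/eqP; rewrite scalerBl eq_sym subr_eq; move: e; rewrite e' -addrA => /addrI ->.
move/eqP: K0; rewrite !mulf_eq0 invr_eq0 oppr_eq0 pnatr_eq0 expf_eq0.
by rewrite (negPf (phi0 Jt)) (negPf (chi0 Jt)) /= !orbF => /eqP.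
Qed.

Lemma graph_sub (B S : 'M[R]_2) (m : R) (u : 'rV[R]_(2 + 2)) : \det B != 0 ->
    S *m B^T = m *: J2 R -> rsubmx u *m B^T = m *: (lsubmx u *m J2 R) ->
  (u <= row_mx 1%:M S)%MS.
Proof.
move=> B0 eS eu; have uB : B^T \in unitmx by rewrite unitmx_tr unitmxE unitfE.
apply/submxP; exists (lsubmx u); rewrite mul_mx_row mulmx1 -[u in LHS]hsubmxK.
congr row_mx; apply: (can_inj (mulmxK uB)).
by rewrite eu -mulmxA eS scalemxAr.
Qed.

Lemma al0_parallel_plane : (forall t, J t -> al t = 0) ->
  exists2 W : R -> 'M[R]_(2, 2 + 2), smooth_on J W & forall t, J t ->
    [/\ null_plane (gram k (x t)) (W t), self_dual_plane (gram k (x t)) (W t),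
        (derive1 x t <= W t)%MS
      & forall a : 'I_2, (covariant (gram k) x (fun s => row a (W s)) t <= W t)%MS].
Proof.
move=> al0; pose f c := chart_vector R k c.
pose n s a := cross (z_ (x s)).1 (f a).
(* The multiple of p makes the entry k.2 zero, as a chart vector requires. *)
pose l s a := slope s *: (n s a - n s a 0 k.2 *: (z_ (x s)).2).
pose S s : 'M[R]_2 := \matrix_(a, b) l s a 0 (lift k.2 b).
pose W s := row_mx 1%:M (S s) : 'M[R]_(2, 2 + 2).
have W1 s a : (L (row a (W s))).1 = f a.
  apply: dunchart1_eq; rewrite row_row_mx !row_mxKl.
  by apply/matrixP => i j; rewrite !mxE (ord1 i) eq_sym.
have W2 s a : (L (row a (W s))).2 = l s a.
  have [_ p1] := unchart_diag k (x s).
  apply/matrixP => i j; rewrite (ord1 i); move: j; apply: (unlift_ind (i := k.2)) => [|b].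
    by rewrite dunchart2_diag entZ entD entN entZ p1 mulr1 subrr mulr0.
  by rewrite dunchart2_lift row_row_mx row_mxKr !mxE.
have graph s a : exists c,
    (L (row a (W s))).2 = slope s *: cross (z_ (x s)).1 (L (row a (W s))).1 + c *: (z_ (x s)).2.
  exists (- (slope s * n s a 0 k.2)).
  by rewrite W1 W2 /l scalerBr scalerA scaleNr.
have sz1 : smooth_on J (fun s => (z_ (x s)).1).
  apply: smooth_ext oJ (fun s Js => esym (xE1 Js)) _; smooth_tac.
have sz2 : smooth_on J (fun s => (z_ (x s)).2).
  apply: smooth_ext oJ (fun s Js => esym (xE2 Js)) _; smooth_tac.
have sl a : smooth_on J (fun s => l s a).
  have sn : smooth_on J (fun s => n s a).
    refine (smooth_cross oJ sz1 _); apply/(smooth_mxP _ oJ) => i j.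
    refine (@smooth_cst R J _ oJ).
  have snk := (smooth_mxP _ oJ).1 sn 0 k.2.
  rewrite /l /slope; smooth_tac.
have sW : smooth_on J W.
  apply/(smooth_mxP _ oJ) => i j; rewrite -(splitK j); case: (fintype.split j) => b /=.
    have -> : (fun s => W s i (lshift 2 b)) = fun=> (1%:M : 'M[R]_2) i b.
      by apply/funext => s; rewrite row_mxEl.
    refine (@smooth_cst R J _ oJ).
  under eq_fun do rewrite row_mxEr mxE.
  exact: ((smooth_mxP _ oJ).1 (sl i) 0 (lift k.2 b)).
exists W => // t Jt; have r0 := r_neq0 Jt; have B0 := gram_block_neq0 r0.
pose kap := - slope t * det3 (z_ (x t)).1 (f 0) (f 1) / pairing (z_ (x t)).2 (z_ (x t)).1.
have SB : S t *m (gram_block k (x t))^T = kap *: J2 R.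
  apply/row_matrixP => a; rewrite row_mul.
  have /(graph_iff r0) := graph t a.
  rewrite row_row_mx row_mxKl row_mxKr => ->.
  by rewrite -/kap row1 [RHS]rowE -scalemxAr.
have sub u : (exists c, (L u).2 = slope t *: cross (z_ (x t)).1 (L u).1 + c *: (z_ (x t)).2) ->
    (u <= W t)%MS.
  by move=> /(graph_iff r0); exact: graph_sub SB.
have sd := graph_self_dual_plane B0 SB; rewrite -(gram_null r0) in sd.
split.
- split.
    apply/row_freeP; exists (col_mx 1%:M 0).
    by rewrite mul_row_col mulmx1 mulmx0 addr0.
  rewrite gram_null// /null_gram tr_row_mx mul_row_block mul_row_col trmx1.
  rewrite mulmx0 add0r mulmx0 addr0 mul1mx !mulmx1.
  by rewrite SB -[gram_block _ _]trmxK -trmx_mul SB linearZ /= J2T scalerN subrr.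
- exact: sd.
- by apply: sub; exact: tangent_graph.
- move=> a; apply: sub.
  have sV : smooth_on J (fun s => row a (W s)).
    apply/(smooth_mxP _ oJ) => i j; under eq_fun do rewrite mxE.
    by move/(smooth_mxP _ oJ): sW => /(_ a j).
  have [d] := covariant_graph sV (fun s _ => graph s a) Jt; cbv zeta => ->.
  by exists d; rewrite al0// mulr0 !mul0r scale0r addr0.
Qed.

End CurveInChart.

(** * Parallel tangent planes *)

Lemma open_nonvanishing (R : realType) (J : set R) (h : R -> R) : open J ->
  smooth_on J h -> open (J `&` [set t | h t != 0]).
Proof.
move=> oJ sh; rewrite openE => t [Jt ht].
have ct : h s @[s --> t] --> h t := smooth_continuous sh Jt.
apply: (filterI (F := nbhs t)); first exact: (open_nbhs_nbhs (conj oJ Jt)).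
exact: (cvgr_neq0 _ ct ht).
Qed.

Section ParallelPlane.
Variables (R : realType) (I : set R).
Hypothesis oI : open I.
Variables (q : R -> 'cV[R]_3) (p : R -> 'rV[R]_3).
Hypotheses (sq : smooth_on I q) (sp : smooth_on I p).
Hypothesis d0 : forall t, I t -> det3 (q t) (derive1 q t) (derive1 (derive1 q) t) != 0.
Variables mu a f g al : R -> R.
Hypothesis nz : normalization I q p mu a f g al.

Let Q t := f t *: q t.
Let P t := g t *: p t.

Section Chart.
Variable k : 'I_3 * 'I_3.
Let J := I `&` [set t | in_chart k (q t) (p t)].
Let x t := chart k (q t) (p t).
(** With [chi], it rescales Q and P to the representatives whose entries k.1 and k.2 are 1. *)
Let phi t := (f t * q t k.1 0)^-1.
Let chi t := (g t * p t 0 k.2)^-1.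

Let JI : J `<=` I. Proof. by move=> t []. Qed.
Let sqi i : smooth_on I (fun t => q t i 0). Proof. exact: ((smooth_mxP _ oI).1 sq i 0). Qed.
Let spi i : smooth_on I (fun t => p t 0 i). Proof. exact: ((smooth_mxP _ oI).1 sp 0 i). Qed.

Let oJ : open J.
Proof.
have oJ1 := open_nonvanishing oI (@sqi k.1).
have sp1 := smooth_sub (@subIsetl _ I [set t | q t k.1 0 != 0]) (@spi k.2).
have := open_nonvanishing oJ1 sp1.
by rewrite -setIA.
Qed.

Let qk t : J t -> q t k.1 0 != 0. Proof. by move=> [_ []]. Qed.
Let pk t : J t -> p t 0 k.2 != 0. Proof. by move=> [_ []]. Qed.
Let f0 t : J t -> f t != 0. Proof. by move=> /JI /(nz_neq0 nz) []. Qed.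
Let g0 t : J t -> g t != 0. Proof. by move=> /JI /(nz_neq0 nz) []. Qed.
Let fq0 t : J t -> f t * q t k.1 0 != 0.
Proof. by move=> Jt; rewrite mulf_neq0 ?f0 ?qk. Qed.
Let gp0 t : J t -> g t * p t 0 k.2 != 0.
Proof. by move=> Jt; rewrite mulf_neq0 ?g0 ?pk. Qed.

Let sx : smooth_on J x.
Proof.
have sq0 := smooth_sub JI (@sqi k.1); have sp0 := smooth_sub JI (@spi k.2).
apply/(smooth_mxP _ oJ) => i j; rewrite (ord1 i) -(splitK j).
case: (fintype.split j) => b /=.
  have sb := smooth_sub JI (@sqi (lift k.1 b)).
  have -> : (fun s => x s 0 (lshift 2 b)) = fun s => (q s k.1 0)^-1 * q s (lift k.1 b) 0.
    by apply/funext => s; have [-> _] := chart_lift k (q s) (p s) b.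
  smooth_tac.
have sb := smooth_sub JI (@spi (lift k.2 b)).
have -> : (fun s => x s 0 (rshift 2 b)) = fun s => (p s 0 k.2)^-1 * p s 0 (lift k.2 b).
  by apply/funext => s; have [_ ->] := chart_lift k (q s) (p s) b.
smooth_tac.
Qed.

Let sf : smooth_on J f. Proof. by have [_ _ sf _ _] := nz_smooth nz; exact: smooth_sub JI sf. Qed.
Let sg : smooth_on J g. Proof. by have [_ _ _ sg _] := nz_smooth nz; exact: smooth_sub JI sg. Qed.
Let sphi : smooth_on J phi.
Proof.
have s := smooth_sub JI (@sqi k.1); have h := sf; have h0 := fq0.
rewrite /phi; smooth_tac.
Qed.
Let schi : smooth_on J chi.
Proof.
have s := smooth_sub JI (@spi k.2); have h := sg; have h0 := gp0.
rewrite /chi; smooth_tac.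
Qed.
Let sQ : smooth_on J Q. Proof. exact: smooth_sub JI (smooth_Q oI sq nz). Qed.
Let sP : smooth_on J P. Proof. exact: smooth_sub JI (smooth_P oI sp nz). Qed.
Let phi0 t : J t -> phi t != 0. Proof. by move=> Jt; rewrite invr_eq0 fq0. Qed.
Let chi0 t : J t -> chi t != 0. Proof. by move=> Jt; rewrite invr_eq0 gp0. Qed.
Let xE1 t : J t -> (unchart k (x t)).1 = phi t *: Q t.
Proof.
move=> Jt; rewrite unchart_chart; last by case: Jt.
by rewrite /phi /Q /= scalerA invfM mulrAC mulVf ?f0// mul1r.
Qed.
Let xE2 t : J t -> (unchart k (x t)).2 = chi t *: P t.
Proof.
move=> Jt; rewrite unchart_chart; last by case: Jt.
by rewrite /chi /P /= scalerA invfM mulrAC mulVf ?g0// mul1r.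
Qed.
Let PQ1 t : J t -> pairing (P t) (Q t) = 1.
Proof. by move=> /JI; exact: (normalized_PQ nz). Qed.
Let P'E t : J t -> derive1 P t = cross (Q t) (derive1 Q t) + al t *: P t.
Proof. by move=> /JI; exact: (normalized_P' sq sp nz). Qed.
Let Q0 t : J t -> cross (Q t) (derive1 Q t) != 0.
Proof. by move=> /JI /(det_Q oI sq d0 nz) /det3_neq0[]. Qed.

Definition chart_plane_al0 :=
  parallel_plane_al0 oJ sx sQ sP sphi schi phi0 chi0 xE1 xE2 PQ1 P'E Q0.

Definition al0_chart_plane :=
  al0_parallel_plane oJ sx sQ sP sphi schi phi0 chi0 xE1 xE2 PQ1 P'E.

End Chart.

Lemma al0_parallel : (forall t, I t -> al t = 0) -> parallel_self_dual_tangent_plane I q p.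
Proof.
move=> al0 k; apply: al0_chart_plane => t [It _].
exact: al0.
Qed.

Lemma parallel_al0 : (forall t, I t -> pairing (p t) (q t) != 0) ->
  parallel_self_dual_tangent_plane I q p -> forall t, I t -> al t = 0.
Proof.
move=> r0 par t It.
have [q0 _ _] := det3_neq0 (d0 It).
have [i qi] : exists i, q t i 0 != 0.
  apply/existsP; apply: contraNT q0; rewrite negb_exists => /forallP q0.
  apply/eqP/matrixP => i j; rewrite (ord1 j) ent0; apply/eqP; move: (q0 i).
  by rewrite negbK.
have [j pj] : exists j, p t 0 j != 0.
  apply/existsP; apply: contraNT (r0 t It); rewrite negb_exists => /forallP p0.
  rewrite pairingE big1// => j _; move: (p0 j); rewrite negbK => /eqP ->.
  by rewrite mul0r.
have [W sW H] := par (i, j).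
apply: (chart_plane_al0 sW _ (t := t)) => //.
by move=> s Js; have [[fr _] sd xW cW] := H s Js.
Qed.

End ParallelPlane.

(** * No-twist in terms of the normalized lifts *)

Section NoTwist.
Variables (R : realType) (I : set R).
Hypothesis oI : open I.
Variables (q : R -> 'cV[R]_3) (p : R -> 'rV[R]_3) (psi : R -> 'M[R]_3).
Hypotheses (sq : smooth_on I q) (sp : smooth_on I p).
Variables mu a f g al : R -> R.
Hypothesis nz : normalization I q p mu a f g al.
Hypothesis psiE : forall t, I t -> forall v, exists c,
  lin (psi t) v = mu t *: cross (q t) v + c *: p t.

Let Q t : 'cV[R]_3 := f t *: q t.
Let P t : 'rV[R]_3 := g t *: p t.
Let f0 t : I t -> f t != 0. Proof. by move=> /(nz_neq0 nz)[]. Qed.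
Let g0 t : I t -> g t != 0. Proof. by move=> /(nz_neq0 nz)[]. Qed.
Let mu0 t : I t -> mu t != 0. Proof. by move=> /(nz_neq0 nz)[]. Qed.
Let sf : smooth_on I f. Proof. by have [] := nz_smooth nz. Qed.
Let sg : smooth_on I g. Proof. by have [] := nz_smooth nz. Qed.
Let sQ : smooth_on I Q. Proof. exact: (smooth_Q oI sq nz). Qed.
Let sPT : smooth_on I (fun t => (P t)^T).
Proof. have := smooth_P oI sp nz; exact: smooth_tr. Qed.
Let spT : smooth_on I (fun t => (p t)^T). Proof. exact: smooth_tr. Qed.
Let sfi : smooth_on I (fun t => (f t)^-1). Proof. exact: smoothV. Qed.
Let sgi : smooth_on I (fun t => (g t)^-1). Proof. exact: smoothV. Qed.
Let fi0 t : I t -> (f t)^-1 != 0. Proof. by move=> It; rewrite invr_eq0 f0. Qed.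
Let gi0 t : I t -> (g t)^-1 != 0. Proof. by move=> It; rewrite invr_eq0 g0. Qed.

(** Modulo p, psi u is mu q x u while Q x u is f q x u. They represent the same direction, and
    changing the lifts does not affect parallel sections. *)
Lemma no_twist_dual_transport : no_twist I q p psi <-> dual_transport I Q P.
Proof.
have same (c : R -> 'cV[R]_3) u t : I t ->
    exists2 s : R, s != 0 & exists k, u t = s *: u t + k *: c t.
  by exists 1; rewrite ?oner_eq0//; exists 0; rewrite scale1r scale0r addr0.
split=> nt u pu.
- have pq : parallel_section I q u.
    apply: (parallel_section_scale oI sQ sfi fi0 _ pu (same Q u)) => t It.
    by rewrite /Q scalerA mulVf ?f0// scale1r.
  apply: (parallel_section_scale oI spT sg g0 _ (nt u pq)) => t It.
    by rewrite /P linearZ.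
  have [c e] := psiE It (u t); exists (f t / mu t).
    by rewrite mulf_neq0 ?invr_eq0 ?f0 ?mu0.
  exists (- (f t / mu t * c)); rewrite e /Q crossZl.
  have m0 := mu0 It; move: (cross _ _) => n.
  by apply/matrixP => i j; rewrite !(entT, entD, entZ); field.
- have pQ : parallel_section I Q u.
    by apply: (parallel_section_scale oI sq sf f0 _ pu (same q u)).
  apply: (parallel_section_scale oI sPT sgi gi0 _ (nt u pQ)) => t It.
    by rewrite /P linearZ /= scalerA mulVf ?g0// scale1r.
  have [c e] := psiE It (u t); exists (mu t / f t).
    by rewrite mulf_neq0 ?invr_eq0 ?f0 ?mu0.
  exists (c / g t); rewrite e /Q /P crossZl.
  have ff := f0 It; have gg := g0 It; move: (cross _ _) => n.
  by apply/matrixP => i j; rewrite !(entT, entD, entZ); field; rewrite gg ff.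
Qed.

End NoTwist.

(** * Proof of the theorem *)

Section Hypotheses.
Variables (R : realType) (I : set R).
Hypothesis oI : open I.

Lemma no_inflection_det3 (c : R -> 'cV[R]_3) : smooth_on I c -> no_inflection_on I c ->
  forall t, I t -> det3 (c t) (derive1 c t) (derive1 (derive1 c) t) != 0.
Proof.
move=> sc nc t It; apply/negP => /eqP /det3_eq0[l l0 [l1 l2 l3]]; apply: (nc t It).
exists l => //.
have dl (v : R -> 'cV[R]_3) : smooth_on I v ->
    dif I (fun s => pairing l (v s)) (fun s => pairing l (derive1 v s)).
  move=> sv; apply: dif_eq (dif_pairing (dif_cst l) (smooth_dif sv)) _ => s _.
  by rewrite pairing0l add0r.
have d1 := dl _ sc; have d2 := dl _ (smooth_derive1 sc).
case=> [|[|[|//]]] _; first exact: l1.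
  by rewrite derive1n1 (difE d1 It).
by rewrite derive1Sn derive1n1 (derive1_dif2 oI d1 d2 It).
Qed.

Lemma regular_dual (p : R -> 'rV[R]_3) : smooth_on I p ->
  regular_on I (fun t => (p t)^T) -> forall t, I t -> forall a : R, derive1 p t <> a *: p t.
Proof.
move=> sp preg t It a e; apply: (preg t It); exists a.
by rewrite subr0 (difE (dif_tr (smooth_dif sp)) It) e linearZ.
Qed.

(** No-slip makes the factor of psi relative to v |-> q x v the factor of q x q' in p' as well. *)
Lemma no_slip_decomposition (q : R -> 'cV[R]_3) (p : R -> 'rV[R]_3) (psi : R -> 'M[R]_3) t :
  in_PC (q t) (p t) (psi t) ->
  det3 (q t) (derive1 q t) (derive1 (derive1 q) t) != 0 ->
  same_tangent (p t) (lin (psi t) (derive1 q t)) (derive1 p t) ->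
  exists m, (exists a, derive1 p t = m *: cross (q t) (derive1 q t) + a *: p t) /\
    forall v, exists c, lin (psi t) v = m *: cross (q t) v + c *: p t.
Proof.
move=> PC d0 [a e]; have [m m0 h] := in_PC_cross PC d0.
have h' v : exists c, lin (psi t) v = m *: cross (q t) v + c *: p t.
  by have [c ec] := h v; exists c; rewrite -ec addrC subrK.
exists m; split=> //; have [c ec] := h' (derive1 q t); exists (c - a).
move/eqP: e; rewrite subr_eq => /eqP e; apply: (addrI (a *: p t)).
by rewrite -e ec scalerBl [in RHS]addrC -addrA subrK.
Qed.

End Hypotheses.

Theorem theorem1p7 (R : realType) (I : set R) (hIopen : open I)
    (hIint : is_interval I)
    (q : R -> 'cV[R]_3) (p : R -> 'rV[R]_3) (psi : R -> 'M[R]_3)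
    (hroll : rolling_curve I q p psi)
    (hqreg : regular_on I q) (hqinf : no_inflection_on I q)
    (hpreg : regular_on I (fun t => (p t)^T))
    (hpinf : no_inflection_on I (fun t => (p t)^T)) :
  [/\ (no_slip I q p psi /\ no_twist I q p psi ->
         null_with_parallel_plane I q p),
      (null_with_parallel_plane I q p ->
         (exists psi0 : R -> 'M[R]_3,
            [/\ rolling_curve I q p psi0, no_slip I q p psi0
              & no_twist I q p psi0]) /\
         (no_slip I q p psi -> no_twist I q p psi))
    & (null_with_parallel_plane I q p <-> projects_from_integral_curve I q p)].
Proof.
have [sq sp spsi PC] := hroll.
have r0 t : I t -> pairing (p t) (q t) != 0 by move=> /PC[].
have d0 := no_inflection_det3 hIopen sq hqinf.
have preg := regular_dual sp hpreg.
have nullP : null_curve I q p <-> forall t, I t ->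
    pairing (derive1 p t) (derive1 q t) * pairing (p t) (q t)
    = pairing (derive1 p t) (q t) * pairing (p t) (derive1 q t).
  by split=> h t It; apply/(dancing_self_eq0 _ _ (r0 t It)); exact: h.
have norm : null_curve I q p -> exists mu a f g al, normalization I q p mu a f g al.
  by move/nullP; exact: (normalization_exists hIopen hIint sq sp r0 d0 preg).
have slip_null : no_slip I q p psi -> null_curve I q p.
  move=> ns; apply/nullP => t It.
  have [m [[a e] _]] := no_slip_decomposition (PC t It) (d0 t It) (ns t It).
  exact: null_of_decomposition e.
(* The factor of [psi] equals [mu] because q x q' is nonzero modulo p. *)
have slip_psi mu a f g al : normalization I q p mu a f g al -> no_slip I q p psi ->
    forall t, I t -> forall v, exists c, lin (psi t) v = mu t *: cross (q t) v + c *: p t.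
  move=> nz ns t It v.
  have [m [[b e] /(_ v)[c ec]]] := no_slip_decomposition (PC t It) (d0 t It) (ns t It).
  exists c; rewrite ec; suff -> : m = mu t by [].
  have [_ qn _] := det3_neq0 (d0 t It).
  apply/eqP; rewrite -subr_eq0; apply/eqP.
  apply: (graph_slope_eq0 (c := a t - b) (r0 t It) qn).
  apply/eqP; rewrite !scalerBl subr_eq addrAC eq_sym subr_eq addrC.
  by rewrite -(nz_p' nz It) e addrC.
have transport mu a f g al : normalization I q p mu a f g al ->
    dual_transport I (fun t => f t *: q t) (fun t => g t *: p t) <->
    forall t, I t -> al t = 0.
  move=> nz; have [_ _ _ _ sal] := nz_smooth nz.
  have [E [A fr]] := framed_exists hIopen (smooth_Q hIopen sq nz) (det_Q hIopen sq d0 nz).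
  have PQ1 := @normalized_PQ _ _ _ _ _ _ _ _ _ nz.
  have P'E := @normalized_P' _ _ _ _ sq sp _ _ _ _ _ nz.
  split.
    exact: (al_eq0_of_dual_transport hIopen hIint (smooth_Q hIopen sq nz)
      (smooth_P hIopen sp nz) sal PQ1 P'E fr).
  exact: (dual_transport0 hIopen (smooth_Q hIopen sq nz) (smooth_P hIopen sp nz) sal PQ1 P'E fr).
split.
- move=> [ns nt]; have nc := slip_null ns; split; first exact: nc.
  have [mu [a [f [g [al nz]]]]] := norm nc.
  apply: (al0_parallel hIopen sq sp nz); apply/(transport _ _ _ _ _ nz).
  exact: ((no_twist_dual_transport hIopen sq sp nz (slip_psi _ _ _ _ _ nz ns)).1 nt).
- move=> [nc par]; have [mu [a [f [g [al nz]]]]] := norm nc.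
  have al0 := parallel_al0 hIopen sq sp d0 nz r0 par.
  have dt := (transport _ _ _ _ _ nz).2 al0.
  split; last first.
    move=> ns.
    exact: ((no_twist_dual_transport hIopen sq sp nz (slip_psi _ _ _ _ _ nz ns)).2 dt).
  (* With this factor, no-slip is the decomposition [nz_p'] of p'. *)
  exists (fun t => mu t *: skew (q t)).
  have psi0E t : I t -> forall v, exists c,
      lin (mu t *: skew (q t)) v = mu t *: cross (q t) v + c *: p t.
    by move=> It v; exists 0; rewrite lin_skew scale0r addr0.
  have [smu _ _ _ _] := nz_smooth nz.
  split.
  + split; [exact: sq|exact: sp| |].
      have sk : smooth_on I (fun t => skew (q t)).
        apply/(smooth_mxP _ hIopen) => i j; under eq_fun do rewrite mxE.
        have sc : smooth_on I (fun t => cross (q t) (delta_mx j 0 : 'cV[R]_3)).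
          refine (smooth_cross hIopen sq _); apply/(smooth_mxP _ hIopen) => i' j'.
          refine (@smooth_cst R I _ hIopen).
        exact: ((smooth_mxP _ hIopen).1 sc 0 i).
      exact: (smoothZ hIopen smu sk).
    by move=> t It; have [m0 _ _] := nz_neq0 nz It; exact: in_PC_skew (r0 t It) m0.
  + move=> t It; exists (- a t).
    by rewrite lin_skew (nz_p' nz It) opprD addrA subrr add0r scaleNr.
  + exact: ((no_twist_dual_transport hIopen sq sp nz psi0E).2 dt).
- split.
    move=> [nc par]; have [mu [a [f [g [al nz]]]]] := norm nc.
    exact: (projects_al0 hIopen sq sp nz (parallel_al0 hIopen sq sp d0 nz r0 par)).
  move=> pj; have nc : null_curve I q p.
    by apply/nullP; exact: (null_projects hIopen sq sp r0 pj).
  split; first exact: nc.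
  have [mu [a [f [g [al nz]]]]] := norm nc.
  exact: (al0_parallel hIopen sq sp nz (al0_projects hIopen sq sp d0 nz pj)).
Qed.
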